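(* Let $(M,\mathcal{T},I)$ be a weighted closed triangulated surface with $I\ge 0$, and let $\alpha\in\mathbb{R}$. For the Euclidean background geometry, the normalized combinatorial $\alpha$-Ricci flow is defined to be $$\frac{dr_i}{dt}=(R_{\alpha,av}-R_{\alpha,i})r_i,\qquad (\ast)$$ where $R_{\alpha,av}=\frac{2\pi\chi(M)}{\|r\|_\alpha^\alpha}$ if $\alpha\ne 0$ and $R_{\alpha,av}=\frac{2\pi\chi(M)}{N}$ if $\alpha=0$. (1) Along $(\ast)$ the $\alpha$-curvature $R_\alpha$ evolves according to $$\frac{dR_{\alpha,i}}{dt}=\Delta_\alpha R_{\alpha,i}+\alpha R_{\alpha,i}(R_{\alpha,i}-R_{\alpha,av}),$$ where the $\alpha$-Laplace operator is defined, with $u_i=\ln r_i$ and for $f\in C(V)$, by $$\Delta_\alpha f_i=\frac{1}{r_i^\alpha}\sum_{j=1}^N\Big(-\frac{\partial K_i}{\partial u_j}\Big)f_j=\frac{1}{r_i^\alpha}\sum_{j\sim i}\Big(-\frac{\partial K_i}{\partial u_j}\Big)(f_j-f_i).$$ (2) If the solution of $(\ast)$ stays in $\Omega$ and converges to an inversive distance circle packing metric $r^*\in\Omega$, then there exists a constant $\alpha$-curvature metric in $\Omega$, and $r^*$ is such a metric. (3) Suppose $\alpha\chi(M)\le 0$. If there exists a Euclidean inversive distance circle packing metric $r^*\in\Omega$ with constant $\alpha$-curvature, then the solution of $(\ast)$ develops no essential singularities in finite time and at time infinity. Furthermore, if the solution of $(\ast)$ develops no removable singularities in finite time, then the solution of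 $(\ast)$ exists for all time, converges exponentially fast to the constant $\alpha$-curvature metric $r^*\in\Omega$, and does not develop removable singularities at time infinity. (4) If $\alpha\chi(M)\le 0$ and there exists a Euclidean inversive distance circle packing metric $r^*\in\Omega$ with constant $\alpha$-curvature, then the solution of the extended combinatorial $\alpha$-Ricci flow $$\frac{dr_i}{dt}=(R_{\alpha,av}-\widetilde R_{\alpha,i})r_i$$ exists for all time and converges exponentially fast to $r^*\in\Omega$.
   Context: $M$ is a closed surface with a triangulation $\mathcal{T}=\{V,E,F\}$ (vertices, edges, faces), $V=\{1,\dots,N\}$; $i\sim j$ means $\{ij\}\in E$; $C(V)$ is the set of functions $V\to\mathbb{R}$. A weight is a function $I:E\to[0,+\infty)$ (written $I\ge0$), called the inversive distance. $\chi(M)$ is the Euler number and $\|r\|_\alpha^\alpha=\sum_{i=1}^N r_i^\alpha$. For $r\in\mathbb{R}^N_{>0}$ the Euclidean length of an edge $\{ij\}$ is $l_{ij}=\sqrt{r_i^2+r_j^2+2r_ir_jI_{ij}}$. The admissible space is $\Omega=\{r\in\mathbb{R}^N_{>0}: l_{ij}<l_{ik}+l_{kj},\ l_{ik}<l_{ij}+l_{jk},\ l_{jk}<l_{ji}+l_{ik}\ \text{for all faces }\triangle ijk\in F\}$; its elements are the Euclidean inversive distance circle packing metrics. For $r\in\Omega$, $\theta_i^{jk}$ is the inner angle at $i$ of the Euclidean triangle with edge lengths $l_{ij},l_{jk},l_{ik}$, $K_i=2\pi-\sum_{\triangle ijk\in F}\theta_i^{jk}$ (sum over faces having $i$ as a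 vertex), and the $\alpha$-curvature is $R_{\alpha,i}=K_i/r_i^\alpha$. A constant $\alpha$-curvature metric is an $r\in\Omega$ with $R_{\alpha,i}(r)$ independent of $i$. The flow $(\ast)$ is considered in $\Omega$, with initial value in $\Omega$; the extended flow is considered on $\mathbb{R}^N_{>0}$. Extended curvature: for any $r\in\mathbb{R}^N_{>0}$ and face $\triangle ijk$, $\widetilde\theta_i^{jk}=\theta_i^{jk}$ if the three strict triangle inequalities hold for $l_{ij},l_{jk},l_{ik}$; $\widetilde\theta_i^{jk}=\pi$ if $l_{jk}\ge l_{ik}+l_{ij}$; $\widetilde\theta_i^{jk}=0$ if $l_{ik}\ge l_{jk}+l_{ij}$ or $l_{ij}\ge l_{jk}+l_{ik}$. Set $\widetilde K_i=2\pi-\sum_{\triangle ijk\in F}\widetilde\theta_i^{jk}$ and $\widetilde R_{\alpha,i}=\widetilde K_i/r_i^\alpha$. Singularities: suppose the solution of the flow $(\ast)$ exists on $[0,\tau)$, $\tau\le+\infty$. It develops an essential singularity at time $\tau$ if there is $i\in V$ such that $r_i(t_n)\to 0$ for some sequence $t_n\to\tau$. It develops a removable singularity at $\tau$ if there is a sequence $t_n\to\tau$ such that $r(t_n)$ stays in a compact subset of $\mathbb{R}^N_{>0}$ and there is a face $\triangle ijk\in F$ whose triangle inequalities degenerate as $t_n\to\tau$. ''In finite time'' means $\tau<+\infty$, ''at time infinity'' means $\tau=+\infty$.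
   Formalization: In (3) and (4) the limit is the multiple c r* (c>0) with the same α-norm (product of radii if α=0) as the initial metric, since constant α-curvature is scale invariant and the flow preserves this size; c=1 if r* is so normalized. *)

(* Defs.v *)
From HB Require Import structures.
From mathcomp Require Import all_boot all_order all_algebra.
From mathcomp Require Import all_classical all_reals all_analysis.
Set Implicit Arguments.
Unset Strict Implicit.
Unset Printing Implicit Defensive.
Import Order.TTheory GRing.Theory Num.Theory.
Import numFieldNormedType.Exports.
Local Open Scope classical_set_scope.
Local Open Scope ring_scope.

                                                                              
                                                                            
                                                                          
                                                                    
Record triangulation (N : nat) := Triangulation {
  edges : {set {set 'I_N}};
  faces : {set {set 'I_N}};
  vertex_nonempty : (0 < N)%N;
  edge_card : forall e, e \in edges -> #|e| = 2%N;
  face_card : forall f, f \in faces -> #|f| = 3%N;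
  vertex_in_edge : forall i, exists2 e, e \in edges & i \in e;
  edge_of_face : forall f e : {set 'I_N},
    f \in faces -> e \subset f -> #|e| = 2%N -> e \in edges;
  edge_two_faces : forall e : {set 'I_N},
    e \in edges -> #|[set f in faces | e \subset f]| = 2%N;
  link_connected : forall i j k : 'I_N,
    [set i; j]%SET \in edges -> [set i; k]%SET \in edges ->
    connect (fun a b : 'I_N => [set i; a; b]%SET \in faces) j k;
  surface_connected : forall i j : 'I_N,
    connect (fun a b : 'I_N => [set a; b]%SET \in edges) i j
}.

Definition euler_char (N : nat) (T : triangulation N) : int :=
  N%:Z - #|edges T|%:Z + #|faces T|%:Z.

Definition adj_vertices (N : nat) (T : triangulation N) (i j : 'I_N) : bool :=
  [set i; j]%SET \in edges T.

Section Metric.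
Context {R : realType} {N : nat}.
Variables (T : triangulation N) (I : {set 'I_N} -> R).
Implicit Types (r u : 'rV[R]_N) (i j k : 'I_N).

Definition positive_radii : set 'rV[R]_N := [set r | forall i, 0 < r 0 i].

Definition edge_length r i j : R :=
  Num.sqrt (r 0 i ^+ 2 + r 0 j ^+ 2 + 2 * r 0 i * r 0 j * I [set i; j]%SET).

Definition nondegenerate r i j k : bool :=
  [&& edge_length r i j < edge_length r i k + edge_length r k j,
      edge_length r i k < edge_length r i j + edge_length r j k
    & edge_length r j k < edge_length r j i + edge_length r i k].

                                 
Definition admissible : set 'rV[R]_N :=
  [set r | positive_radii r /\
    forall i j k, [set i; j; k]%SET \in faces T -> nondegenerate r i j k].

                                                                  
Definition angle r i j k : R :=
  acos ((edge_length r i j ^+ 2 + edge_length r i k ^+ 2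
         - edge_length r j k ^+ 2)
        / (2 * edge_length r i j * edge_length r i k)).

                                                 
                                                     
Definition ext_angle r i j k : R :=
  if nondegenerate r i j k then angle r i j k
  else if edge_length r i k + edge_length r i j <= edge_length r j k then pi
  else 0.

                                                                           
Definition curvature_of (theta : 'rV[R]_N -> 'I_N -> 'I_N -> 'I_N -> R) r i : R :=
  2 * pi - \sum_(p : 'I_N * 'I_N |
                 (p.1 < p.2)%N && ([set i; p.1; p.2]%SET \in faces T))
              theta r i p.1 p.2.

Definition curvature := curvature_of angle.
Definition ext_curvature := curvature_of ext_angle.

Definition alpha_curvature (alpha : R) r i : R :=
  curvature r i / (r 0 i `^ alpha).
Definition ext_alpha_curvature (alpha : R) r i : R :=
  ext_curvature r i / (r 0 i `^ alpha).

Definition average_curvature (alpha : R) r : R :=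
  if alpha == 0 then 2 * pi * (euler_char T)%:~R / N%:R
  else 2 * pi * (euler_char T)%:~R / \sum_i r 0 i `^ alpha.

Definition constant_alpha_curvature (alpha : R) r : Prop :=
  admissible r /\
  exists c : R, forall i, alpha_curvature alpha r i = c.

                                                                 
Definition curvature_log i u : R := curvature (map_mx expR u) i.
Definition dcurvature r i j : R :=
  'D_(delta_mx 0 j) (curvature_log i) (map_mx (@ln R) r).

Definition alpha_laplace (alpha : R) r (f : 'I_N -> R) i : R :=
  (r 0 i `^ alpha)^-1 * \sum_j (- dcurvature r i j) * f j.

                                                                        
                                  
Definition alpha_size (alpha : R) r : R :=
  if alpha == 0 then \prod_i r 0 i else \sum_i r 0 i `^ alpha.

Definition flow_field (alpha : R) r : 'rV[R]_N :=
  \row_i ((average_curvature alpha r - alpha_curvature alpha r i) * r 0 i).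
Definition ext_flow_field (alpha : R) r : 'rV[R]_N :=
  \row_i ((average_curvature alpha r - ext_alpha_curvature alpha r i) * r 0 i).

                                                        
Definition time_interval (tau : \bar R) : set R :=
  [set t | 0 <= t /\ (t%:E < tau)%E].

                                                                           
Definition derivative_within (D : set R) (f : R -> R) (t l : R) : Prop :=
  (f s - f t) / (s - t) @[s --> within D (dnbhs t)] --> l.

Definition ode_solution (X : 'rV[R]_N -> 'rV[R]_N) (D : set 'rV[R]_N)
    (tau : \bar R) (r : R -> 'rV[R]_N) : Prop :=
  forall t, time_interval tau t ->
    D (r t) /\
    forall i, derivative_within (time_interval tau)
                (fun s => r s 0 i) t (X (r t) 0 i).

Definition flow_solution (alpha : R) :=
  ode_solution (flow_field alpha) admissible.
Definition ext_flow_solution (alpha : R) :=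
  ode_solution (ext_flow_field alpha) positive_radii.

                                                                             
                                             
Definition exists_for_all_time (sol : \bar R -> (R -> 'rV[R]_N) -> Prop)
    (r0 : 'rV[R]_N) : Prop :=
  (exists r : R -> 'rV[R]_N, sol +oo%E r /\ r 0 = r0) /\
  forall (tau : \bar R) (r : R -> 'rV[R]_N), (0 < tau)%E -> sol tau r -> r 0 = r0 ->
    exists r' : R -> 'rV[R]_N, sol +oo%E r' /\ forall t, time_interval tau t -> r' t = r t.

Definition converges_exponentially (r : R -> 'rV[R]_N) (rs : 'rV[R]_N) : Prop :=
  exists C lambda : R, 0 < lambda /\
    forall t i, 0 <= t -> `|r t 0 i - rs 0 i| <= C * expR (- (lambda * t)).

Definition times_to (tau : \bar R) (t_ : nat -> R) : Prop :=
  (forall n, time_interval tau (t_ n)) /\ (t_ n)%:E @[n --> \oo] --> tau.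

Definition essential_singularity (r : R -> 'rV[R]_N) (tau : \bar R) : Prop :=
  exists i (t_ : nat -> R), times_to tau t_ /\ r (t_ n) 0 i @[n --> \oo] --> 0.

                                                                           
                                           
Definition removable_singularity (r : R -> 'rV[R]_N) (tau : \bar R) : Prop :=
  exists t_ : nat -> R, times_to tau t_ /\
    (exists A : set 'rV[R]_N,
       [/\ compact A, A `<=` positive_radii & forall n, A (r (t_ n))]) /\
    exists i j k, [set i; j; k]%SET \in faces T /\
      edge_length (r (t_ n)) i k + edge_length (r (t_ n)) k j
        - edge_length (r (t_ n)) i j @[n --> \oo] --> 0.

End Metric.

(* Main.v *)
(** With [u_i = ln r_i], [W u = \sum_j exp (alpha u_j)] and [X = 2 pi chi], the
    extended flow is [u_i' = X / W u - K_i u * exp (- alpha u_i)], where the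
    extended curvature [K] is continuous, bounded, invariant under
    [u |-> u + c] and of sum [X].  In a nondegenerate face the derivatives of the
    angles in [u] form a symmetric matrix which is definite modulo scalings,
    although its off-diagonal entries may have either sign; in a degenerate face
    the angles are [0, 0, pi].  Hence [K] is monotone on all of [R^N], strictly so
    at an admissible point.

    A priori bound: when the radii of a proper set [A] of vertices are far smaller
    than the others, [\sum_(i in A) K_i u] is nearly constant and, by
    monotonicity, lies below its value at the constant curvature metric by a
    definite amount.  With [alpha chi <= 0] this forces the weight
    [\sum exp (alpha u_i)] of any small group of vertices to grow, so solutions
    stay in a box; Peano's theorem for a truncated field then yields global
    solutions.

    Convergence: for [h 0 = 0] and [h' y = exp (alpha y) y], the function
    [\sum_i exp (alpha v_i) h (u_i - v_i)], with [v] the constant curvature metric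
    of the same size, decays exponentially by strict monotonicity.  A solution of
    the original flow is one of the extended flow as long as it is admissible, and
    a first exit from the admissible set is a removable singularity. *)

Require Import Defs.
From HB Require Import structures.
From mathcomp Require Import all_boot all_order all_algebra.
From mathcomp Require Import all_classical all_reals all_analysis.
From mathcomp Require Import ring lra.
Set Implicit Arguments.
Unset Strict Implicit.
Unset Printing Implicit Defensive.
Import Order.TTheory GRing.Theory Num.Theory.
Import numFieldNormedType.Exports.
Local Open Scope classical_set_scope.
Local Open Scope ring_scope.

(** The extended angles are continuous but need not be Lipschitz where a triangle degenerates, so
    uniqueness of solutions is not at hand. Every claim is therefore proved for an arbitrary
    solution: a given one is continued past the end of its interval, and bounds and convergence
    never refer to the particular solution that Peano's theorem supplies.

    As the derivatives of [K_i] in the other [u_j] have no fixed sign, the smallest or largest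
    radius cannot be compared with its neighbours by a maximum principle. What survives is
    monotonicity of the whole curvature map, and it speaks about sums over groups of vertices; this
    is why the a priori bound follows all proper subsets at once instead of single vertices.

    The constant [c] of the conclusion has a geometric origin: constant curvature metrics come in
    rays, while the flow conserves [alpha_size], so the limit is the point of the ray through [rs]
    that has the size of the initial value. *)

(** * One-sided derivatives *)

(* The prefix [dw] stands for [derivative_within]. *)
Section OneSidedCalculus.
Variable R : realType.
Implicit Types (D : set R) (f g : R -> R) (t l : R).

Lemma within_le (T : Type) (F : set_system T) (A B : set T) : Filter F ->
  A `<=` B -> within A F `=>` within B F.
Proof.
move=> FF AB C; rewrite /within /=.
by apply: filterS => x BC /AB; exact: BC.
Qed.

(** Caratheodory's form: with the difference quotient extended to [t] by [l], the rules of calculus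
    become identities between quotients followed by limits of sums and products. *)
Lemma dwP D f t l : derivative_within D f t l <->
  exists g, [/\ forall s, f s - f t = g s * (s - t),
    g s @[s --> within D (nbhs t)] --> l & g t = l].
Proof.
split=> [fl|[g [fE gl gt]]].
  exists (fun s => if s == t then l else (f s - f t) / (s - t)); split.
  - move=> s; case: eqP => [->|/eqP]; first by rewrite !subrr mulr0.
    by rewrite -subr_eq0 => /divfK ->.
  - apply/cvgrPdist_le => e e0; have /cvgrPdist_le/(_ e e0) := fl.
    rewrite !near_withinE !near_simpl; apply: filterS => s fs Ds.
    case: eqP => [_|/eqP st]; first by rewrite subrr normr0 ltW.
    exact: fs.
  - by rewrite eqxx.
have {}gl : g s @[s --> within D (dnbhs t)] --> l.
  by apply: cvg_trans gl; apply: cvg_app => A AD;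
    exact: (@cvg_within _ (nbhs t) _ [set y | y != t] _ AD).
apply: cvg_trans gl; apply: near_eq_cvg; rewrite near_withinE near_withinE.
near=> s => st _ /=.
by rewrite fE mulfK // subr_eq0.
Unshelve. all: by end_near. Qed.

Lemma dw_cvg D f t l : derivative_within D f t l ->
  f s @[s --> within D (nbhs t)] --> f t.
Proof.
move=> /dwP[g [fE gl _]].
have s0 : (s - t) @[s --> within D (nbhs t)] --> (0 : R).
  by rewrite -(subrr t); apply: cvgB; [exact: cvg_within|exact: cvg_cst].
have fE' : f = (fun s => g s * (s - t) + f t).
  by apply/funext => s; rewrite -fE subrK.
rewrite [X in X @ _]fE' -[X in _ --> X]add0r -(mulr0 l).
by apply: cvgD; [exact: cvgM|exact: cvg_cst].
Qed.

Lemma dw_sub D D' f t l : D' `<=` D ->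
  derivative_within D f t l -> derivative_within D' f t l.
Proof.
move=> DD; rewrite /derivative_within => H; apply: cvg_trans H; by apply: cvg_app; apply: within_le.
Qed.

Lemma dw_eq D f g t l : D t -> (forall s, D s -> f s = g s) ->
  derivative_within D f t l -> derivative_within D g t l.
Proof.
move=> Dt fg; rewrite /derivative_within => H; apply: cvg_trans H; apply: near_eq_cvg.
by rewrite near_withinE; near=> s => Ds; rewrite !fg.
Unshelve. all: by end_near. Qed.

Lemma dw_ext D f g t l : f =1 g ->
  derivative_within D f t l -> derivative_within D g t l.
Proof. by move=> /funext ->. Qed.

Lemma dw_near_eq D f g t l : f t = g t ->
  (\forall s \near within D (nbhs t), f s = g s) ->
  derivative_within D f t l -> derivative_within D g t l.
Proof.
move=> fgt fg; rewrite /derivative_within => H; apply: cvg_trans H.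
apply: near_eq_cvg; move: fg; rewrite !near_withinE => fg.
have {}fg : (t^') (fun s => D s -> f s = g s).
  exact: (@cvg_within _ (nbhs t) _ [set y | y != t] _ fg).
by apply: filterS fg => s fgs Ds; rewrite fgs ?fgt.
Qed.

Lemma dw_cst D t (c : R) : derivative_within D (fun=> c) t 0.
Proof.
by apply/dwP; exists (fun=> 0); split=> // [s|]; [ring|exact: cvg_cst].
Qed.

Lemma dw_id D t : derivative_within D id t 1.
Proof.
by apply/dwP; exists (fun=> 1); split=> // [s|]; [ring|exact: cvg_cst].
Qed.

Lemma dw_comp D f g t l m : derivative_within D f t l ->
  is_derive (f t) 1 g m -> derivative_within D (fun s => g (f s)) t (m * l).
Proof.
move=> fl /is_derive1_caratheodory[h [gE hc hm]].
have fc := dw_cvg fl; case/dwP : fl => k [fE kl kt].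
apply/dwP; exists (fun s => h (f s) * k s); split.
- by move=> s; rewrite gE fE mulrA.
- by apply: cvgM => //; rewrite -hm; apply: (cvg_comp _ _ fc); exact: hc.
- by rewrite hm kt.
Qed.

Lemma dwD D f g t l m : derivative_within D f t l ->
  derivative_within D g t m -> derivative_within D (fun s => f s + g s) t (l + m).
Proof.
move=> /dwP[h [fE hl ht]] /dwP[k [gE kl kt]].
apply/dwP; exists (fun s => h s + k s); split.
- by move=> s; rewrite mulrDl -fE -gE; ring.
- exact: cvgD.
- by rewrite ht kt.
Qed.

Lemma dwM D f g t l m : derivative_within D f t l ->
  derivative_within D g t m ->
  derivative_within D (fun s => f s * g s) t (l * g t + f t * m).
Proof.
move=> fl; have fc := dw_cvg fl; move: fl.
move=> /dwP[h [fE hl ht]] /dwP[k [gE kl kt]].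
apply/dwP; exists (fun s => h s * g t + f s * k s); split.
- by move=> s; rewrite mulrDl -(mulrA (f s)) -gE mulrAC -fE; ring.
- by apply: cvgD; [apply: cvgM => //; exact: cvg_cst|exact: cvgM].
- by rewrite ht kt.
Qed.

Lemma dw_val D f t l m : l = m -> derivative_within D f t l ->
  derivative_within D f t m.
Proof. by move->. Qed.

Lemma dwZ D f t l (c : R) : derivative_within D f t l ->
  derivative_within D (fun s => c * f s) t (c * l).
Proof.
by move=> fl; apply: dw_val (dwM (dw_cst D t c) fl); rewrite mul0r add0r.
Qed.

Lemma dwN D f t l : derivative_within D f t l ->
  derivative_within D (fun s => - f s) t (- l).
Proof.
move=> /(dwZ (c := -1)); rewrite mulN1r.
congr (derivative_within _ _ _ _).
by apply/funext => s; rewrite mulN1r.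
Qed.

Lemma dwB D f g t l m : derivative_within D f t l ->
  derivative_within D g t m -> derivative_within D (fun s => f s - g s) t (l - m).
Proof. by move=> fl /dwN; exact: dwD. Qed.

Lemma dw_sum D (J : Type) (r : seq J) (P : pred J) (F : J -> R -> R) (L : J -> R) t :
  (forall j, P j -> derivative_within D (F j) t (L j)) ->
  derivative_within D (fun s => \sum_(j <- r | P j) F j s) t
    (\sum_(j <- r | P j) L j).
Proof.
move=> FL; elim: r => [|j r IH].
  rewrite big_nil; under eq_fun do rewrite big_nil; exact: dw_cst.
rewrite big_cons; under eq_fun do rewrite big_cons.
by case: ifPn => // Pj; apply: dwD => //; exact: FL.
Qed.

Lemma is_derive_dw D f t l : is_derive t 1 f l -> derivative_within D f t l.
Proof. by move=> fl; apply: dw_val (dw_comp (dw_id D t) fl); rewrite mulr1. Qed.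

Lemma dw_is_derive D f t l : nbhs t D -> derivative_within D f t l ->
  is_derive t 1 f l.
Proof.
move=> Dt /dwP[g [fE gl gt]]; apply/is_derive1_caratheodory.
exists g; split=> //; rewrite /prop_for /continuous_at gt.
apply: cvg_trans gl; apply: cvg_app => A DA.
by apply: filterS2 Dt DA => s Ds; apply.
Qed.

(** Points of the open interval are interior to [D], where the derivative within [D] is an ordinary
    one; at the ends continuity is enough. *)
Lemma dw_MVT D f df (a b : R) : a <= b -> `[a, b] `<=` D ->
  (forall t, D t -> derivative_within D f t (df t)) ->
  exists2 c, c \in `[a, b] & f b - f a = df c * (b - a).
Proof.
move=> ab abD fD; apply: MVT_segment => //.
  move=> x xab; have Dx : D x by apply: abD => /=; exact: subset_itv_oo_cc.
  apply: dw_is_derive (fD _ Dx).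
  apply: (@filterS _ (nbhs x) _ _ _ abD).
  near=> y; apply: subset_itv_oo_cc; near: y; exact: near_in_itvoo.
apply/subspace_continuousP => x xab.
have H := dw_cvg (fD _ (abD _ xab)); apply: cvg_trans H.
by apply: cvg_app; apply: within_le.
Unshelve. all: by end_near. Qed.

End OneSidedCalculus.

(** * Barriers and monotonicity from pointwise information on derivatives *)

Section Barriers.
Variable R : realType.
Implicit Types (D : set R) (f g : R -> R) (t l : R).

Lemma near_within_ball D t (P : set R) : (\forall s \near within D (nbhs t), P s) ->
  exists2 e : R, 0 < e & forall s, D s -> `|s - t| < e -> P s.
Proof.
rewrite near_withinE => /nbhs_ballP[e /= e0 eP]; exists e => // s Ds st.
by apply: eP => //; rewrite /ball /= distrC.
Qed.

(* At the first time at which some [f j] vanishes its derivative would have to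
   be nonpositive. *)
Lemma barrier (J : finType) (P : pred J) D (f df : J -> R -> R) :
  (forall t, D t -> 0 <= t /\ `[0, t] `<=` D) ->
  (forall j t, P j -> D t -> derivative_within D (f j) t (df j t)) ->
  (forall j, P j -> 0 < f j 0) ->
  (forall t j, P j -> D t -> (forall k, P k -> 0 <= f k t) -> f j t = 0 ->
     0 < df j t) ->
  forall t j, D t -> P j -> 0 < f j t.
Proof.
move=> Ditv fD f0 fz t1 j1 Dt1 Pj1; rewrite ltNge; apply/negP => fj1.
pose E := [set t | D t /\ exists2 j, P j & f j t <= 0].
have E1 : E t1 by split=> //; exists j1.
have hE : has_inf E.
  by split; [exists t1|exists 0 => t [/Ditv[]]].
pose t0 := inf E.
have t0le t : E t -> t0 <= t by move=> Et; apply: ge_inf => //; case: hE.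
have t00 : 0 <= t0 by apply: lb_le_inf; [exists t1|move=> t [/Ditv[]]].
have Dle t : 0 <= t -> t <= t1 -> D t.
  by move=> ? ?; apply: (Ditv _ Dt1).2; rewrite /= in_itv /= ; apply/andP.
have Dt0 : D t0 by apply: Dle => //; exact: t0le.
have fpos s j : P j -> 0 <= s -> s < t0 -> 0 < f j s.
  move=> Pj s0 st; rewrite ltNge; apply/negP => fs.
  have : E s by split; [apply: Dle => //; exact: le_trans (ltW st) (t0le _ E1)|exists j].
  by move=> /t0le; rewrite leNgt st.
have before (e : R) : 0 < e -> 0 < t0 -> exists s, [/\ D s, 0 <= s, s < t0 & `|s - t0| < e].
  move=> e0 t0p; exists (Num.max 0 (t0 - e / 2)).
  have s0 : 0 <= Num.max 0 (t0 - e / 2) by rewrite le_max lexx.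
  have st0 : Num.max 0 (t0 - e / 2) < t0.
    by rewrite gt_max t0p /= ltrBlDr ltrDl divr_gt0.
  split => //.
    by apply: Dle => //; exact: le_trans (ltW st0) (t0le _ E1).
  rewrite ltr0_norm ?subr_lt0// opprB ltrBlDr -ltrBlDl lt_max.
  by apply/orP; right; lra.
have f_ge0 k : P k -> 0 <= f k t0.
  move=> Pk; rewrite leNgt; apply/negP => fk.
  have [t0p|] := ltP 0 t0; last first.
    move=> t0n; move: fk; have -> : t0 = 0 by apply/eqP; rewrite eq_le t0n t00.
    by rewrite ltNge ltW// f0.
  have [e e0 He] := near_within_ball (cvgr_lt _ (dw_cvg (fD k _ Pk Dt0)) _ fk).
  have [s [Ds s0 st /He]] := before _ e0 t0p.
  by move=> /(_ Ds); rewrite ltNge ltW// fpos.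
(* Were all [f k] positive at the infimum [t0], they would stay positive on a neighbourhood, which
   contains times of [E]. *)
have [j Pj fj0] : exists2 j, P j & f j t0 <= 0.
  apply: contrapT => Hno.
  have fgt k : P k -> 0 < f k t0.
    by move=> Pk; rewrite ltNge; apply/negP => H; apply: Hno; exists k.
  have : \forall s \near within D (nbhs t0), forall k, P k -> 0 < f k s.
    apply: filter_forall => k.
    have [Pk|nPk] := boolP (P k); last exact: nearW.
    by apply: filterS (cvgr_gt _ (dw_cvg (fD k _ Pk Dt0)) _ (fgt _ Pk)).
  move=> H; have [e e0 He] := near_within_ball H.
  have [s Es ste] := inf_adherent e0 hE.
  have [Ds [k Pk]] := Es; rewrite leNgt => /negP; apply; apply: He => //.
  by rewrite ger0_norm ?subr_ge0 ?t0le// ltrBlDl.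
have fj : f j t0 = 0 by apply/eqP; rewrite eq_le fj0 f_ge0.
have t0p : 0 < t0.
  rewrite lt_neqAle t00 andbT; apply/eqP => t0E.
  by move: (f0 _ Pj); rewrite [X in f j X]t0E fj ltxx.
have dfj := fz _ _ Pj Dt0 f_ge0 fj.
have /dwP[g [fE gl gt]] := fD j _ Pj Dt0.
have [e e0 He] := near_within_ball (cvgr_gt _ gl _ dfj).
have [s [Ds s0 st se]] := before _ e0 t0p.
have := fE s; rewrite fj subr0 => fsE.
have := fpos s j Pj s0 st; rewrite fsE pmulr_rgt0 ?He//.
by rewrite subr_gt0 ltNge ltW.
Qed.

Lemma exists_notin (s : seq R) (a b : R) : a < b ->
  exists y, [/\ a < y, y < b & y \notin s].
Proof.
elim: s a b => [|v s IH] a b ab; first by exists ((a + b) / 2); split=> //; lra.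
have [vm|mv] := leP v ((a + b) / 2).
  have [|y [y1 y2 ys]] := IH ((a + b) / 2) b; first lra.
  exists y; split=> //; first lra.
  by rewrite inE negb_or ys andbT gt_eqF//; lra.
have [|y [y1 y2 ys]] := IH a ((a + b) / 2); first lra.
exists y; split=> //; first lra.
by rewrite inE negb_or ys andbT lt_eqF//; lra.
Qed.

(* Were [g] to increase from [a] to [b], it would take some value outside [s]
   for the last time while going up. *)
Lemma nonincr_off_finite (s : seq R) g :
  continuous g ->
  (forall t, g t \notin s -> exists2 l, l < 0 & is_derive t 1 g l) ->
  forall a b, a <= b -> g b <= g a.
Proof.
move=> gc gD a b ab; rewrite leNgt; apply/negP => gab.
have [y [ay yb ys]] := exists_notin s gab.
pose E := [set t | a <= t <= b /\ g t <= y].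
have Ea : E a by split; [rewrite lexx|rewrite ltW].
have hE : has_sup E by split; [exists a|exists b => t [/andP[]]].
pose c := sup E.
have cub t : E t -> t <= c by move=> Et; apply: ub_le_sup => //; case: hE.
have ac : a <= c by exact: cub.
have cb : c <= b by apply: ge_sup; [exists a|move=> t [/andP[]]].
have gcW t (P : set R) : (\forall s \near nbhs t, P s) ->
    exists2 e : R, 0 < e & forall s, `|s - t| < e -> P s.
  move=> tP; have [|e e0 H] := @near_within_ball setT t P.
    by rewrite near_withinE; near=> z => _; near: z.
  by exists e => // z; exact: H.
have gcy : g c <= y.
  rewrite leNgt; apply/negP => yc.
  have [e e0 He] := gcW _ _ (cvgr_gt _ (gc c) _ yc).
  have [t Et tc] := sup_adherent e0 hE.
  have : y < g t.
    by apply: He; rewrite ler0_norm ?subr_le0 ?cub// opprB ltrBlDr -ltrBlDl.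
  by rewrite ltNge; case: Et => _ ->.
have cltb : c < b.
  rewrite lt_neqAle cb andbT; apply/eqP => cE.
  by move: gcy; rewrite cE leNgt yb.
have after (e : R) : 0 < e -> exists z, [/\ c < z, z <= b & `|z - c| < e].
  move=> e0; exists (Num.min b (c + e / 2)).
  have cz : c < Num.min b (c + e / 2) by rewrite lt_min cltb ltrDl divr_gt0.
  split=> //; first by rewrite ge_min lexx.
  rewrite gtr0_norm ?subr_gt0// ltrBlDr gt_min; apply/orP; right; lra.
have gt_after z : c < z -> z <= b -> y < g z.
  move=> cz zb; rewrite ltNge; apply/negP => gz.
  have : E z by split=> //; rewrite zb andbT (le_trans ac)// ltW.
  by move=> /cub; rewrite leNgt cz.
have gcE : g c = y.
  apply/eqP; rewrite eq_le gcy leNgt; apply/negP => cy.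
  have [e e0 He] := gcW _ _ (cvgr_lt _ (gc c) _ cy).
  have [z [cz zb /He]] := after _ e0.
  by rewrite ltNge ltW// gt_after.
have [l l0 /is_derive1_caratheodory[h [hE' hc hl]]] : exists2 l, l < 0 & is_derive c 1 g l.
  by apply: gD; rewrite gcE.
have /gcW[e e0 He] : \forall s \near nbhs c, h s < 0.
  by apply: (cvgr_lt (h c)) => //; rewrite hl.
have [z [cz zb /He hz]] := after _ e0.
have := gt_after _ cz zb; rewrite -gcE -subr_gt0 hE' nmulr_rgt0//.
by rewrite subr_lt0 ltNge ltW.
Unshelve. all: by end_near. Qed.

Lemma dwU D D' f t l : derivative_within D f t l ->
  derivative_within D' f t l -> derivative_within (D `|` D') f t l.
Proof.
rewrite /derivative_within => H H' A lA.
have h : (t^') (fun s => D s -> A ((f s - f t) / (s - t))) := H A lA.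
have h' : (t^') (fun s => D' s -> A ((f s - f t) / (s - t))) := H' A lA.
by apply: filterS2 h h' => s ? ? [].
Qed.

(** By the mean value theorem the derivative at an end point is the limit of the derivatives. This
    is what allows two solutions to be glued. *)
Lemma dw_left_end f df (a b l : R) : a < b ->
  (forall t, a < t < b -> is_derive t 1 f (df t)) ->
  f s @[s --> b^'-] --> f b -> df s @[s --> b^'-] --> l ->
  derivative_within `]a, b] f b l.
Proof.
move=> ab fD fb dfl; apply/cvgrPdist_le => e e0.
have /cvgrPdist_le/(_ e e0) := dfl.
rewrite /at_left near_withinE => /nbhs_ballP[d /= d0 dP].
change (nbhs b (fun s => s != b -> `]a, b]%classic s ->
  `|l - (f s - f b) / (s - b)| <= e)).
apply/nbhs_ballP; exists d => //= s sd sb.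
rewrite in_itv /= => /andP[as_ sb'].
have {sb sb'}sb : s < b by rewrite lt_neqAle sb.
have [||x] := @MVT _ f df s b sb.
- move=> x; rewrite in_itv /= => /andP[sx xb]; apply: fD.
  by rewrite xb (lt_trans as_).
- apply/(continuous_within_itvP _ sb); split=> //.
    move=> x; rewrite in_itv /= => /andP[sx xb].
    have [|+ _] := fD x; first by rewrite xb (lt_trans as_).
    by move=> /derivable1_diffP/differentiable_continuous.
  have [|+ _] := fD s; first by rewrite as_.
  move=> /derivable1_diffP/differentiable_continuous.
  exact: cvg_at_right_filter.
rewrite in_itv /= => /andP[sx xb] fE.
have -> : (f s - f b) / (s - b) = df x.
  by rewrite -opprB fE -mulrN opprB mulfK// subr_eq0 lt_eqF.
apply: dP => //; rewrite /ball /= ger0_norm ?subr_ge0 ?ltW//.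
by move: sd; rewrite /ball /= ger0_norm ?subr_ge0 ?ltW//; lra.
Qed.

End Barriers.

(** * The arccosine extended continuously to the whole line *)

Section ClampedArccosine.
Variable R : realType.

Definition clamped_acos (x : R) : R := acos (Num.max (-1) (Num.min 1 x)).

Lemma clamp_itv (x : R) : -1 <= Num.max (-1) (Num.min 1 x) <= 1.
Proof. by rewrite le_max lexx /= ge_max ge_min lexx /= andbT; lra. Qed.

Lemma clamped_acosE (x : R) : -1 <= x <= 1 -> clamped_acos x = acos x.
Proof.
by move=> /andP[x1 x2]; rewrite /clamped_acos (min_idPr x2) (max_idPr x1).
Qed.

Lemma clamped_acos_ge1 (x : R) : 1 <= x -> clamped_acos x = 0.
Proof.
by move=> x1; rewrite /clamped_acos (min_idPl x1) max_r ?acos1//; lra.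
Qed.

Lemma clamped_acos_leN1 (x : R) : x <= -1 -> clamped_acos x = pi.
Proof.
move=> x1; rewrite /clamped_acos min_r; last by lra.
by rewrite (max_idPl x1) acosN1.
Qed.

Lemma clamped_acos_bound (x : R) : 0 <= clamped_acos x <= pi.
Proof. by rewrite acos_ge0 ?clamp_itv// acos_lepi ?clamp_itv. Qed.

Lemma continuous_clamp (a b : R) : continuous (fun y : R => Num.max a (Num.min b y)).
Proof.
move=> x; apply: (@continuous_max R R (fun=> a) (fun y => Num.min b y)).
  exact: cvg_cst.
by apply: (@continuous_min R R (fun=> b) id) => //; exact: cvg_cst.
Qed.

(** At -1 and 1 [acos] is not differentiable; its continuity up to the ends comes from its being the
    inverse of the continuous [cos] on [[0, pi]]. *)
Lemma continuous_clamped_acos : continuous clamped_acos.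
Proof.
move=> x.
have acosc : {within `[-1, 1], continuous (@acos R)}.
  have := @segment_can_ge_continuous R 0 pi (@cos R) (@acos R) (pi_ge0 R) _ (@cosK R).
  rewrite cos0 cospi; apply.
  by apply: continuous_subspaceT; exact: continuous_cos.
have clampc := @continuous_clamp (-1) 1 x.
have /subspace_continuousP/(_ _ (clamp_itv x)) H := acosc.
apply: cvg_trans H => A.
rewrite /= /within /= => HA.
have {}HA : nbhs x (fun y => `[(-1 : R), 1]%classic (Num.max (-1) (Num.min 1 y)) ->
    A (clamped_acos y)) := clampc _ HA.
by apply: filterS HA => y; apply; exact: clamp_itv.
Qed.

End ClampedArccosine.

(** * Peano's existence theorem *)

Section Peano.
Variable R : realType.

(** A cluster point of an ultrafilter is a limit, since each set or its complement belongs to the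
    ultrafilter. *)
Lemma ultra_cvg_compact (T : Type) (U : set_system T) (f : T -> R) (K : set R) :
  UltraFilter U -> compact K -> U [set t | K (f t)] ->
  exists p : R, f t @[t --> U] --> p.
Proof.
move=> FU cK fK.
have [p [_ Hp]] := cK (fmap f U) _ fK.
exists p => A pA.
have [//|nA] := in_ultra_setVsetC (f @^-1` A) FU.
have [y [ny yA]] := Hp (~` A) A nA pA.
by [].
Qed.

Lemma rV_near n (x : 'rV[R]_n) (P : set 'rV[R]_n) : (\forall y \near x, P y) ->
  exists2 d : R, 0 < d & forall y : 'rV[R]_n, (forall j, `|y 0 j - x 0 j| < d) -> P y.
Proof.
move=> /nbhs_ballP[d /= d0 dP]; exists d => // y yx; apply: dP.
by split=> // i j; rewrite !ord1 /ball /= distrC; exact: yx.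
Qed.

Variable N : nat.
Variables (X : 'rV[R]_N -> 'rV[R]_N) (B : R).
Hypothesis Xc : forall i, continuous (fun y => X y 0 i).
Hypothesis XB : forall y i, `|X y 0 i| <= B.
Variable x0 : 'rV[R]_N.

Let euler n k : 'rV[R]_N := iter k (fun z => z + n.+1%:R^-1 *: X z) x0.

(** Serves twice: [v = 0] and [e = B] give the Lipschitz bound of the polygon, and [v] the field at
    the limit point gives the derivative of the limit. *)
Let euler_step n k m i (v e : R) :
  (forall l, (l < m)%N -> `|X (euler n (k + l)) 0 i - v| <= e) ->
  `|euler n (k + m) 0 i - euler n k 0 i - m%:R / n.+1%:R * v| <= e * (m%:R / n.+1%:R).
Proof.
elim: m => [_|m IH H].
  by rewrite addn0 subrr mul0r mul0r subrr normr0 mulr0.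
have {}IH := IH (fun l lm => H l (leqW lm)).
rewrite addnS {1}/euler iterS -/(euler n (k + m)) !mxE.
have := H m (ltnSn m).
have n0 : 0 < n.+1%:R^-1 :> R by rewrite invr_gt0.
move: n0 IH; have -> : m.+1%:R = m%:R + 1 :> R by rewrite natr1.
rewrite !mulrDl mul1r.
move: (n.+1%:R^-1) (X _ _ _) (euler _ _ _ _) (euler _ _ _ _) (m%:R * _) => h a b c d h0 IH ae.
have -> : c + h * a - b - (d * v + h * v) = (c - b - d * v) + h * (a - v) by ring.
rewrite [e * _]mulrDr (le_trans (ler_normD _ _))// lerD//.
by rewrite normrM gtr0_norm// mulrC ler_pM2r.
Qed.

(** The polygon is sampled at the last node not after [t], without interpolation; the error is at
    most one step and vanishes in the limit. *)
Let idx n (t : R) : nat := Num.trunc (t * n.+1%:R).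
Let appr n t := euler n (idx n t).

Let idx_itv n (t : R) : 0 <= t ->
  (idx n t)%:R / n.+1%:R <= t /\ t < (idx n t)%:R / n.+1%:R + n.+1%:R^-1.
Proof.
move=> t0; have /truncn_itv/andP[] : 0 <= t * n.+1%:R by rewrite mulr_ge0.
rewrite -/(idx n t) => h1 h2; split; first by rewrite ler_pdivrMr.
by rewrite -[X in _ + X]mul1r -mulrDl ltr_pdivlMr// natr1.
Qed.

Let idx_le n (s t : R) : 0 <= s -> s <= t -> (idx n s <= idx n t)%N.
Proof. by move=> s0 st; apply: le_truncn; rewrite ler_pM2r. Qed.

Let euler_lip n k k' i : (k <= k')%N ->
  `|euler n k' 0 i - euler n k 0 i| <= B * ((k'%:R - k%:R) / n.+1%:R).
Proof.
move=> kk'; have := @euler_step n k (k' - k) i 0 B; rewrite subnKC// mulr0 subr0 natrB//.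
by apply => l _; rewrite subr0.
Qed.

Lemma peano : exists x : R -> 'rV[R]_N, x 0 = x0 /\
  forall t : R, 0 <= t -> forall i,
    derivative_within [set s | 0 <= s] (fun s => x s 0 i) t (X (x t) 0 i).
Proof.
have B0 (i : 'I_N) : 0 <= B by rewrite (le_trans _ (XB 0 i)).
(* Limits of Euler polygons along an ultrafilter avoid Ascoli's theorem. *)
have [U [FU sU]] := ultraFilterLemma (eventually_filter).
have xcvg (t : R) i : 0 <= t -> exists p : R, appr n t 0 i @[n --> U] --> p.
  move=> t0; apply: (@ultra_cvg_compact _ U _ `[x0 0 i - B * t, x0 0 i + B * t]).
    exact: segment_compact.
  apply: filterS filterT => n _ /=.
  rewrite in_itv /= -ler_distl /appr.
  have := @euler_lip n 0 (idx n t) i isT.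
  rewrite subr0 {2}/euler /= => /le_trans; apply.
  by apply: ler_wpM2l; [exact: B0 i|exact: (idx_itv n t0).1].
pose x t := \row_i lim (appr n t 0 i @[n --> U]).
have xlim (t : R) i : 0 <= t -> appr n t 0 i @[n --> U] --> x t 0 i.
  move=> t0; rewrite mxE; have [p px] := xcvg t i t0.
  by have /cvg_lim -> := px.
have Uinv : (n.+1%:R^-1 : R) @[n --> U] --> (0 : R).
  by move=> A /(@cvg_harmonic R); exact: sU.
exists x; split.
  apply/rowP => i; rewrite mxE.
  have -> : (fun n => appr n 0 0 i) = (fun=> x0 0 i).
    by apply/funext => n; rewrite /appr /idx mul0r truncn0.
  exact: lim_cst.
move=> t t0 i; have {}B0 := B0 i; set v := X (x t) 0 i.
(* Increments over [a <= b] near [t] are compared with [(b - a) * v]; the left and right difference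
   quotients are the cases [b = t] and [a = t]. *)
have key (e : R) : 0 < e -> exists2 d : R, 0 < d & forall a b, 0 <= a -> a <= b ->
    `|a - t| < d -> `|b - t| < d -> `|x b 0 i - x a 0 i - (b - a) * v| <= e * (b - a).
  move=> e0.
  have [d0 d00 d0P] : exists2 d : R, 0 < d &
      forall y : 'rV[R]_N, (forall j, `|y 0 j - x t 0 j| < d) -> `|v - X y 0 i| <= e.
    apply: rV_near; have H : X y 0 i @[y --> x t] --> v by exact: Xc.
    by move/cvgrPdist_le : H; apply.
  have B1 : 0 < 4 * (B + 1) by move: B0; lra.
  (* The nodes between [a] and [b] must lie within [d0] of [x t]. Half of [d0] is left for the
     convergence at [t], a quarter for moving at speed [B] during this time, a quarter for one step.
     As [B] may be 0, the divisor is [B + 1]. *)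
  exists (d0 / (4 * (B + 1))); first by rewrite divr_gt0.
  move=> a b a0 ab ad bd.
  have b0 := le_trans a0 ab.
  have H1 : \forall n \near U, forall j, `|appr n t 0 j - x t 0 j| < d0 / 2.
    apply: filter_forall => j.
    have /cvgrPdist_lt/(_ (d0 / 2)) := xlim t j t0.
    by rewrite divr_gt0// => /(_ isT); apply: filterS => n; rewrite distrC.
  have H2 : \forall n \near U, B * n.+1%:R^-1 < d0 / 4.
    apply: (cvgr_lt 0); last by rewrite divr_gt0.
    by rewrite -[X in _ --> X](mulr0 B); apply: cvgM => //; exact: cvg_cst.
  (* Rounding [a] and [b] to nodes changes the elapsed time by at most one step, which costs
     [(e + |v|) / (n + 1)]. *)
  have L1 : `|appr n b 0 i - appr n a 0 i - (b - a) * v| - (e + `|v|) * n.+1%:R^-1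
      @[n --> U] --> `|x b 0 i - x a 0 i - (b - a) * v| - (e + `|v|) * 0.
    apply: cvgB; last by apply: cvgM => //; exact: cvg_cst.
    apply: cvg_norm; apply: cvgB; last exact: cvg_cst.
    by apply: cvgB; exact: xlim.
  rewrite mulr0 subr0 in L1; apply: (cvgr_to_le L1).
  near=> n.
  have h1 : forall j, `|appr n t 0 j - x t 0 j| < d0 / 2 by near: n.
  have h2 : B * n.+1%:R^-1 < d0 / 4 by near: n.
  have iab := idx_le n a0 ab.
  have [a1 a2] := idx_itv n a0; have [b1 b2] := idx_itv n b0.
  have [t1 t2] := idx_itv n t0.
  pose m := (idx n b - idx n a)%N.
  have hm : `|(m%:R / n.+1%:R - (b - a)) : R| <= n.+1%:R^-1.
    rewrite /m natrB// mulrBl ler_norml; move: a1 a2 b1 b2.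
    move: (n.+1%:R^-1) ((idx n a)%:R / _) ((idx n b)%:R / _) => p1 p2 p3 *.
    by apply/andP; split; lra.
  have := @euler_step n (idx n a) m i v e.
  rewrite {1}/m subnKC// -/(appr n b) -/(appr n a) => /(_ _) H.
  have {}H : `|appr n b 0 i - appr n a 0 i - m%:R / n.+1%:R * v| <= e * (m%:R / n.+1%:R).
    apply: H => l lm; rewrite distrC; apply: d0P => j.
    have n0 : 0 < n.+1%:R^-1 :> R by rewrite invr_gt0.
    have qa : (idx n a)%:R / n.+1%:R <= (idx n a + l)%:R / n.+1%:R :> R.
      by rewrite ler_pM2r// ler_nat leq_addr.
    have qb : (idx n a + l)%:R / n.+1%:R <= (idx n b)%:R / n.+1%:R :> R.
      by rewrite ler_pM2r// ler_nat -(subnKC iab) leq_add2l ltnW.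
    have far : `|euler n (idx n a + l) 0 j - appr n t 0 j| <=
        B * `|(idx n a + l)%:R / n.+1%:R - (idx n t)%:R / n.+1%:R|.
      have [qt|qt] := leqP (idx n a + l) (idx n t).
        rewrite distrC (distrC (_ / _)) (le_trans (euler_lip _ _ qt))// mulrBl.
        by rewrite ler_wpM2l ?ler_norm// B0.
      rewrite (le_trans (euler_lip _ _ (ltnW qt)))// mulrBl.
      by rewrite ler_wpM2l ?ler_norm// B0.
    have near_idx : `|(idx n a + l)%:R / n.+1%:R - (idx n t)%:R / n.+1%:R| <=
        d0 / (4 * (B + 1)) + n.+1%:R^-1 :> R.
      move: ad bd qa qb a2 b1 t1 t2; rewrite !ltr_norml ler_norml.
      move: (_ / (4 * _)) ((idx n a + l)%:R / _) ((idx n a)%:R / _) => p4 p5 p6.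
      move: (n.+1%:R^-1) ((idx n b)%:R / _) ((idx n t)%:R / _) => p1 p2 p3.
      by move=> /andP[? _] /andP[_ ?] *; apply/andP; split; lra.
    have Bd : B * (d0 / (4 * (B + 1))) <= d0 / 4.
      rewrite mulrA ler_pdivrMr//.
      have -> : d0 / 4 * (4 * (B + 1)) = B * d0 + d0 by field.
      by rewrite lerDl ltW.
    have : `|euler n (idx n a + l) 0 j - appr n t 0 j| <= d0 / 4 + B * n.+1%:R^-1.
      rewrite (le_trans far)// (le_trans (ler_wpM2l B0 near_idx))// mulrDr.
      by rewrite lerD2r.
    move: (h1 j) h2.
    have -> : euler n (idx n a + l) 0 j - x t 0 j =
        (euler n (idx n a + l) 0 j - appr n t 0 j) + (appr n t 0 j - x t 0 j) by ring.
    move: (ler_normD (euler n (idx n a + l) 0 j - appr n t 0 j) (appr n t 0 j - x t 0 j)).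
    move: `|_| `|_ - appr n t 0 j| `|_ - x t 0 j| (B * _) => p1 p2 p3 p4.
    by lra.
  have -> : appr n b 0 i - appr n a 0 i - (b - a) * v =
     (appr n b 0 i - appr n a 0 i - m%:R / n.+1%:R * v) +
     (m%:R / n.+1%:R - (b - a)) * v by ring.
  rewrite lerBlDr (le_trans (ler_normD _ _))// normrM.
  have hv := ler_wpM2r (normr_ge0 v) hm.
  have : e * (m%:R / n.+1%:R - (b - a)) <= e * n.+1%:R^-1.
    by rewrite ler_pM2l// (le_trans (ler_norm _) hm).
  move: H hv; move: (n.+1%:R^-1) (m%:R / _) `|v| `|_ - (b - a)| `|_ - _ * v|.
  by move=> p1 p2 p3 p4 p5; lra.
apply/cvgrPdist_le => e e0; have [d d0 dP] := key e e0.
change (nbhs t (fun s => s != t -> 0 <= s -> `|v - (x s 0 i - x t 0 i) / (s - t)| <= e)).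
apply/nbhs_ballP; exists d => //= s st sNt s0.
have tt : `|t - t| < d by rewrite subrr normr0.
have {}st : `|s - t| < d by move: st; rewrite /ball /= distrC.
have st0 : s - t != 0 by rewrite subr_eq0.
have -> : v - (x s 0 i - x t 0 i) / (s - t) =
    - ((x s 0 i - x t 0 i - (s - t) * v) / (s - t)) by field.
rewrite normrN normrM normfV ler_pdivrMr ?normr_gt0//.
have [ts|lst] := leP t s.
  by rewrite (ger0_norm (_ : 0 <= s - t)) ?subr_ge0// dP.
rewrite (ltr0_norm (_ : s - t < 0)) ?subr_lt0// opprB -normrN.
have -> : - (x s 0 i - x t 0 i - (s - t) * v) = x t 0 i - x s 0 i - (t - s) * v by ring.
by rewrite dP// ltW.
Unshelve. all: by end_near. Qed.

End Peano.

(** * Extended angles of a face *)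

Section TriangleAngles.
Variable R : realType.
Implicit Types a b c x y z P Q S : R.

Definition cos_angle a b c : R := (b ^+ 2 + c ^+ 2 - a ^+ 2) / (2 * b * c).

(* The angle opposite to [a]; clamping the cosine yields the extended angle of
   a degenerate triangle. *)
Definition side_angle a b c : R := clamped_acos (cos_angle a b c).

Definition is_triangle a b c : bool := [&& a < b + c, b < c + a & c < a + b].

(** Sixteen times the squared area of the triangle. *)
Definition heron a b c : R :=
  4 * b ^+ 2 * c ^+ 2 - (b ^+ 2 + c ^+ 2 - a ^+ 2) ^+ 2.

Lemma heronE a b c :
  heron a b c = (a + b + c) * (b + c - a) * (c + a - b) * (a + b - c).
Proof. by rewrite /heron; ring. Qed.

Lemma heron_rot a b c : heron a b c = heron b c a.
Proof. by rewrite /heron; ring. Qed.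

Lemma cos_angleC a b c : cos_angle a b c = cos_angle a c b.
Proof. by rewrite /cos_angle [c ^+ 2 + _]addrC mulrAC. Qed.

Lemma is_triangle_rot a b c : is_triangle a b c = is_triangle b c a.
Proof. by rewrite /is_triangle; case: (a < _) => //=; rewrite ?andbT ?andbF. Qed.

Lemma heron_gt0 a b c : is_triangle a b c -> 0 < a -> 0 < b -> 0 < c ->
  0 < heron a b c.
Proof. by move=> /and3P[*]; rewrite heronE !mulr_gt0//; lra. Qed.

(** Once the positive denominator is cleared, [(b + c)^2 - a^2] and [(b - c)^2 - a^2] factor into
    linear forms in the sides. *)
Lemma cos_angle_lt a b c : 0 < a -> 0 < b -> 0 < c ->
  [/\ (cos_angle a b c <= -1) = (b + c <= a),
      (1 <= cos_angle a b c) = (c + a <= b) || (a + b <= c) &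
      (-1 < cos_angle a b c < 1) = is_triangle a b c].
Proof.
move=> a0 b0 c0; have bc : 0 < 2 * b * c by rewrite !mulr_gt0.
have h1 : (cos_angle a b c <= -1) = (b + c <= a).
  rewrite ler_pdivrMr// -subr_ge0.
  have -> : -1 * (2 * b * c) - (b ^+ 2 + c ^+ 2 - a ^+ 2) =
    (a - (b + c)) * (a + b + c) by ring.
  by rewrite pmulr_lge0 ?subr_ge0// !addr_gt0.
have h2 : (1 <= cos_angle a b c) = (c + a <= b) || (a + b <= c).
  rewrite ler_pdivlMr// -subr_ge0.
  have -> : b ^+ 2 + c ^+ 2 - a ^+ 2 - 1 * (2 * b * c) =
    (b - (c + a)) * (b + a - c) by ring.
  apply/idP/orP => [|[H|H]].
  - have [|bca] := leP (c + a) b; first by left.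
    rewrite nmulr_rge0 ?subr_lt0// => ?; right; lra.
  - by rewrite mulr_ge0//; lra.
  - by rewrite mulr_le0//; lra.
split=> //; by rewrite !ltNge h1 h2 /is_triangle !ltNge negb_or.
Qed.

Lemma side_angle_rot_degenerate a b c : 0 < a -> 0 < b -> 0 < c ->
  b + c <= a ->
  [/\ side_angle a b c = pi, side_angle b c a = 0 & side_angle c a b = 0].
Proof.
move=> a0 b0 c0 bca; split.
- by apply: clamped_acos_leN1; have [-> _ _] := cos_angle_lt a0 b0 c0.
- apply: clamped_acos_ge1; have [_ -> _] := cos_angle_lt b0 c0 a0.
  by apply/orP; right.
- apply: clamped_acos_ge1; have [_ -> _] := cos_angle_lt c0 a0 b0.
  by apply/orP; left.
Qed.

Lemma sin_side_angle a b c : 0 < a -> 0 < b -> 0 < c -> is_triangle a b c ->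
  sin (side_angle a b c) = Num.sqrt (heron a b c) / (2 * b * c).
Proof.
move=> a0 b0 c0 abc; have [_ _] := cos_angle_lt a0 b0 c0; rewrite abc => /andP[h1 h2].
have bc : 0 < 2 * b * c by rewrite !mulr_gt0.
rewrite /side_angle clamped_acosE ?(ltW h1) ?(ltW h2)// sin_acos ?(ltW h1) ?(ltW h2)//.
rewrite -[in RHS](gtr0_norm bc) -sqrtr_sqr -sqrtrV ?sqr_ge0// -sqrtrM ?ltW ?heron_gt0//.
congr Num.sqrt; rewrite /cos_angle /heron; field.
by rewrite !gt_eqF.
Qed.

Lemma cos_side_angle a b c : 0 < a -> 0 < b -> 0 < c -> is_triangle a b c ->
  cos (side_angle a b c) = cos_angle a b c.
Proof.
move=> a0 b0 c0 abc; have [_ _] := cos_angle_lt a0 b0 c0; rewrite abc => /andP[h1 h2].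
rewrite /side_angle clamped_acosE ?(ltW h1) ?(ltW h2)// acosK//.
by rewrite in_itv /= !ltW.
Qed.

(** In a genuine triangle with angles A, B, C the addition formulas give A + B the sine of C and the
    cosine of pi - C; the sign of the sine excludes A + B > pi, and the cosine is injective on
    [[0, pi]]. *)
Lemma side_angle_sum a b c : 0 < a -> 0 < b -> 0 < c ->
  side_angle a b c + side_angle b c a + side_angle c a b = pi.
Proof.
move=> a0 b0 c0; have [abc|] := boolP (is_triangle a b c); last first.
  rewrite !negb_and -!leNgt => /or3P[] H.
  - by have [-> -> ->] := side_angle_rot_degenerate a0 b0 c0 H; rewrite !addr0.
  - by have [-> -> ->] := side_angle_rot_degenerate b0 c0 a0 H; rewrite addr0 add0r.
  - by have [-> -> ->] := side_angle_rot_degenerate c0 a0 b0 H; rewrite !add0r.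
have bca : is_triangle b c a by rewrite -is_triangle_rot.
have cab : is_triangle c a b by rewrite -is_triangle_rot.
have D0 := heron_gt0 abc a0 b0 c0.
have DE1 : heron b c a = heron a b c by rewrite -heron_rot.
have DE2 : heron c a b = heron a b c by rewrite heron_rot.
have sq := sqr_sqrtr (ltW D0).
have s0 : 0 < Num.sqrt (heron a b c) by rewrite sqrtr_gt0.
have sE : sin (side_angle a b c + side_angle b c a) = sin (side_angle c a b).
  rewrite sinD !sin_side_angle// !cos_side_angle// DE1 DE2 /cos_angle.
  by field; rewrite !gt_eqF.
have cE : cos (side_angle a b c + side_angle b c a) = - cos (side_angle c a b).
  rewrite cosD !sin_side_angle// !cos_side_angle// DE1.
  have -> : Num.sqrt (heron a b c) / (2 * b * c) * (Num.sqrt (heron a b c) / (2 * c * a)) =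
     Num.sqrt (heron a b c) ^+ 2 / (4 * a * b * c ^+ 2) by field; rewrite !gt_eqF.
  by rewrite sq /cos_angle /heron; field; rewrite !gt_eqF.
have bnd x y z : 0 < x -> 0 < y -> 0 < z -> is_triangle x y z ->
    0 < side_angle x y z < pi.
  move=> x0 y0 z0 xyz; have [_ _] := cos_angle_lt x0 y0 z0; rewrite xyz => /andP[h1 h2].
  rewrite /side_angle clamped_acosE ?(ltW h1) ?(ltW h2)//.
  by rewrite acos_gt0 ?acos_ltpi// ?h1 ?h2 ltW.
have /andP[A1 A2] := bnd _ _ _ a0 b0 c0 abc.
have /andP[B1 B2] := bnd _ _ _ b0 c0 a0 bca.
have /andP[C1 C2] := bnd _ _ _ c0 a0 b0 cab.
have AB : side_angle a b c + side_angle b c a <= pi.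
  rewrite leNgt; apply/negP => H.
  have : 0 < sin (side_angle a b c + side_angle b c a).
    by rewrite sE sin_gt0_pi// C1.
  have -> : side_angle a b c + side_angle b c a =
     (side_angle a b c + side_angle b c a - pi) + pi by ring.
  rewrite sinDpi oppr_gt0 ltNge ltW// sin_gt0_pi//; lra.
have : side_angle a b c + side_angle b c a = pi - side_angle c a b; last by move=> ->; rewrite subrK.
apply: cos_inj; rewrite ?in_itv /= ?subr_ge0.
- by rewrite AB andbT; lra.
- by rewrite (ltW C2) /=; lra.
- by rewrite cE addrC cosDpi cosN.
Qed.

End TriangleAngles.

(** * Angles of a face as functions of radii and inversive distances *)

Section CirclePackingTriangle.
Variable R : realType.
Implicit Types x y z P Q S : R.

Definition edge2 x y P : R := x ^+ 2 + y ^+ 2 + 2 * x * y * P.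
Definition edge_len x y P : R := Num.sqrt (edge2 x y P).

(* [P], [Q], [S] are the inversive distances of [xy], [xz], [yz]. *)
Definition radii_angle x y z P Q S : R :=
  side_angle (edge_len y z S) (edge_len x y P) (edge_len x z Q).

Definition radii_heron x y z P Q S : R :=
  heron (edge_len y z S) (edge_len x y P) (edge_len x z Q).

Definition radii_triangle x y z P Q S : bool :=
  is_triangle (edge_len y z S) (edge_len x y P) (edge_len x z Q).

(** In a nondegenerate triangle, a positive multiple of the signed distance from the edge [x y] to
    the radical centre of the three circles. *)
Definition edge_height x y z P Q S : R :=
  x * y * (1 - P ^+ 2) + x * z * (S + P * Q) + y * z * (Q + P * S).

(** Divided by the square root of [radii_heron], this is the derivative of the angle at [x] in
    [ln y]. Being symmetric in the two ends, it is also that of the angle at [y] in [ln x]. *)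
Definition edge_weight x y z P Q S : R :=
  2 * x * y * edge_height x y z P Q S / edge2 x y P.

Lemma edge2C x y P : edge2 x y P = edge2 y x P.
Proof. by rewrite /edge2; ring. Qed.

Lemma edge_lenC x y P : edge_len x y P = edge_len y x P.
Proof. by rewrite /edge_len edge2C. Qed.

Lemma edge_heightC x y z P Q S : edge_height x y z P Q S = edge_height y x z P S Q.
Proof. by rewrite /edge_height; ring. Qed.

Lemma edge_weightC x y z P Q S : edge_weight x y z P Q S = edge_weight y x z P S Q.
Proof. by rewrite /edge_weight edge_heightC edge2C -(mulrA 2) (mulrC x) mulrA. Qed.

Lemma edge2_gt0 x y P : 0 < x -> 0 < y -> 0 <= P -> 0 < edge2 x y P.
Proof.
move=> x0 y0 P0; rewrite ltr_pwDl// ?mulr_ge0// ?ltW//.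
by rewrite addr_gt0// exprn_gt0.
Qed.

Lemma edge_len_gt0 x y P : 0 < x -> 0 < y -> 0 <= P -> 0 < edge_len x y P.
Proof. by move=> *; rewrite sqrtr_gt0 edge2_gt0. Qed.

(** The triangle is the signed union of three triangles over its edges with the radical centre as
    apex. *)
Lemma radii_heronE x y z P Q S : 0 < x -> 0 < y -> 0 < z ->
  0 <= P -> 0 <= Q -> 0 <= S ->
  radii_heron x y z P Q S = 4 * (x * y * edge_height x y z P Q S +
    x * z * edge_height x z y Q P S + y * z * edge_height y z x S P Q).
Proof.
move=> x0 y0 z0 P0 Q0 S0; rewrite /radii_heron /heron /edge_len.
rewrite !sqr_sqrtr ?ltW ?edge2_gt0// /edge2 /edge_height; ring.
Qed.

(* Negativity of both would give
   [(S + P Q)^2 < (P^2 - 1) (Q^2 - 1)], against [S >= 0]. *)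
Lemma edge_height_not_both_neg x y z P Q S : 0 < x -> 0 < y -> 0 < z ->
  0 <= P -> 0 <= Q -> 0 <= S ->
  edge_height x y z P Q S < 0 -> edge_height x z y Q P S < 0 -> False.
Proof.
move=> x0 y0 z0 P0 Q0 S0 H1 H2.
have PQ := mulr_ge0 P0 Q0; have PS := mulr_ge0 P0 S0; have QS := mulr_ge0 Q0 S0.
have g0 : 0 <= S + P * Q by rewrite addr_ge0.
have h1 : z * (S + P * Q) < y * (P ^+ 2 - 1).
  rewrite -subr_lt0 -(pmulr_rlt0 _ x0); apply: le_lt_trans H1.
  have : 0 <= y * z * (Q + P * S) by rewrite !mulr_ge0 ?addr_ge0// ltW.
  by rewrite /edge_height; lra.
have h2 : y * (S + P * Q) < z * (Q ^+ 2 - 1).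
  rewrite -subr_lt0 -(pmulr_rlt0 _ x0); apply: le_lt_trans H2.
  have : 0 <= z * y * (P + Q * S) by rewrite !mulr_ge0 ?addr_ge0// ltW.
  by rewrite /edge_height; lra.
have zg := mulr_ge0 (ltW z0) g0; have yg := mulr_ge0 (ltW y0) g0.
have P1 : 0 < P ^+ 2 - 1 by rewrite -(pmulr_rgt0 _ y0); lra.
have := ltr_pM zg yg h1 h2.
have -> : z * (S + P * Q) * (y * (S + P * Q)) = y * z * (S + P * Q) ^+ 2 by ring.
have -> : y * (P ^+ 2 - 1) * (z * (Q ^+ 2 - 1)) =
  y * z * ((P ^+ 2 - 1) * (Q ^+ 2 - 1)) by ring.
rewrite ltr_pM2l ?mulr_gt0//; apply/negP; rewrite -leNgt.
have : 0 <= S * (S + 2 * (P * Q)) by rewrite mulr_ge0// addr_ge0// mulr_ge0.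
have : 0 <= Q ^+ 2 by exact: sqr_ge0.
by lra.
Qed.

Section PositiveDefinite.
Variables x y z P Q S : R.
Hypotheses (x0 : 0 < x) (y0 : 0 < y) (z0 : 0 < z).
Hypotheses (P0 : 0 <= P) (Q0 : 0 <= Q) (S0 : 0 <= S).

Let m12 := edge_weight x y z P Q S.
Let m13 := edge_weight x z y Q P S.
Let m23 := edge_weight y z x S P Q.

(** The determinant of the form [m12 p^2 + m13 q^2 + m23 (q - p)^2] in [p] and [q]; its trace is
    [m12 + m13 + 2 * m23]. *)
Definition weight_det := m12 * m13 + m12 * m23 + m13 * m23.

Let cofactor := y * z ^+ 2 * (S * P + Q) + y ^+ 2 * z * (S * Q + P) +
  x * z ^+ 2 * (S + Q * P) + 2 * x * y * z * (1 + P * Q * S) +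
  x * y ^+ 2 * (S + P * Q) + x ^+ 2 * z * (S * Q + P) + x ^+ 2 * y * (S * P + Q).

(** All coefficients of [cofactor] are nonnegative when the inversive distances are, so the
    determinant is positive together with the squared area. *)
Let weight_detE : weight_det = x * y * z * radii_heron x y z P Q S * cofactor /
  (edge2 x y P * edge2 x z Q * edge2 y z S).
Proof.
rewrite radii_heronE// /weight_det /m12 /m13 /m23 /edge_weight.
have A0 : edge2 x y P != 0 by rewrite gt_eqF// edge2_gt0.
have B0 : edge2 x z Q != 0 by rewrite gt_eqF// edge2_gt0.
have C0 : edge2 y z S != 0 by rewrite gt_eqF// edge2_gt0.
have H : x * edge_height x y z P Q S * edge_height x z y Q P S * edge2 y z S +
   y * edge_height x y z P Q S * edge_height y z x S P Q * edge2 x z Q +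
   z * edge_height x z y Q P S * edge_height y z x S P Q * edge2 x y P =
   (x * y * edge_height x y z P Q S + x * z * edge_height x z y Q P S +
    y * z * edge_height y z x S P Q) * cofactor.
  by rewrite /edge_height /edge2 /cofactor; ring.
move: H A0 B0 C0; move: (edge_height x y z P Q S) (edge_height x z y Q P S).
move: (edge_height y z x S P Q) (edge2 x y P) (edge2 x z Q) (edge2 y z S) cofactor.
move=> h3 A B C cof h1 h2 H A0 B0 C0.
transitivity (4 * x * y * z *
    (x * h1 * h2 * C + y * h1 * h3 * B + z * h2 * h3 * A) / (A * B * C)).
  by field; rewrite A0 B0 C0.
by rewrite H; field; rewrite A0 B0 C0.
Qed.

Lemma weight_det_gt0 : radii_triangle x y z P Q S -> 0 < weight_det.
Proof.
move=> xyz; have D0 : 0 < radii_heron x y z P Q S.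
  by apply: heron_gt0 => //; exact: edge_len_gt0.
rewrite weight_detE divr_gt0//; last by rewrite !mulr_gt0// edge2_gt0.
have := mulr_ge0 P0 Q0; have := mulr_ge0 S0 P0; have := mulr_ge0 S0 Q0 => h1 h2 h3.
have h4 := mulr_ge0 h3 S0.
have [x0' y0' z0'] := And3 (ltW x0) (ltW y0) (ltW z0).
rewrite !mulr_gt0// /cofactor.
have : 0 < 2 * x * y * z * (1 + P * Q * S) by rewrite !mulr_gt0// ltr_pwDl.
have : 0 <= y * z ^+ 2 * (S * P + Q) by rewrite !mulr_ge0 ?addr_ge0 ?exprn_ge0.
have : 0 <= y ^+ 2 * z * (S * Q + P) by rewrite !mulr_ge0 ?addr_ge0 ?exprn_ge0.
have : 0 <= x * z ^+ 2 * (S + Q * P).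
  by rewrite !mulr_ge0 ?addr_ge0 ?exprn_ge0// mulrC.
have : 0 <= x * y ^+ 2 * (S + P * Q) by rewrite !mulr_ge0 ?addr_ge0 ?exprn_ge0.
have : 0 <= x ^+ 2 * z * (S * Q + P) by rewrite !mulr_ge0 ?addr_ge0 ?exprn_ge0.
have : 0 <= x ^+ 2 * y * (S * P + Q) by rewrite !mulr_ge0 ?addr_ge0 ?exprn_ge0.
move: (y * z ^+ 2 * _) (y ^+ 2 * z * _) (x * z ^+ 2 * _) (2 * x * y * z * _).
by move: (x * y ^+ 2 * _) (x ^+ 2 * z * _) (x ^+ 2 * y * _) => *; lra.
Qed.

Let weight_lt0 a b c I J K : 0 < a -> 0 < b -> 0 < c -> 0 <= I ->
  (edge_weight a b c I J K < 0) = (edge_height a b c I J K < 0).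
Proof.
move=> a0 b0 c0 I0; rewrite /edge_weight -mulrA pmulr_rlt0 ?mulr_gt0//.
by rewrite pmulr_llt0// invr_gt0 edge2_gt0.
Qed.

(* The pairwise sums of the weights have positive pairwise products, and at
   most one weight is negative. *)
Lemma weight_trace_gt0 : radii_triangle x y z P Q S -> 0 < m12 + m13 + 2 * m23.
Proof.
move=> /weight_det_gt0; rewrite /weight_det => det0.
have n1 : ~ (m12 < 0 /\ m13 < 0).
  by rewrite !weight_lt0// => -[]; exact: edge_height_not_both_neg.
have n2 : ~ (m12 < 0 /\ m23 < 0).
  rewrite !weight_lt0// edge_heightC => -[].
  exact: edge_height_not_both_neg.
have n3 : ~ (m13 < 0 /\ m23 < 0).
  rewrite !weight_lt0// [edge_height x z _ _ _ _]edge_heightC.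
  rewrite [edge_height y z _ _ _ _]edge_heightC => -[].
  exact: edge_height_not_both_neg.
have q1 : 0 < (m12 + m23) * (m13 + m23).
  by apply: lt_le_trans det0 _; rewrite -subr_ge0; have := sqr_ge0 m23; lra.
move: n1 n2 n3 det0 q1; move: m12 m13 m23 => a b c n1 n2 n3 det0 q1.
have [ac|ac] := ltP 0 (a + c).
  by move: q1; rewrite pmulr_rgt0//; lra.
have ac0 : a + c < 0.
  rewrite lt_neqAle ac andbT; apply/eqP => H.
  by move: q1; rewrite H mul0r ltxx.
have bc0 : b + c < 0 by move: q1; rewrite nmulr_rgt0.
(* At most one weight is negative and it has to be [c], with [c < - a] and [c < - b]. Then
   [a b + a c + b c <= a b - a^2 - b^2 <= 0], against [det0]. *)
exfalso.
have [a0|a0] := ltP a 0; first by have [b0|b0] := ltP b 0; [exact: n1|apply: n2; lra].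
have c0 : c < 0 by lra.
have [b0|b0] := ltP b 0; first by apply: n3.
have := mulr_gt0 (_ : 0 < - (a + c)) (_ : 0 < - (b + c)).
have : 0 <= (a + c + b) ^+ 2 by exact: sqr_ge0.
have := mulr_ge0 a0 b0.
have : a * b <= c * c.
  have : a * b <= (- c) * (- c) by apply: ler_pM => //; lra.
  by rewrite mulrNN.
have : a * c <= - (a * a) by rewrite -mulrN ler_wpM2l//; lra.
have : b * c <= - (b * b) by rewrite -mulrN ler_wpM2l//; lra.
have := sqr_ge0 (a - b).
by rewrite expr2; lra.
Qed.

(** For a positive definite form, determinant over trace is a lower bound of the smaller eigenvalue;
    the 3 comes from [p^2 + q^2 + (q - p)^2 <= 3 (p^2 + q^2)]. *)
Definition weight_const := weight_det / (m12 + m13 + 2 * m23) / 3.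

Lemma weight_const_gt0 : radii_triangle x y z P Q S -> 0 < weight_const.
Proof. by move=> t; rewrite !divr_gt0 ?weight_det_gt0 ?weight_trace_gt0. Qed.

(* Cayley-Hamilton for the matrix [M] of the form in the coordinates
   [b - a], [c - a]: [tr(M) M - det(M) = M^2]. *)
Lemma weight_form_ge e f g : radii_triangle x y z P Q S ->
  weight_const * ((e - f) ^+ 2 + (e - g) ^+ 2 + (f - g) ^+ 2) <=
  m12 * (e - f) ^+ 2 + m13 * (e - g) ^+ 2 + m23 * (f - g) ^+ 2.
Proof.
move=> t; have t0 := weight_trace_gt0 t; have d0 := weight_det_gt0 t.
rewrite /weight_const; move: t0 d0; rewrite /weight_det.
move: m12 m13 m23 => a b c t0 d0.
have -> : f - g = (e - g) - (e - f) by ring.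
move: (e - f) (e - g) => p q.
have s0 : 0 <= ((a + c) * p - c * q) ^+ 2 + ((b + c) * q - c * p) ^+ 2.
  by rewrite addr_ge0 ?sqr_ge0.
have s1 : 0 <= (p + q) ^+ 2 by exact: sqr_ge0.
have h : (a * b + a * c + b * c) * (p ^+ 2 + q ^+ 2 + (q - p) ^+ 2) <=
    3 * (a * b + a * c + b * c) * (p ^+ 2 + q ^+ 2).
  have -> : 3 * (a * b + a * c + b * c) * (p ^+ 2 + q ^+ 2) =
    (a * b + a * c + b * c) * (3 * (p ^+ 2 + q ^+ 2)) by ring.
  by rewrite ler_pM2l//; lra.
have -> : (a * b + a * c + b * c) / (a + b + 2 * c) / 3 *
    (p ^+ 2 + q ^+ 2 + (q - p) ^+ 2) = (a * b + a * c + b * c) *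
    (p ^+ 2 + q ^+ 2 + (q - p) ^+ 2) / ((a + b + 2 * c) * 3).
  by field; rewrite gt_eqF.
rewrite ler_pdivrMr ?mulr_gt0//.
apply: le_trans h _; rewrite -subr_ge0.
have -> : (a * p ^+ 2 + b * q ^+ 2 + c * (q - p) ^+ 2) * ((a + b + 2 * c) * 3) -
  3 * (a * b + a * c + b * c) * (p ^+ 2 + q ^+ 2) =
  3 * (((a + c) * p - c * q) ^+ 2 + ((b + c) * q - c * p) ^+ 2) by ring.
by rewrite mulr_ge0.
Qed.

End PositiveDefinite.

Lemma radii_angle_sum x y z P Q S : 0 < x -> 0 < y -> 0 < z ->
  0 <= P -> 0 <= Q -> 0 <= S ->
  radii_angle x y z P Q S + radii_angle y z x S P Q + radii_angle z x y Q S P = pi.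
Proof.
move=> x0 y0 z0 P0 Q0 S0; rewrite /radii_angle.
rewrite [edge_len z x _]edge_lenC [edge_len y x _]edge_lenC [edge_len z y _]edge_lenC.
rewrite -(side_angle_sum (edge_len_gt0 y0 z0 S0) (edge_len_gt0 x0 y0 P0)
  (edge_len_gt0 x0 z0 Q0)).
by rewrite addrAC.
Qed.

Lemma radii_angleC x y z P Q S : radii_angle x y z P Q S = radii_angle x z y Q P S.
Proof.
by rewrite /radii_angle /side_angle cos_angleC [edge_len z y _]edge_lenC.
Qed.

Lemma is_derive_clamped_acos (c : R) : -1 < c < 1 ->
  is_derive c 1 (@clamped_acos R) (- (Num.sqrt (1 - c ^+ 2))^-1).
Proof.
move=> c1; apply: near_eq_is_derive (is_derive1_acos c1).
have : \forall y \near c, y \in `](-1), 1[ by apply: near_in_itvoo; rewrite in_itv.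
apply: filterS => y; rewrite in_itv /= => /andP[y1 y2].
by rewrite clamped_acosE// !ltW.
Qed.

Lemma dw_edge2 (D : set R) (u v : R -> R) t e f P :
  derivative_within D u t e -> derivative_within D v t f ->
  derivative_within D (fun s => edge2 (expR (u s)) (expR (v s)) P) t
    (2 * (expR (u t) ^+ 2 * e + expR (v t) ^+ 2 * f +
      expR (u t) * expR (v t) * P * (e + f))).
Proof.
move=> ue vf.
have xe := dw_comp ue (is_derive_expR (u t)).
have yf := dw_comp vf (is_derive_expR (v t)).
have := dwD (dwD (dwM xe xe) (dwM yf yf)) (dwZ (c := 2 * P) (dwM xe yf)).
rewrite /edge2 => H; apply: dw_val; last first.
  move: H; congr (derivative_within _ _ _ _); apply/funext => s; ring.
by ring.
Qed.

Lemma is_derive_invsqrt (x : R) : 0 < x ->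
  is_derive x 1 (fun y => (Num.sqrt y)^-1) (- (Num.sqrt x)^-1 / (2 * x)).
Proof.
move=> x0; have s0 : Num.sqrt x != 0 by rewrite gt_eqF// sqrtr_gt0.
have := is_deriveV s0 (is_derive1_sqrt x0); congr is_derive.
rewrite /GRing.scale /= -{4}[x]sqr_sqrtr ?ltW//.
by field.
Qed.

Lemma dw_radii_angle (D : set R) (u v w : R -> R) t e f g P Q S :
  derivative_within D u t e -> derivative_within D v t f ->
  derivative_within D w t g -> 0 <= P -> 0 <= Q -> 0 <= S ->
  let x := expR (u t) in let y := expR (v t) in let z := expR (w t) in
  radii_triangle x y z P Q S ->
  derivative_within D
    (fun s => radii_angle (expR (u s)) (expR (v s)) (expR (w s)) P Q S) t
    ((edge_weight x y z P Q S * (f - e) + edge_weight x z y Q P S * (g - e)) /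
      Num.sqrt (radii_heron x y z P Q S)).
Proof.
move=> ue vf wg P0 Q0 S0 x y z t0.
have [x0 y0 z0] := And3 (expR_gt0 (u t)) (expR_gt0 (v t)) (expR_gt0 (w t)).
rewrite -/x -/y -/z in x0 y0 z0.
have A0 := edge2_gt0 x0 y0 P0; have B0 := edge2_gt0 x0 z0 Q0.
have C0 := edge2_gt0 y0 z0 S0.
have dA := dw_edge2 (P := P) ue vf; have dB := dw_edge2 (P := Q) ue wg.
have dC := dw_edge2 (P := S) vf wg.
have dgA := dw_comp dA (is_derive_invsqrt A0).
have dgB := dw_comp dB (is_derive_invsqrt B0).
have dN := dwB (dwD dA dB) dC.
have := dwZ (c := 2^-1) (dwM dN (dwM dgA dgB)).
rewrite -/x -/y -/z => dcos.
have cE s : 2^-1 * ((edge2 (expR (u s)) (expR (v s)) P + edge2 (expR (u s)) (expR (w s)) Q -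
   edge2 (expR (v s)) (expR (w s)) S) *
   ((Num.sqrt (edge2 (expR (u s)) (expR (v s)) P))^-1 *
    (Num.sqrt (edge2 (expR (u s)) (expR (w s)) Q))^-1)) =
   cos_angle (edge_len (expR (v s)) (expR (w s)) S) (edge_len (expR (u s)) (expR (v s)) P)
     (edge_len (expR (u s)) (expR (w s)) Q).
  rewrite /cos_angle /edge_len !sqr_sqrtr ?ltW ?edge2_gt0 ?expR_gt0// !invfM; ring.
have {}dcos := dw_ext cE dcos.
have [lA lB lC] := And3 (edge_len_gt0 x0 y0 P0) (edge_len_gt0 x0 z0 Q0)
  (edge_len_gt0 y0 z0 S0).
have cos1 : -1 < cos_angle (edge_len y z S) (edge_len x y P) (edge_len x z Q) < 1.
  by have [_ _ ->] := cos_angle_lt lC lA lB.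
have := dw_comp dcos (is_derive_clamped_acos cos1).
rewrite -/x -/y -/z; apply: dw_val.
have /andP[c1 c2] := cos1; rewrite -sin_acos ?(ltW c1) ?(ltW c2)//.
rewrite -clamped_acosE ?(ltW c1) ?(ltW c2)// sin_side_angle//.
rewrite -/(radii_heron x y z P Q S).
have H0 : 0 < Num.sqrt (radii_heron x y z P Q S) by rewrite sqrtr_gt0 heron_gt0.
(* Up to a positive factor, minus the derivative of the cosine. It can be grouped by [f - e] and
   [g - e] because the angle depends only on ratios of the radii. *)
have E : - (2 * (x ^+ 2 * e + y ^+ 2 * f + x * y * P * (e + f)) +
     2 * (x ^+ 2 * e + z ^+ 2 * g + x * z * Q * (e + g)) -
     2 * (y ^+ 2 * f + z ^+ 2 * g + y * z * S * (f + g)) -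
     (edge2 x y P + edge2 x z Q - edge2 y z S) *
       ((x ^+ 2 * e + y ^+ 2 * f + x * y * P * (e + f)) / edge2 x y P +
        (x ^+ 2 * e + z ^+ 2 * g + x * z * Q * (e + g)) / edge2 x z Q)) =
    edge_weight x y z P Q S * (f - e) + edge_weight x z y Q P S * (g - e).
  move: A0 B0; rewrite /edge_weight /edge_height /edge2 => A0 B0; field.
  by rewrite !gt_eqF.
rewrite -E -/(edge_len x y P) -/(edge_len x z Q).
move: A0 B0 lA lB H0.
move: (Num.sqrt _) (edge_len x y P) (edge_len x z Q) (edge2 x y P) (edge2 x z Q) (edge2 y z S).
move: (x ^+ 2 * e + y ^+ 2 * f + _) (x ^+ 2 * e + z ^+ 2 * g + _) (y ^+ 2 * f + z ^+ 2 * g + _).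
move=> p q r h a b A B C A0 B0 a0 b0 h0; field.
by rewrite !gt_eqF.
Qed.

End CirclePackingTriangle.

(** * Face angles in logarithmic coordinates *)

Section FaceAngles.
Variable R : realType.
Implicit Types u v w e f g P Q S : R.

Definition face_angle u v w P Q S : R :=
  radii_angle (expR u) (expR v) (expR w) P Q S.

Definition face_triangle u v w P Q S : bool :=
  radii_triangle (expR u) (expR v) (expR w) P Q S.

Definition face_pairing u v w P Q S e f g : R :=
  e * face_angle u v w P Q S + f * face_angle v w u S P Q +
  g * face_angle w u v Q S P.

Definition face_form u v w P Q S e f g : R :=
  (edge_weight (expR u) (expR v) (expR w) P Q S * (e - f) ^+ 2 +
   edge_weight (expR u) (expR w) (expR v) Q P S * (e - g) ^+ 2 +
   edge_weight (expR v) (expR w) (expR u) S P Q * (f - g) ^+ 2) /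
  Num.sqrt (radii_heron (expR u) (expR v) (expR w) P Q S).

Lemma face_angleC u v w P Q S : face_angle u v w P Q S = face_angle u w v Q P S.
Proof. exact: radii_angleC. Qed.

Lemma face_angle_bound u v w P Q S : 0 <= face_angle u v w P Q S <= pi.
Proof. exact: clamped_acos_bound. Qed.

Lemma face_angle_sum u v w P Q S : 0 <= P -> 0 <= Q -> 0 <= S ->
  face_angle u v w P Q S + face_angle v w u S P Q + face_angle w u v Q S P = pi.
Proof. by move=> *; apply: radii_angle_sum; rewrite ?expR_gt0. Qed.

Lemma edge2_scale k x y P : edge2 (k * x) (k * y) P = k ^+ 2 * edge2 x y P :> R.
Proof. by rewrite /edge2; ring. Qed.

Lemma edge_len_scale k x y P : 0 < k ->
  edge_len (k * x) (k * y) P = k * edge_len x y P :> R.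
Proof.
move=> k0; rewrite /edge_len edge2_scale sqrtrM ?sqr_ge0//.
by rewrite sqrtr_sqr gtr0_norm.
Qed.

Lemma cos_angle_scale k a b c : 0 < k ->
  cos_angle (k * a) (k * b) (k * c) = cos_angle a b c :> R.
Proof.
move=> k0; rewrite /cos_angle.
have -> : (k * b) ^+ 2 + (k * c) ^+ 2 - (k * a) ^+ 2 =
  k ^+ 2 * (b ^+ 2 + c ^+ 2 - a ^+ 2) by ring.
have -> : 2 * (k * b) * (k * c) = k ^+ 2 * (2 * b * c) by ring.
by rewrite -mulf_div divff ?mul1r// expf_neq0// gt_eqF.
Qed.

Lemma face_angle_shift k u v w P Q S :
  face_angle (u + k) (v + k) (w + k) P Q S = face_angle u v w P Q S.
Proof.
rewrite /face_angle /radii_angle /side_angle !expRD.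
by rewrite ![_ * expR k]mulrC !edge_len_scale ?expR_gt0// cos_angle_scale ?expR_gt0.
Qed.

Lemma radii_heron_rot x y z P Q S :
  radii_heron y z x S P Q = radii_heron x y z P Q S :> R.
Proof.
rewrite /radii_heron [edge_len z x _]edge_lenC [edge_len y x _]edge_lenC.
by rewrite heron_rot; rewrite /heron; ring.
Qed.

Lemma radii_triangle_rot x y z P Q S :
  radii_triangle y z x S P Q = radii_triangle x y z P Q S :> bool.
Proof.
rewrite /radii_triangle [edge_len z x _]edge_lenC [edge_len y x _]edge_lenC.
by rewrite is_triangle_rot.
Qed.

Lemma dw_face_angle (D : set R) (u v w : R -> R) t e f g P Q S :
  derivative_within D u t e -> derivative_within D v t f ->
  derivative_within D w t g -> 0 <= P -> 0 <= Q -> 0 <= S ->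
  face_triangle (u t) (v t) (w t) P Q S ->
  derivative_within D (fun s => face_angle (u s) (v s) (w s) P Q S) t
    ((edge_weight (expR (u t)) (expR (v t)) (expR (w t)) P Q S * (f - e) +
      edge_weight (expR (u t)) (expR (w t)) (expR (v t)) Q P S * (g - e)) /
      Num.sqrt (radii_heron (expR (u t)) (expR (v t)) (expR (w t)) P Q S)).
Proof. by move=> *; exact: dw_radii_angle. Qed.

(** The symmetry of the edge weights combines [e (f - e)] and [f (e - f)] into [- (e - f)^2], edge
    by edge. *)
Lemma dw_face_pairing (D : set R) (u v w : R -> R) t e f g P Q S :
  derivative_within D u t e -> derivative_within D v t f ->
  derivative_within D w t g -> 0 <= P -> 0 <= Q -> 0 <= S ->
  face_triangle (u t) (v t) (w t) P Q S ->
  derivative_within D (fun s => face_pairing (u s) (v s) (w s) P Q S e f g) t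
    (- face_form (u t) (v t) (w t) P Q S e f g).
Proof.
move=> ue vf wg P0 Q0 S0 tr.
have tr2 : face_triangle (v t) (w t) (u t) S P Q.
  by rewrite /face_triangle radii_triangle_rot.
have tr3 : face_triangle (w t) (u t) (v t) Q S P.
  by rewrite /face_triangle 2!radii_triangle_rot.
have := dwD (dwD (dwZ (c := e) (dw_face_angle ue vf wg P0 Q0 S0 tr))
  (dwZ (c := f) (dw_face_angle vf wg ue S0 P0 Q0 tr2)))
  (dwZ (c := g) (dw_face_angle wg ue vf Q0 S0 P0 tr3)).
apply: dw_val; rewrite /face_form.
rewrite [radii_heron (expR (w t)) _ _ _ _ _]radii_heron_rot.
rewrite [radii_heron (expR (v t)) _ _ _ _ _]radii_heron_rot.
rewrite [edge_weight (expR (v t)) (expR (u t)) _ _ _ _]edge_weightC.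
rewrite [edge_weight (expR (w t)) (expR (u t)) _ _ _ _]edge_weightC.
rewrite [edge_weight (expR (w t)) (expR (v t)) _ _ _ _]edge_weightC.
ring.
Qed.

Section Limits.
Variables (T : Type) (F : set_system T).
Context {FF : ProperFilter F}.
Variables (x y z : T -> R) (x0 y0 z0 P Q S : R).
Hypotheses (xl : x t @[t --> F] --> x0) (yl : y t @[t --> F] --> y0).

Lemma cvg_edge2 : edge2 (x t) (y t) P @[t --> F] --> edge2 x0 y0 P.
Proof.
rewrite /edge2 !expr2; apply: cvgD; first by apply: cvgD; exact: cvgM.
apply: cvgM; last exact: cvg_cst.
by apply: cvgM => //; apply: cvgM => //; exact: cvg_cst.
Qed.

Lemma cvg_edge_len : edge_len (x t) (y t) P @[t --> F] --> edge_len x0 y0 P.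
Proof.
rewrite /edge_len; apply: (continuous_cvg _ _ cvg_edge2).
exact: sqrt_continuous.
Qed.

End Limits.

End FaceAngles.

(** * Continuity of the quantities attached to a face *)

Section FaceLimits.
Variables (R : realType) (T : Type) (F : set_system T).
Context {FF : ProperFilter F}.
Implicit Types (x y z u v w : T -> R) (P Q S : R).

Lemma cvg_edge_height x y z (x0 y0 z0 : R) P Q S :
  x t @[t --> F] --> x0 -> y t @[t --> F] --> y0 -> z t @[t --> F] --> z0 ->
  edge_height (x t) (y t) (z t) P Q S @[t --> F] --> edge_height x0 y0 z0 P Q S.
Proof.
move=> xl yl zl; rewrite /edge_height.
by apply: cvgD; [apply: cvgD|]; (apply: cvgM; [exact: cvgM|exact: cvg_cst]).
Qed.

Lemma cvg_edge_weight x y z (x0 y0 z0 : R) P Q S :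
  x t @[t --> F] --> x0 -> y t @[t --> F] --> y0 -> z t @[t --> F] --> z0 ->
  edge2 x0 y0 P != 0 ->
  edge_weight (x t) (y t) (z t) P Q S @[t --> F] --> edge_weight x0 y0 z0 P Q S.
Proof.
move=> xl yl zl A0; rewrite /edge_weight; apply: cvgM; last first.
  by apply: cvgV => //; exact: cvg_edge2.
apply: cvgM; last exact: cvg_edge_height.
by apply: cvgM => //; apply: cvgM => //; exact: cvg_cst.
Qed.

Lemma cvg_radii_heron x y z (x0 y0 z0 : R) P Q S :
  x t @[t --> F] --> x0 -> y t @[t --> F] --> y0 -> z t @[t --> F] --> z0 ->
  radii_heron (x t) (y t) (z t) P Q S @[t --> F] --> radii_heron x0 y0 z0 P Q S.
Proof.
move=> xl yl zl; rewrite /radii_heron /heron !expr2.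
have A := cvg_edge_len (FF := FF) (P := P) xl yl.
have B := cvg_edge_len (FF := FF) (P := Q) xl zl.
have C := cvg_edge_len (FF := FF) (P := S) yl zl.
apply: cvgB.
  by apply: cvgM; [apply: cvgM; [exact: cvg_cst|exact: (cvgM A A)]|exact: (cvgM B B)].
by apply: cvgM; (apply: cvgB; [apply: cvgD; [exact: (cvgM A A)|exact: (cvgM B B)]|
  exact: (cvgM C C)]).
Qed.

Lemma cvg_radii_angle x y z (x0 y0 z0 : R) P Q S :
  x t @[t --> F] --> x0 -> y t @[t --> F] --> y0 -> z t @[t --> F] --> z0 ->
  0 < x0 -> 0 < y0 -> 0 < z0 -> 0 <= P -> 0 <= Q ->
  radii_angle (x t) (y t) (z t) P Q S @[t --> F] --> radii_angle x0 y0 z0 P Q S.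
Proof.
move=> xl yl zl x0_gt0 y0_gt0 z0_gt0 P0 Q0.
have A := cvg_edge_len (FF := FF) (P := P) xl yl.
have B := cvg_edge_len (FF := FF) (P := Q) xl zl.
have C := cvg_edge_len (FF := FF) (P := S) yl zl.
rewrite /radii_angle /side_angle; apply: continuous_cvg.
  exact: continuous_clamped_acos.
rewrite /cos_angle !expr2; apply: cvgM.
  by apply: cvgB; [apply: cvgD; [exact: (cvgM A A)|exact: (cvgM B B)]|exact: (cvgM C C)].
apply: cvgV; first by rewrite !mulf_neq0// gt_eqF// edge_len_gt0.
by apply: cvgM; [apply: cvgM; [exact: cvg_cst|exact: A]|exact: B].
Qed.

Lemma cvg_face_angle u v w (u0 v0 w0 : R) P Q S :
  u t @[t --> F] --> u0 -> v t @[t --> F] --> v0 -> w t @[t --> F] --> w0 ->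
  0 <= P -> 0 <= Q ->
  face_angle (u t) (v t) (w t) P Q S @[t --> F] --> face_angle u0 v0 w0 P Q S.
Proof.
move=> ul vl wl P0 Q0; apply: cvg_radii_angle; rewrite ?expR_gt0//;
  by apply: continuous_cvg => //; exact: continuous_expR.
Qed.

Lemma cvg_weight_const x y z (x0 y0 z0 : R) P Q S :
  x t @[t --> F] --> x0 -> y t @[t --> F] --> y0 -> z t @[t --> F] --> z0 ->
  0 < x0 -> 0 < y0 -> 0 < z0 -> 0 <= P -> 0 <= Q -> 0 <= S ->
  radii_triangle x0 y0 z0 P Q S ->
  weight_const (x t) (y t) (z t) P Q S @[t --> F] --> weight_const x0 y0 z0 P Q S.
Proof.
move=> xl yl zl x0_gt0 y0_gt0 z0_gt0 P0 Q0 S0 tr.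
have A : edge2 x0 y0 P != 0 by rewrite gt_eqF// edge2_gt0.
have B : edge2 x0 z0 Q != 0 by rewrite gt_eqF// edge2_gt0.
have C : edge2 y0 z0 S != 0 by rewrite gt_eqF// edge2_gt0.
have a := cvg_edge_weight (Q := Q) (S := S) xl yl zl A.
have b := cvg_edge_weight (Q := P) (S := S) xl zl yl B.
have c := cvg_edge_weight (Q := P) (S := Q) yl zl xl C.
rewrite /weight_const; apply: cvgM; last exact: cvg_cst.
apply: cvgM.
  by rewrite /weight_det; apply: cvgD; [apply: cvgD|]; exact: cvgM.
apply: cvgV; first by rewrite gt_eqF// weight_trace_gt0.
by apply: cvgD; [exact: cvgD|apply: cvgM => //; exact: cvg_cst].
Qed.

Lemma cvg_form_const x y z (x0 y0 z0 : R) P Q S :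
  x t @[t --> F] --> x0 -> y t @[t --> F] --> y0 -> z t @[t --> F] --> z0 ->
  0 < x0 -> 0 < y0 -> 0 < z0 -> 0 <= P -> 0 <= Q -> 0 <= S ->
  radii_triangle x0 y0 z0 P Q S ->
  weight_const (x t) (y t) (z t) P Q S / Num.sqrt (radii_heron (x t) (y t) (z t) P Q S)
    @[t --> F] -->
  weight_const x0 y0 z0 P Q S / Num.sqrt (radii_heron x0 y0 z0 P Q S).
Proof.
move=> xl yl zl x0_gt0 y0_gt0 z0_gt0 P0 Q0 S0 tr; apply: cvgM.
  exact: cvg_weight_const.
apply: cvgV; first by rewrite gt_eqF// sqrtr_gt0 heron_gt0// edge_len_gt0.
by apply: continuous_cvg; [exact: sqrt_continuous|exact: cvg_radii_heron].
Qed.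

Lemma near_radii_triangle x y z (x0 y0 z0 : R) P Q S :
  x t @[t --> F] --> x0 -> y t @[t --> F] --> y0 -> z t @[t --> F] --> z0 ->
  radii_triangle x0 y0 z0 P Q S ->
  \forall t \near F, radii_triangle (x t) (y t) (z t) P Q S.
Proof.
move=> xl yl zl /and3P[]; rewrite -subr_gt0 => t1; rewrite -subr_gt0 => t2.
rewrite -subr_gt0 => t3.
have A := cvg_edge_len (FF := FF) (P := P) xl yl.
have B := cvg_edge_len (FF := FF) (P := Q) xl zl.
have C := cvg_edge_len (FF := FF) (P := S) yl zl.
have h1 := cvgr_gt _ (cvgB (cvgD A B) C) _ t1.
have h2 := cvgr_gt _ (cvgB (cvgD B C) A) _ t2.
have h3 := cvgr_gt _ (cvgB (cvgD C A) B) _ t3.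
near=> t; apply/and3P; split; rewrite -subr_gt0; near: t.
- exact: h1.
- exact: h2.
- exact: h3.
Unshelve. all: by end_near. Qed.

End FaceLimits.

(** * Monotonicity of the angles of a face *)

Section FaceMonotone.
Variable R : realType.
Implicit Types u v w e f g P Q S : R.

Lemma face_form_ge u v w P Q S e f g : 0 <= P -> 0 <= Q -> 0 <= S ->
  face_triangle u v w P Q S ->
  weight_const (expR u) (expR v) (expR w) P Q S /
    Num.sqrt (radii_heron (expR u) (expR v) (expR w) P Q S) *
    ((e - f) ^+ 2 + (e - g) ^+ 2 + (f - g) ^+ 2) <= face_form u v w P Q S e f g.
Proof.
move=> P0 Q0 S0 tr; rewrite mulrAC /face_form ler_wpM2r ?invr_ge0 ?sqrtr_ge0//.
by apply: weight_form_ge; rewrite ?expR_gt0.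
Qed.

Lemma face_const_gt0 u v w P Q S : 0 <= P -> 0 <= Q -> 0 <= S ->
  face_triangle u v w P Q S ->
  0 < weight_const (expR u) (expR v) (expR w) P Q S /
    Num.sqrt (radii_heron (expR u) (expR v) (expR w) P Q S).
Proof.
move=> P0 Q0 S0 tr; rewrite divr_gt0 ?weight_const_gt0 ?expR_gt0//.
by rewrite sqrtr_gt0 heron_gt0// edge_len_gt0// expR_gt0.
Qed.

Let line u e (s : R) : R := u + s * e.

Let dw_line D u e t : derivative_within D (line u e) t e.
Proof.
have := dwD (dw_cst D t u) (dwM (dw_id D t) (dw_cst D t e)).
by apply: dw_val; ring.
Qed.

Let line_cvg u e t : line u e s @[s --> t] --> line u e t.
Proof. by apply: cvgD; [exact: cvg_cst|apply: cvgM => //; exact: cvg_cst]. Qed.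

Lemma face_pairing_degenerate u v w P Q S e f g :
  0 <= P -> 0 <= Q -> 0 <= S -> ~~ face_triangle u v w P Q S ->
  face_pairing u v w P Q S e f g \in [:: e * pi; f * pi; g * pi].
Proof.
move=> P0 Q0 S0; rewrite /face_triangle /radii_triangle.
rewrite /face_pairing /face_angle /radii_angle.
rewrite [edge_len (expR w) (expR u) _]edge_lenC [edge_len (expR v) (expR u) _]edge_lenC.
rewrite [edge_len (expR w) (expR v) _]edge_lenC.
have a0 := edge_len_gt0 (expR_gt0 v) (expR_gt0 w) S0.
have b0 := edge_len_gt0 (expR_gt0 u) (expR_gt0 v) P0.
have c0 := edge_len_gt0 (expR_gt0 u) (expR_gt0 w) Q0.
move: a0 b0 c0; set a := edge_len _ _ S; set b := edge_len _ _ P; set c := edge_len _ _ Q.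
move=> a0 b0 c0; rewrite !negb_and -!leNgt !inE => /or3P[] H.
- have [-> -> ->] := side_angle_rot_degenerate a0 b0 c0 H.
  by rewrite !mulr0 !addr0 eqxx.
- have [-> -> ->] := side_angle_rot_degenerate b0 c0 a0 H.
  by rewrite !mulr0 !addr0 add0r eqxx !orbT.
- have [-> -> ->] := side_angle_rot_degenerate c0 a0 b0 H.
  by rewrite !mulr0 !addr0 add0r eqxx !orbT.
Qed.

(** A degenerate triangle can give the pairing only the values [e * pi], [f * pi], [g * pi]; at any
    other value the triangle is genuine and the derivative negative. Thus nothing needs to be known
    about the set of degenerate parameters along the segment. If [e = f = g], the pairing is
    constant by the angle sum. *)
Lemma face_pairing_nonincr u v w P Q S e f g : 0 <= P -> 0 <= Q -> 0 <= S ->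
  forall a b : R, a <= b ->
  face_pairing (u + b * e) (v + b * f) (w + b * g) P Q S e f g <=
  face_pairing (u + a * e) (v + a * f) (w + a * g) P Q S e f g.
Proof.
move=> P0 Q0 S0.
have [/andP[/eqP <- /eqP <-] a b _|efg] := boolP ((e == f) && (e == g)).
  by rewrite /face_pairing -!mulrDr !face_angle_sum.
apply: (@nonincr_off_finite _ [:: e * pi; f * pi; g * pi]
  (fun s => face_pairing (line u e s) (line v f s) (line w g s) P Q S e f g)).
  move=> t; rewrite /face_pairing.
  have ac a b c a' b' c' I J K : 0 <= I -> 0 <= J ->
      face_angle (line a a' s) (line b b' s) (line c c' s) I J K @[s --> t] -->
      face_angle (line a a' t) (line b b' t) (line c c' t) I J K.
    by move=> *; apply: (cvg_face_angle (FF := nbhs_pfilter t)) => //; exact: line_cvg.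
  by apply: cvgD; [apply: cvgD|]; apply: cvgM; by [exact: cvg_cst|exact: ac].
move=> t tN; have tr : face_triangle (line u e t) (line v f t) (line w g t) P Q S.
  by apply: contraNT tN; exact: face_pairing_degenerate.
exists (- face_form (line u e t) (line v f t) (line w g t) P Q S e f g).
  rewrite oppr_lt0; apply: lt_le_trans (face_form_ge _ _ _ P0 Q0 S0 tr).
  rewrite pmulr_rgt0 ?face_const_gt0//.
  have [ef|ef] := eqVneq e f; last first.
    by rewrite -addrA ltr_pwDl ?addr_ge0 ?sqr_ge0// exprn_even_gt0//= subr_eq0.
  have eg : e != g by apply: contra efg => /eqP <-; rewrite ef !eqxx.
  rewrite addrAC ltr_wpDl ?addr_ge0 ?sqr_ge0// exprn_even_gt0//= subr_eq0//.
apply: (@dw_is_derive _ setT); first exact: filterT.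
by apply: dw_face_pairing => //; exact: dw_line.
Qed.

(** The end of the segment may be degenerate. A definite decrease is gained on an initial piece
    [[0, s]], where the triangle stays genuine and the form stays bounded below; on the rest the
    pairing cannot increase again. *)
Lemma face_pairing_strict u v w P Q S (M : R) : 0 <= P -> 0 <= Q -> 0 <= S ->
  face_triangle u v w P Q S -> 0 < M ->
  exists2 c : R, 0 < c & forall e f g, `|e| <= M -> `|f| <= M -> `|g| <= M ->
    face_pairing (u + e) (v + f) (w + g) P Q S e f g -
    face_pairing u v w P Q S e f g <=
    - (c * ((e - f) ^+ 2 + (e - g) ^+ 2 + (f - g) ^+ 2)).
Proof.
move=> P0 Q0 S0 tr M0.
pose K u v w := weight_const (expR u) (expR v) (expR w) P Q S /
    Num.sqrt (radii_heron (expR u) (expR v) (expR w) P Q S).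
have K0 : 0 < K u v w by exact: face_const_gt0.
have [d d0 dP] : exists2 d : R, 0 < d & forall e f g, `|e| < d -> `|f| < d -> `|g| < d ->
   face_triangle (u + e) (v + f) (w + g) P Q S /\
   K u v w / 2 < K (u + e) (v + f) (w + g).
  pose Z : R * R * R := (0, 0, 0).
  have p1 : p.1.1 @[p --> Z] --> (0 : R).
    exact: (cvg_comp _ _ (@cvg_fst _ _ (nbhs (0 : R, 0 : R)) (nbhs (0 : R)) _)
      (@cvg_fst _ _ (nbhs (0 : R)) (nbhs (0 : R)) _)).
  have p2 : p.1.2 @[p --> Z] --> (0 : R).
    exact: (cvg_comp _ _ (@cvg_fst _ _ (nbhs (0 : R, 0 : R)) (nbhs (0 : R)) _)
      (@cvg_snd _ _ (nbhs (0 : R)) (nbhs (0 : R)) _)).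
  have p3 : p.2 @[p --> Z] --> (0 : R) by exact: cvg_snd.
  have ecvg a (q : R * R * R -> R) : q p @[p --> Z] --> (0 : R) ->
      expR (a + q p) @[p --> Z] --> expR a.
    move=> q0; rewrite -[X in _ --> expR X](addr0 a).
    apply: continuous_cvg; first exact: continuous_expR.
    by apply: cvgD => //; exact: cvg_cst.
  have [e1 e2 e3] := And3 (ecvg u _ p1) (ecvg v _ p2) (ecvg w _ p3).
  have FZ : ProperFilter (nbhs Z) := nbhs_pfilter Z.
  have HK : K (u + p.1.1) (v + p.1.2) (w + p.2) @[p --> Z] --> K u v w.
    exact: (cvg_form_const (FF := FZ) e1 e2 e3 (expR_gt0 u) (expR_gt0 v) (expR_gt0 w)
      P0 Q0 S0 tr).
  have : \forall p \near Z, face_triangle (u + p.1.1) (v + p.1.2) (w + p.2) P Q S /\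
     K u v w / 2 < K (u + p.1.1) (v + p.1.2) (w + p.2).
    have h1 := near_radii_triangle (FF := FZ) e1 e2 e3 tr.
    have h2 : \forall p \near Z, K u v w / 2 < K (u + p.1.1) (v + p.1.2) (w + p.2).
      by apply: (cvgr_gt _ HK); lra.
    by apply: filterS2 h1 h2.
  move=> /nbhs_ballP[d /= d0 dP]; exists d => // e f g ed fd gd.
  by apply: (dP (e, f, g)); rewrite /ball /=; split; [split|]; rewrite /ball /= sub0r normrN.
(* Up to time [s] no coordinate moves by more than [s * M <= d / 2]. *)
pose s := Num.min 1 (d / (2 * M)).
have s0 : 0 < s by rewrite lt_min ltr01 divr_gt0// mulr_gt0.
exists (s * (K u v w / 2)); first by rewrite mulr_gt0// divr_gt0.
move=> e f g eM fM gM.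
have small h t : `|h| <= M -> 0 <= t -> t <= s -> `|t * h| < d.
  move=> hM t0 ts; rewrite normrM ger0_norm//.
  apply: (@le_lt_trans _ _ (d / (2 * M) * M)).
    by apply: ler_pM => //; apply: le_trans ts _; rewrite ge_min lexx orbT.
  by rewrite invfM mulrA mulfVK ?gt_eqF//; lra.
have good t : 0 <= t -> t <= s ->
   face_triangle (line u e t) (line v f t) (line w g t) P Q S /\
   K u v w / 2 < K (line u e t) (line v f t) (line w g t).
  by move=> t0 ts; apply: dP; exact: small.
have [|t|t tin tE] := @dw_MVT _ `[0, s]
   (fun s => face_pairing (line u e s) (line v f s) (line w g s) P Q S e f g)
   (fun t => - face_form (line u e t) (line v f t) (line w g t) P Q S e f g)
   0 s (ltW s0).
- by [].
- rewrite /= in_itv /= => /andP[t0 ts].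
  by apply: dw_face_pairing => //; [exact: dw_line..|exact: (good _ t0 ts).1].
move: tin; rewrite in_itv /= => /andP[t0 ts].
have [tr' Kt] := good t t0 ts.
have mono := face_pairing_nonincr u v w e f g P0 Q0 S0 (_ : s <= 1).
move: tE mono; rewrite /line !mul0r !addr0 subr0 !mul1r => tE mono.
apply: le_trans (_ : _ <= face_pairing (u + s * e) (v + s * f) (w + s * g) P Q S e f g -
  face_pairing u v w P Q S e f g) _.
  by rewrite lerD2r mono// ge_min lexx.
rewrite tE mulNr lerN2 [leRHS]mulrC -mulrA ler_pM2l//.
apply: le_trans (face_form_ge e f g P0 Q0 S0 tr').
by rewrite ler_wpM2r ?addr_ge0 ?sqr_ge0// ltW.
Unshelve. all: by end_near. Qed.

End FaceMonotone.

(** * Angles of a face whose radii have different scales *)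

Section ScaleSeparation.
Variable R : realType.
Implicit Types u v w P Q S : R.

(* A limit at [(0,0)] as a uniform statement about length scales. *)
Lemma near0_exp (h : R -> R -> R) (l : R) :
  h p.1 p.2 @[p --> ((0, 0) : R * R)] --> l ->
  forall e : R, 0 < e -> exists2 G : R, 0 < G & forall a b : R, a <= - G -> b <= - G ->
    `|h (expR a) (expR b) - l| <= e.
Proof.
move=> hl e e0; move/cvgrPdist_le/(_ e e0) : hl => /nbhs_ballP[d /= d0 dP].
exists (Num.max 1 (- ln (d / 2))); first by rewrite lt_max ltr01.
have small a : a <= - Num.max 1 (- ln (d / 2)) -> `|expR a| < d.
  move=> aG; rewrite gtr0_norm ?expR_gt0//.
  apply: (@le_lt_trans _ _ (d / 2)); last by lra.
  rewrite -[leRHS]lnK ?posrE ?divr_gt0// ler_expR (le_trans aG)//.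
  by rewrite lerNl le_max lexx orbT.
move=> a b aG bG; rewrite distrC; apply: (dP (expR a, expR b)).
by split; rewrite /ball /= sub0r normrN small.
Qed.

Lemma cos_angle_radiiE x y z P Q S : 0 < x -> 0 < y -> 0 < z ->
  0 <= P -> 0 <= Q -> 0 <= S ->
  cos_angle (edge_len y z S) (edge_len x y P) (edge_len x z Q) =
  (x ^+ 2 + x * y * P + x * z * Q - y * z * S) / (edge_len x y P * edge_len x z Q) :> R.
Proof.
move=> x0 y0 z0 P0 Q0 S0.
have A0 := edge_len_gt0 x0 y0 P0; have B0 := edge_len_gt0 x0 z0 Q0.
rewrite /cos_angle {1 2 3}/edge_len !sqr_sqrtr ?ltW ?edge2_gt0// /edge2.
by field; rewrite !gt_eqF.
Qed.

Section Limits.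
Variables (T : Type) (F : set_system T).
Context {FF : ProperFilter F}.
Variables (a b : T -> R) (P Q S : R).
Hypotheses (a0 : a t @[t --> F] --> (0 : R)) (b0 : b t @[t --> F] --> (0 : R)).

Let len0 c I : c t @[t --> F] --> (0 : R) -> edge_len (c t) 1 I @[t --> F] --> (1 : R).
Proof.
move=> c0; have E : edge_len 0 1 I = 1 :> R.
  by rewrite /edge_len /edge2 expr0n /= add0r mulr0 !mul0r addr0 expr1n sqrtr1.
rewrite -[X in _ --> X]E; have c1 : (fun=> 1 : R) t @[t --> F] --> (1 : R) by exact: cvg_cst.
exact: (cvg_edge_len (FF := FF) c0 c1).
Qed.

Let cvg_ratio (N : T -> R) (l : R) : N t @[t --> F] --> l ->
  clamped_acos (N t / (edge_len (a t) 1 P * edge_len (b t) 1 Q)) @[t --> F] -->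
  clamped_acos l.
Proof.
move=> Nl; apply: continuous_cvg; first exact: continuous_clamped_acos.
rewrite -[X in _ --> X]divr1 -[X in _ / X](mulr1 1).
apply: cvgM => //; apply: cvgV; first by rewrite mulr1 oner_neq0.
by apply: cvgM; exact: len0.
Qed.

Lemma cvg_small_angle : clamped_acos ((a t * b t + b t * P + a t * Q - S) /
    (edge_len (a t) 1 P * edge_len (b t) 1 Q)) @[t --> F] --> clamped_acos (- S).
Proof.
apply: cvg_ratio; have E : 0 * 0 + 0 * P + 0 * Q - S = - S by ring.
rewrite -[X in _ --> X]E.
apply: cvgB; last exact: cvg_cst.
by apply: cvgD; [apply: cvgD; [exact: cvgM|]|]; (apply: cvgM => //; exact: cvg_cst).
Qed.

Lemma cvg_large_angle : clamped_acos ((1 + a t * P + b t * Q - a t * b t * S) /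
    (edge_len (a t) 1 P * edge_len (b t) 1 Q)) @[t --> F] --> clamped_acos 1.
Proof.
apply: cvg_ratio; have E : 1 + 0 * P + 0 * Q - 0 * 0 * S = 1 :> R by ring.
rewrite -[X in _ --> X]E.
apply: cvgB; last by apply: cvgM; [exact: cvgM|exact: cvg_cst].
apply: cvgD; last by apply: cvgM => //; exact: cvg_cst.
by apply: cvgD; [exact: cvg_cst|apply: cvgM => //; exact: cvg_cst].
Qed.

End Limits.

Let pairF := nbhs_pfilter ((0, 0) : R * R).

(** With [x], [y], [z] the radii at [u], [v], [w]: after division by [y z] the cosine is continuous
    in the ratios [x / y] and [x / z], with value [- S] at zero. The clamp admits [S > 1]. *)
Lemma face_angle_small P Q S : 0 <= P -> 0 <= Q -> 0 <= S ->
  forall e : R, 0 < e -> exists2 G : R, 0 < G & forall u v w,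
    u + G <= v -> u + G <= w -> `|face_angle u v w P Q S - clamped_acos (- S)| <= e.
Proof.
move=> P0 Q0 S0 e e0.
pose h (t s : R) := clamped_acos ((t * s + s * P + t * Q - S) /
  (edge_len t 1 P * edge_len s 1 Q)).
have hl : h p.1 p.2 @[p --> ((0, 0) : R * R)] --> clamped_acos (- S).
  by rewrite /h; apply: (cvg_small_angle (FF := pairF)); [exact: cvg_fst|exact: cvg_snd].
have [G G0 GP] := near0_exp hl e0; exists G => // u v w uv uw.
have -> : face_angle u v w P Q S = h (expR (u - v)) (expR (u - w)).
  rewrite /face_angle /radii_angle /side_angle /h cos_angle_radiiE ?expR_gt0//.
  congr clamped_acos; rewrite !expRB.
  have := expR_gt0 u; have := expR_gt0 v; have := expR_gt0 w.
  move: (expR u) (expR v) (expR w) => x y z z0 y0 x0.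
  have sc k I : 0 < k -> edge_len x k I = k * edge_len (x / k) 1 I.
    by move=> k0; rewrite -edge_len_scale// mulr1 mulrC divfK// gt_eqF.
  rewrite (sc y)// (sc z)//.
  have A0 := edge_len_gt0 (divr_gt0 x0 y0) ltr01 P0.
  have B0 := edge_len_gt0 (divr_gt0 x0 z0) ltr01 Q0.
  move: A0 B0; move: (edge_len _ _ _) (edge_len _ _ _) => A B A0 B0.
  by field; rewrite !gt_eqF.
by apply: GP; lra.
Qed.

(** Here division by [x^2] leaves a function of [y / x] and [z / x] with value 1 at zero. *)
Lemma face_angle_large P Q S : 0 <= P -> 0 <= Q -> 0 <= S ->
  forall e : R, 0 < e -> exists2 G : R, 0 < G & forall u v w,
    v + G <= u -> w + G <= u -> face_angle u v w P Q S <= e.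
Proof.
move=> P0 Q0 S0 e e0.
pose h (t s : R) := clamped_acos ((1 + t * P + s * Q - t * s * S) /
  (edge_len t 1 P * edge_len s 1 Q)).
have hl : h p.1 p.2 @[p --> ((0, 0) : R * R)] --> clamped_acos (1 : R).
  by rewrite /h; apply: (cvg_large_angle (FF := pairF)); [exact: cvg_fst|exact: cvg_snd].
have [G G0 GP] := near0_exp hl e0; exists G => // u v w uv uw.
have -> : face_angle u v w P Q S = h (expR (v - u)) (expR (w - u)).
  rewrite /face_angle /radii_angle /side_angle /h cos_angle_radiiE ?expR_gt0//.
  congr clamped_acos; rewrite !expRB.
  have := expR_gt0 u; have := expR_gt0 v; have := expR_gt0 w.
  move: (expR u) (expR v) (expR w) => x y z z0 y0 x0.
  have sc k I : edge_len x k I = x * edge_len (k / x) 1 I.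
    by rewrite -edge_len_scale// mulr1 mulrC divfK ?gt_eqF// edge_lenC.
  rewrite (sc y)// (sc z)//.
  have A0 := edge_len_gt0 (divr_gt0 y0 x0) ltr01 P0.
  have B0 := edge_len_gt0 (divr_gt0 z0 x0) ltr01 Q0.
  move: A0 B0; move: (edge_len _ _ _) (edge_len _ _ _) => A B A0 B0.
  by field; rewrite !gt_eqF.
have vu : v - u <= - G by lra.
have wu : w - u <= - G by lra.
have := GP _ _ vu wu; rewrite clamped_acos_ge1// subr0.
by apply: le_trans; exact: ler_norm.
Qed.

End ScaleSeparation.

(** * Curvature on the surface *)

Section FaceTriples.
Variables (N : nat) (T : triangulation N).
Implicit Types i j k : 'I_N.

Definition is_face i j k : bool := [set i; j; k]%SET \in faces T.

Lemma is_face_rot i j k : is_face i j k = is_face j k i.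
Proof.
by rewrite /is_face -finset.setUA [([set i] :|: _)%SET]finset.setUC.
Qed.

Lemma is_face_swap i j k : is_face i j k = is_face i k j.
Proof. by rewrite /is_face finset.setUAC. Qed.

Lemma is_face_neq i j k : is_face i j k -> [/\ i != j, i != k & j != k].
Proof.
move=> /face_card; have [<-|ij] := eqVneq i j.
  by rewrite finset.setUid cards2; case: (_ != _).
have [<-|ik] := eqVneq i k.
  by rewrite finset.setUAC finset.setUid cards2; case: (_ != _).
have [<-|//] := eqVneq j k.
by rewrite -finset.setUA finset.setUid cards2; case: (_ != _).
Qed.

Lemma is_face_edge i j k : is_face i j k -> [set i; j]%SET \in edges T.
Proof.
move=> fijk; have [ij _ _] := is_face_neq fijk.
apply: (edge_of_face fijk); last by rewrite cards2 ij.
by apply/fintype.subsetP => x; rewrite !inE => ->.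
Qed.

Lemma edgeC i j : [set i; j]%SET = [set j; i]%SET.
Proof. exact: finset.setUC. Qed.

Lemma edge_in_face i j : [set i; j]%SET \in edges T -> exists k, is_face i j k.
Proof.
move=> ije; have := edge_two_faces ije; have := edge_card ije.
move=> ij2 two; have : (0 < #|[set f in faces T | [set i; j]%SET \subset f]%SET|)%N.
  by rewrite two.
case/card_gt0P => f; rewrite inE => /andP[fF ijf].
have f3 := face_card fF.
have : (0 < #|(f :\: [set i; j])%SET|)%N.
  by rewrite cardsDS// f3 ij2.
case/card_gt0P => k; rewrite inE => /andP[kij kf]; exists k.
rewrite /is_face; suff -> : [set i; j; k]%SET = f by [].
apply/eqP; rewrite eqEcard finset.subUset ijf finset.sub1set kf f3 /=.
by rewrite finset.setUC cardsU1 kij ij2.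
Qed.

Section Sums.
Variable R : zmodType.
Implicit Types g : 'I_N -> 'I_N -> 'I_N -> R.

Definition face_sum g : R := \sum_i \sum_j \sum_(k | is_face i j k) g i j k.

Lemma face_sum_rot g : face_sum g = face_sum (fun i j k => g j k i).
Proof.
rewrite /face_sum.
under eq_bigr do under eq_bigr do rewrite big_mkcond.
under [RHS]eq_bigr do under eq_bigr do rewrite big_mkcond.
rewrite [RHS]exchange_big /=; under [RHS]eq_bigr do rewrite exchange_big /=.
apply: eq_bigr => j _; apply: eq_bigr => k _; apply: eq_bigr => i _.
by rewrite -is_face_rot.
Qed.

(** Connects the pairs [p.1 < p.2] of the curvature with sums over all ordered triples, in which the
    indices may be rotated freely. *)
Lemma face_sum_ordered g i : (forall j k, g i j k = g i k j) ->
  \sum_j \sum_(k | is_face i j k) g i j k =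
  (\sum_(p : 'I_N * 'I_N | (p.1 < p.2)%N && is_face i p.1 p.2) g i p.1 p.2) *+ 2.
Proof.
move=> gC; under eq_bigr do rewrite big_mkcond /=.
rewrite pair_bigA /= -big_mkcond /= (bigID (fun p : 'I_N * 'I_N => (p.1 < p.2)%N)) /=.
rewrite mulr2n; congr (_ + _); first by apply: eq_bigl => p; rewrite andbC.
have swapK : involutive (fun p : 'I_N * 'I_N => (p.2, p.1)) by case.
rewrite (reindex_inj (inv_inj swapK)) /=.
apply: eq_big => [[j k]|[j k] _] /=; last by rewrite gC.
rewrite is_face_swap andbC; have [fijk|//] := boolP (is_face i j k); last by rewrite !andbF.
have [_ _ jk] := is_face_neq fijk; rewrite !andbT -leqNgt leq_eqVlt.
by have -> : (val j == val k) = false by apply/negbTE.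
Qed.

End Sums.

End FaceTriples.

(** * Counting incidences of vertices, edges and faces *)

Section FaceCount.
Variables (N : nat) (T : triangulation N).
Implicit Types (i j k : 'I_N) (f e : {set 'I_N}).

Lemma card_third_vertex f i j : #|f| = 3%N ->
  #|[set k | [set i; j; k]%SET == f]%SET| = [&& i \in f, j \in f & i != j].
Proof.
move=> f3; have [/and3P[fi fj ij]|nfij] := boolP [&& _, _ & _].
  have -> : [set k | [set i; j; k]%SET == f]%SET = (f :\: [set i; j])%SET.
    apply/setP => k; rewrite !inE eqEcard f3 !finset.subUset !finset.sub1set fi fj /=.
    rewrite [(_ :|: [set k])%SET]finset.setUC cardsU1 !inE cards2 ij andbC.
    by case: (_ || _).
  by rewrite cardsDS ?f3 ?cards2 ?ij// finset.subUset !finset.sub1set fi fj.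
apply/eqP; rewrite cards_eq0; apply/eqP/setP => k; rewrite !inE.
apply: contraNF nfij => /eqP fE; rewrite -fE !inE !eqxx !orbT /=.
apply: contra_eqN f3 => /eqP ij; rewrite -fE ij.
by rewrite finset.setUC cardsU1 !inE cards2 eqxx; case: (_ || _).
Qed.

Lemma pair_eq_card2 e i j : #|e| = 2%N ->
  ([set i; j]%SET == e) = [&& i \in e, j \in e & i != j].
Proof.
move=> e2; rewrite eqEcard e2 finset.subUset !finset.sub1set cards2.
by case: (i \in e); case: (j \in e); case: (i == j).
Qed.

Lemma sum_ordered_pairs f :
  (\sum_i \sum_j [&& i \in f, j \in f & i != j] = #|f| * #|f|.-1)%N.
Proof.
rewrite -sum_nat_const [RHS]big_mkcond; apply: eq_bigr => i _.
have [fi|] := boolP (i \in f); last by rewrite /= big1.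
rewrite (cardsD1 i) fi /= -sum1_card [RHS]big_mkcond; apply: eq_bigr => j _.
by rewrite !inE eq_sym; case: (j \in f) => //; case: (_ == _).
Qed.

Lemma card_third_vertex_faces i j :
  (\sum_(k | is_face T i j k) 1 =
   \sum_(f in faces T) [&& i \in f, j \in f & i != j])%N.
Proof.
rewrite big_mkcond /=; under eq_bigr => k _.
  have -> : (if is_face T i j k then 1 else 0) =
      (\sum_(f in faces T) ([set i; j; k]%SET == f))%N.
    rewrite /is_face; case: ifPn => [F|nF].
      by rewrite (bigD1 _ F) /= eqxx big1// => f /andP[_ /negbTE]; rewrite eq_sym => ->.
    by rewrite big1// => f fF; case: eqP => // fE; rewrite fE fF in nF.
  over.
rewrite exchange_big /=; apply: eq_bigr => f fF.
rewrite -(card_third_vertex _ _ (face_card fF)) -sum1_card [RHS]big_mkcond.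
by apply: eq_bigr => k _; rewrite inE; case: (_ == _).
Qed.

Lemma card_face_triples :
  (\sum_i \sum_j \sum_(k | is_face T i j k) 1 = 6 * #|faces T|)%N.
Proof.
under eq_bigr do under eq_bigr do rewrite card_third_vertex_faces.
under eq_bigr do rewrite exchange_big /=.
rewrite exchange_big /=; under eq_bigr => f fF.
  rewrite sum_ordered_pairs (face_card fF); over.
by rewrite sum_nat_const mulnC.
Qed.

(** An edge has two orientations and lies in two faces. Against six triples per face this yields 3 F
    = 2 E, the relation behind Gauss-Bonnet. *)
Lemma card_face_triples_edges :
  (\sum_i \sum_j \sum_(k | is_face T i j k) 1 = 4 * #|edges T|)%N.
Proof.
under eq_bigr do under eq_bigr do rewrite card_third_vertex_faces.
have E i j : (\sum_(f in faces T) [&& i \in f, j \in f & i != j] =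
    \sum_(e in edges T) 2 * [&& i \in e, j \in e & i != j])%N.
  rewrite -big_distrr /= [X in (2 * X)%N](eq_bigr (fun e => nat_of_bool ([set i; j]%SET == e))); last first.
    by move=> e eE; rewrite pair_eq_card2// (edge_card eE).
  have [ijE|nE] := boolP ([set i; j]%SET \in edges T); last first.
    rewrite [X in (2 * X)%N]big1 ?muln0.
      rewrite big1// => f fF; apply/eqP; rewrite eqb0; apply: contra nE => /and3P[fi fj ij].
      apply: (edge_of_face fF); last by rewrite cards2 ij.
      by rewrite finset.subUset !finset.sub1set fi fj.
    by move=> e eE; case: eqP => // ijE; rewrite ijE eE in nE.
  rewrite [in RHS](bigD1 _ ijE) /= eqxx [X in (_ + X)%N]big1 ?addn0; last first.
    by move=> e /andP[_ /negbTE]; rewrite eq_sym => ->.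
  rewrite [RHS](_ : _ = 2%N)// -(edge_two_faces ijE) -sum1_card [RHS]big_mkcond [LHS]big_mkcond.
  have ij : i != j by move: (edge_card ijE); rewrite cards2; case: (i != j).
  apply: eq_bigr => f _; rewrite inE finset.subUset !finset.sub1set ij.
  by case: (f \in faces T); case: (i \in f); case: (j \in f).
under eq_bigr do under eq_bigr do rewrite E.
under eq_bigr do rewrite exchange_big /=.
rewrite exchange_big /=; under eq_bigr => e eE.
  under eq_bigr do rewrite -big_distrr /=.
  rewrite -big_distrr /= sum_ordered_pairs (edge_card eE); over.
by rewrite sum_nat_const mulnC.
Qed.

End FaceCount.

(** * The extended curvature in logarithmic coordinates *)

Section ExtendedCurvature.
Variables (R : realType) (N : nat) (T : triangulation N) (I : {set 'I_N} -> R).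
Hypothesis I_ge0 : forall e, e \in edges T -> 0 <= I e.
Implicit Types (u v : 'rV[R]_N) (e : 'I_N -> R) (i j k : 'I_N).

Lemma face_I_ge0 i j k : is_face T i j k ->
  [/\ 0 <= I [set i; j]%SET, 0 <= I [set i; k]%SET & 0 <= I [set j; k]%SET].
Proof.
move=> F; split; apply: I_ge0.
- exact: is_face_edge F.
- by apply: (@is_face_edge _ T _ _ j); rewrite -is_face_swap.
- by apply: (@is_face_edge _ T _ _ i); rewrite -is_face_rot.
Qed.

Definition log_angle u i j k : R := face_angle (u 0 i) (u 0 j) (u 0 k)
  (I [set i; j]%SET) (I [set i; k]%SET) (I [set j; k]%SET).

Definition log_triangle u i j k : bool := face_triangle (u 0 i) (u 0 j) (u 0 k)
  (I [set i; j]%SET) (I [set i; k]%SET) (I [set j; k]%SET).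

Definition log_pairing u e i j k : R := face_pairing (u 0 i) (u 0 j) (u 0 k)
  (I [set i; j]%SET) (I [set i; k]%SET) (I [set j; k]%SET) (e i) (e j) (e k).

Definition ext_log_curvature u i : R := ext_curvature T I (map_mx expR u) i.

Lemma edge_length_sym (r : 'rV[R]_N) i j : edge_length I r i j = edge_length I r j i.
Proof. by rewrite /edge_length edgeC; congr Num.sqrt; ring. Qed.

Lemma edge_lengthE u i j : edge_length I (map_mx expR u) i j =
  edge_len (expR (u 0 i)) (expR (u 0 j)) (I [set i; j]%SET).
Proof. by rewrite /edge_length !mxE. Qed.

Lemma nondegenerateE u i j k :
  Defs.nondegenerate I (map_mx expR u) i j k = log_triangle u i j k.
Proof.
rewrite /Defs.nondegenerate /log_triangle /face_triangle /radii_triangle /is_triangle.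
rewrite [edge_length I _ k j]edge_length_sym [edge_length I _ j i]edge_length_sym.
rewrite !edge_lengthE; set a := edge_len _ _ _; set b := edge_len _ _ _.
set c := edge_len _ _ _; move: a b c => a b c.
by apply/idP/idP => /and3P[*]; apply/and3P; split; lra.
Qed.

Lemma positive_expR u : positive_radii (map_mx expR u).
Proof. by move=> i; rewrite mxE expR_gt0. Qed.

Lemma admissibleE u : admissible T I (map_mx expR u) <->
  forall i j k, is_face T i j k -> log_triangle u i j k.
Proof.
split=> [[_ H] i j k F|H]; first by rewrite -nondegenerateE; exact: H.
by split=> [|i j k F]; [exact: positive_expR|rewrite nondegenerateE; exact: H].
Qed.

(** The three cases of [ext_angle] are the ranges where the clamp is inactive, active at -1, or
    active at 1. One continuous formula thus replaces the case distinction. *)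
Lemma ext_angleE u i j k : is_face T i j k ->
  ext_angle I (map_mx expR u) i j k = log_angle u i j k.
Proof.
move=> F; have [P0 Q0 S0] := face_I_ge0 F.
have x0 := expR_gt0 (u 0 i); have y0 := expR_gt0 (u 0 j); have z0 := expR_gt0 (u 0 k).
have [h1 h2 h3] := cos_angle_lt (edge_len_gt0 y0 z0 S0) (edge_len_gt0 x0 y0 P0)
  (edge_len_gt0 x0 z0 Q0).
rewrite /ext_angle nondegenerateE /angle !edge_lengthE.
rewrite /log_angle /face_angle /radii_angle /side_angle /log_triangle.
rewrite /face_triangle /radii_triangle; case: ifPn => [tr|ntr].
  by rewrite clamped_acosE//; move: h3; rewrite tr => /andP[? ?]; rewrite !ltW.
case: ifPn; first by rewrite addrC -h1 => /clamped_acos_leN1.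
rewrite addrC -h1 -ltNge => c1; rewrite clamped_acos_ge1// leNgt.
by apply: contra ntr => c2; rewrite -h3 c1.
Qed.

Lemma angleE u i j k : is_face T i j k -> log_triangle u i j k ->
  angle I (map_mx expR u) i j k = log_angle u i j k.
Proof. by move=> F; rewrite -nondegenerateE -ext_angleE// /ext_angle => ->. Qed.

Lemma ext_log_curvatureE u i : ext_log_curvature u i = 2 * pi -
  \sum_(p : 'I_N * 'I_N | (p.1 < p.2)%N && is_face T i p.1 p.2) log_angle u i p.1 p.2.
Proof.
congr (_ - _); apply: eq_bigr => -[j k] /= /andP[_ F]; exact: ext_angleE.
Qed.

Lemma curvature_log_admissible u i : admissible T I (map_mx expR u) ->
  curvature T I (map_mx expR u) i = ext_log_curvature u i.
Proof.
move=> /admissibleE adm; rewrite ext_log_curvatureE; congr (_ - _).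
by apply: eq_bigr => -[j k] /= /andP[_ F]; apply: angleE => //; exact: adm.
Qed.

Lemma log_angleC u i j k : log_angle u i j k = log_angle u i k j.
Proof. by rewrite /log_angle face_angleC [in RHS](edgeC k j). Qed.

Lemma log_angle_sum u i j k : is_face T i j k ->
  log_angle u i j k + log_angle u j k i + log_angle u k i j = pi.
Proof.
move=> F; have [P0 Q0 S0] := face_I_ge0 F.
rewrite /log_angle (edgeC j i) (edgeC k i) (edgeC k j).
exact: face_angle_sum.
Qed.

Lemma log_pairingE u e i j k : log_pairing u e i j k =
  e i * log_angle u i j k + e j * log_angle u j k i + e k * log_angle u k i j.
Proof.
by rewrite /log_pairing /face_pairing /log_angle (edgeC j i) (edgeC k i) (edgeC k j).
Qed.

(** Regroups the vertex sum by faces, so that facewise monotonicity passes to the curvature. A face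
    occurs as six ordered triples, whence [6^-1]. *)
Lemma curvature_pairing u e : \sum_i e i * ext_log_curvature u i =
  2 * pi * \sum_i e i - 6^-1 * face_sum T (log_pairing u e).
Proof.
have -> : face_sum T (log_pairing u e) =
    3 * face_sum T (fun i j k => e i * log_angle u i j k).
  pose g i j k := e i * log_angle u i j k.
  rewrite (_ : face_sum T (log_pairing u e) = face_sum T g +
    face_sum T (fun i j k => g j k i) + face_sum T (fun i j k => g k i j)); last first.
    rewrite /face_sum -!big_split; apply: eq_bigr => i _ /=.
    rewrite -!big_split; apply: eq_bigr => j _ /=.
    by rewrite -!big_split; apply: eq_bigr => k _ /=; rewrite log_pairingE.
  by rewrite -(face_sum_rot T g) (face_sum_rot T (fun i j k => g k i j)) -/g; ring.
have -> : face_sum T (fun i j k => e i * log_angle u i j k) =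
  2 * \sum_i e i * (2 * pi - ext_log_curvature u i).
  rewrite /face_sum big_distrr /=; apply: eq_bigr => i _.
  rewrite (@face_sum_ordered _ T _ (fun i j k => e i * log_angle u i j k)); last first.
    by move=> j k; rewrite log_angleC.
  rewrite ext_log_curvatureE opprB addrCA subrr addr0 -[LHS]mulr_natl.
  by congr (_ * _); rewrite big_distrr.
have -> : \sum_i e i * (2 * pi - ext_log_curvature u i) =
   2 * pi * (\sum_i e i) - \sum_i e i * ext_log_curvature u i.
  rewrite big_distrr /= -sumrB; apply: eq_bigr => i _; ring.
by field.
Qed.

(** In the constant direction each face contributes its angle sum [pi], so only the number of faces
    remains. *)
Lemma gauss_bonnet u :
  \sum_i ext_log_curvature u i = 2 * pi * (euler_char T)%:~R.
Proof.
have := curvature_pairing u (fun=> 1).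
under eq_bigr do rewrite mul1r.
move=> ->; rewrite big_const_ord iter_addr_0.
have -> : face_sum T (log_pairing u (fun=> 1)) =
    pi * (\sum_i \sum_j \sum_(k | is_face T i j k) 1)%N%:R.
  rewrite natr_sum big_distrr; apply: eq_bigr => i _ /=.
  rewrite natr_sum big_distrr; apply: eq_bigr => j _ /=.
  rewrite natr_sum big_distrr; apply: eq_bigr => k F /=.
  by rewrite log_pairingE !mul1r log_angle_sum// mulr1.
have := card_face_triples T; rewrite card_face_triples_edges.
move=> /(congr1 (fun n => n%:R : R)); rewrite !natrM /euler_char.
rewrite !rmorphD rmorphN /= -!pmulrn.
move=> H; have -> : #|faces T|%:R = 2 / 3 * #|edges T|%:R :> R by lra.
by field.
Qed.

End ExtendedCurvature.

(** * Monotonicity of the curvature map *)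

Section CurvatureMonotone.
Variables (R : realType) (N : nat) (T : triangulation N) (I : {set 'I_N} -> R).
Hypothesis I_ge0 : forall e, e \in edges T -> 0 <= I e.
Implicit Types (u v : 'rV[R]_N) (e : 'I_N -> R) (i j k : 'I_N) (A : {set 'I_N}).

Let K := ext_log_curvature T I.

Lemma ler_face_sum (f g : 'I_N -> 'I_N -> 'I_N -> R) :
  (forall i j k, is_face T i j k -> f i j k <= g i j k) ->
  face_sum T f <= face_sum T g.
Proof.
by move=> fg; apply: ler_sum => i _; apply: ler_sum => j _; apply: ler_sum => k; exact: fg.
Qed.

Lemma curvature_pairingB u v e : \sum_i e i * (K u i - K v i) =
  6^-1 * (face_sum T (log_pairing I v e) - face_sum T (log_pairing I u e)).
Proof.
transitivity (\sum_i e i * K u i - \sum_i e i * K v i).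
  by rewrite -sumrB; apply: eq_bigr => i _; rewrite mulrBr.
by rewrite !curvature_pairing//; ring.
Qed.

Lemma ext_curvature_monotone u v :
  0 <= \sum_i (u 0 i - v 0 i) * (K u i - K v i).
Proof.
rewrite curvature_pairingB mulr_ge0 ?subr_ge0//.
apply: ler_face_sum => i j k F; have [P0 Q0 S0] := face_I_ge0 I_ge0 F.
have := face_pairing_nonincr (v 0 i) (v 0 j) (v 0 k) (u 0 i - v 0 i) (u 0 j - v 0 j)
  (u 0 k - v 0 k) P0 Q0 S0 ler01.
by rewrite !mul0r !addr0 !mul1r ![v 0 _ + _]addrC !subrK.
Qed.

Definition face_energy e : R := face_sum T (fun i j k =>
  (e i - e j) ^+ 2 + (e i - e k) ^+ 2 + (e j - e k) ^+ 2).

Let term_ge0 (x y z : R) : 0 <= (x - y) ^+ 2 + (x - z) ^+ 2 + (y - z) ^+ 2.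
Proof. by rewrite !addr_ge0 ?sqr_ge0. Qed.

Lemma face_energy_ge0 e : 0 <= face_energy e.
Proof. by do 3! (apply: sumr_ge0 => ? _); exact: term_ge0. Qed.

Lemma edge_energy e i j : [set i; j]%SET \in edges T ->
  (e i - e j) ^+ 2 <= face_energy e.
Proof.
move=> /edge_in_face[k F]; rewrite /face_energy /face_sum (bigD1 i)//= (bigD1 j)//=.
rewrite (bigD1 k)//= -!addrA lerDl !addr_ge0 ?sqr_ge0//.
- by apply: sumr_ge0 => ? _; exact: term_ge0.
- by do 2! (apply: sumr_ge0 => ? _); exact: term_ge0.
- by do 3! (apply: sumr_ge0 => ? _); exact: term_ge0.
Qed.

(** Induction along a path of edges with [(x + y)^2 <= 2 x^2 + 2 y^2]; the constant depends on the
    path and not on [e]. *)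
Lemma pair_energy i j : exists2 C : R, 0 < C &
  forall e, (e i - e j) ^+ 2 <= C * face_energy e.
Proof.
have /connectP[p] := surface_connected T i j.
elim: p i => [|k p IH] i /=.
  by move=> _ ->; exists 1 => // e; rewrite subrr expr0n /= mul1r face_energy_ge0.
move=> /andP[ik pp] jl; have [C C0 CP] := IH k pp jl.
exists (2 + 2 * C); first lra.
move=> e; have := CP e; have := edge_energy e ik.
have := sqr_ge0 ((e i - e k) - (e k - e j)).
have -> : (e i - e j) ^+ 2 = 2 * (e i - e k) ^+ 2 + 2 * (e k - e j) ^+ 2 -
  ((e i - e k) - (e k - e j)) ^+ 2 by ring.
by lra.
Qed.

(** A discrete Poincare inequality on the connected surface. *)
Lemma total_energy : exists2 c : R, 0 < c &
  forall e, c * (\sum_i \sum_j (e i - e j) ^+ 2) <= face_energy e.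
Proof.
(* Instead of a maximum over finitely many constants: each condition holds for all large [C], hence
   so do all of them together. *)
have : \forall C \near +oo%R, forall p : 'I_N * 'I_N,
    forall e, (e p.1 - e p.2) ^+ 2 <= C * face_energy e.
  apply: filter_forall => -[i j] /=; have [C C0 CP] := pair_energy i j.
  apply: filterS (nbhs_pinfty_ge (num_real C)) => D CD e.
  by apply: le_trans (CP e) _; rewrite ler_wpM2r ?face_energy_ge0.
move=> near_C.
have [C [C0 CP]] : exists C : R, 0 < C /\ forall p : 'I_N * 'I_N,
    forall e, (e p.1 - e p.2) ^+ 2 <= C * face_energy e.
  near +oo_R => C; exists C; split; last by near: C.
  by near: C; exact: nbhs_pinfty_gt.
have N0 : 0 < N%:R :> R by rewrite ltr0n (vertex_nonempty T).
exists (N%:R * N%:R * C)^-1; first by rewrite invr_gt0 !mulr_gt0.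
move=> e; rewrite ler_pdivrMl ?mulr_gt0//.
apply: (@le_trans _ _ (\sum_(i < N) \sum_(j < N) C * face_energy e)).
  by apply: ler_sum => i _; apply: ler_sum => j _; exact: (CP (i, j)).
have S (x : R) : \sum_(i < N) x = N%:R * x by rewrite sumr_const card_ord mulr_natl.
by rewrite !S !mulrA.
Unshelve. all: by end_near. Qed.

(** Only [v] has to be admissible, while [u] ranges over a whole box. Differences of coordinates
    appear rather than a norm, because scaling does not change the curvature. *)
Lemma ext_curvature_strong v (M : R) :
  admissible T I (map_mx expR v) -> 0 < M ->
  exists2 c : R, 0 < c & forall u, (forall i, `|u 0 i - v 0 i| <= M) ->
    c * (\sum_i \sum_j ((u 0 i - v 0 i) - (u 0 j - v 0 j)) ^+ 2) <=
    \sum_i (u 0 i - v 0 i) * (K u i - K v i).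
Proof.
move=> /admissibleE adm M0.
have Hnear : \forall c \near (0 : R)^'+, forall t : 'I_N * 'I_N * 'I_N,
    is_face T t.1.1 t.1.2 t.2 -> forall e, (forall i, `|e i| <= M) ->
    log_pairing I (v + \row_i e i) e t.1.1 t.1.2 t.2 -
      log_pairing I v e t.1.1 t.1.2 t.2 <=
    - (c * ((e t.1.1 - e t.1.2) ^+ 2 + (e t.1.1 - e t.2) ^+ 2 + (e t.1.2 - e t.2) ^+ 2)).
  apply: filter_forall => -[[i j] k] /=.
  have [F|nF] := boolP (is_face T i j k); last by apply: nearW.
  have [P0 Q0 S0] := face_I_ge0 I_ge0 F.
  have [c c0 cP] := face_pairing_strict P0 Q0 S0 (adm _ _ _ F) M0.
  apply: filterS (nbhs_right_le c0) => d dc _ e eM.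
  have := cP _ _ _ (eM i) (eM j) (eM k); rewrite /log_pairing !mxE.
  move=> /le_trans; apply; by rewrite lerN2 ler_wpM2r.
have [d [d0 dP]] : exists d : R, 0 < d /\ forall t : 'I_N * 'I_N * 'I_N,
    is_face T t.1.1 t.1.2 t.2 -> forall e, (forall i, `|e i| <= M) ->
    log_pairing I (v + \row_i e i) e t.1.1 t.1.2 t.2 -
      log_pairing I v e t.1.1 t.1.2 t.2 <=
    - (d * ((e t.1.1 - e t.1.2) ^+ 2 + (e t.1.1 - e t.2) ^+ 2 + (e t.1.2 - e t.2) ^+ 2)).
  near (0 : R)^'+ => d; exists d; split; last by near: d.
  by near: d; exact: nbhs_right_gt.
have [c c0 cP] := total_energy.
exists (6^-1 * d * c); first by rewrite !mulr_gt0.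
move=> u uM; rewrite curvature_pairingB -!mulrA ler_pM2l//.
pose e i := u 0 i - v 0 i.
apply: (@le_trans _ _ (d * face_energy e)); first by rewrite ler_pM2l// cP.
rewrite -lerN2 opprB /face_energy /face_sum.
have uE : u = v + \row_i e i by apply/rowP => i; rewrite !mxE /e addrC subrK.
rewrite mulr_sumr -!sumrB -sumrN; apply: ler_sum => i _.
rewrite mulr_sumr -!sumrB -sumrN; apply: ler_sum => j _.
rewrite mulr_sumr -!sumrB -sumrN; apply: ler_sum => k F.
by rewrite {1}uE; exact: (dP (i, j, k) F).
Unshelve. all: by end_near. Qed.

End CurvatureMonotone.

Lemma cvg_sum (R : realType) (S : Type) (F : set_system S) (FF : Filter F)
    (J : Type) (r : seq J) (P : pred J) (f : J -> S -> R) (l : J -> R) :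
  (forall j, P j -> f j t @[t --> F] --> l j) ->
  \sum_(j <- r | P j) f j t @[t --> F] --> \sum_(j <- r | P j) l j.
Proof.
move=> fl; elim: r => [|j r IH].
  by rewrite big_nil; under eq_fun do rewrite big_nil; exact: cvg_cst.
rewrite big_cons; under eq_fun do rewrite big_cons.
by case: ifPn => // Pj; apply: cvgD => //; exact: fl.
Qed.

(** * Total curvature of a group of vertices at a much smaller scale *)

Section CurvatureGap.
Variables (R : realType) (N : nat) (T : triangulation N) (I : {set 'I_N} -> R).
Hypothesis I_ge0 : forall e, e \in edges T -> 0 <= I e.
Implicit Types (u v : 'rV[R]_N) (i j k : 'I_N) (A : {set 'I_N}).

Let K := ext_log_curvature T I.

Definition scale_gap A (G : R) u : Prop :=
  forall i j, i \in A -> j \notin A -> u 0 i + G <= u 0 j.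

Definition indicator A i : R := (i \in A)%:R.

Lemma scale_gap_le A (G G' : R) u : G' <= G -> scale_gap A G u -> scale_gap A G' u.
Proof. by move=> GG H i j iA jA; apply: le_trans (H i j iA jA); rewrite lerD2l. Qed.

(* Up to [e], the angle sum of a face over its vertices in [A] does not depend
   on [u] once [A] is far below the other vertices: the angle at a small vertex
   only depends on the inversive distance of the opposite edge, and the angle
   opposite to a short edge is small. *)
Lemma gap_pairing A i j k (e : R) : is_face T i j k -> 0 < e ->
  exists2 G : R, 0 < G & forall u v, scale_gap A G u -> scale_gap A G v ->
    log_pairing I u (indicator A) i j k - log_pairing I v (indicator A) i j k <= e.
Proof.
move=> F e0; have e20 : 0 < e / 2 by lra.
have [P0 Q0 S0] := face_I_ge0 I_ge0 F.
have [G1 G10 s1] := face_angle_small P0 Q0 S0 e20.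
have [G2 G20 s2] := face_angle_small S0 P0 Q0 e20.
have [G3 G30 s3] := face_angle_small Q0 S0 P0 e20.
have [G4 G40 l1] := face_angle_large P0 Q0 S0 e0.
have [G5 G50 l2] := face_angle_large S0 P0 Q0 e0.
have [G6 G60 l3] := face_angle_large Q0 S0 P0 e0.
pose G := G1 + G2 + G3 + G4 + G5 + G6; exists G; first by rewrite /G; lra.
have [GG1 GG2 GG3] : [/\ G1 <= G, G2 <= G & G3 <= G] by rewrite /G; split; lra.
have [GG4 GG5 GG6] : [/\ G4 <= G, G5 <= G & G6 <= G] by rewrite /G; split; lra.
clearbody G => u v gu gv.
rewrite /log_pairing /face_pairing /indicator.
have su := face_angle_sum (u 0 i) (u 0 j) (u 0 k) P0 Q0 S0.
have sv := face_angle_sum (v 0 i) (v 0 j) (v 0 k) P0 Q0 S0.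
have pos a b c I1 I2 I3 : 0 <= face_angle a b c I1 I2 I3 :> R.
  by have /andP[] := face_angle_bound a b c I1 I2 I3.
have below w H a b : scale_gap A G w -> H <= G -> a \in A -> b \notin A ->
    w 0 a + H <= w 0 b.
  by move=> gw HG aA bA; exact: (scale_gap_le HG gw).
have close (x y l : R) : `|x - l| <= e / 2 -> `|y - l| <= e / 2 -> x - y <= e.
  by rewrite !ler_norml => /andP[? ?] /andP[? ?]; lra.
have [iA|iA] := boolP (i \in A); have [jA|jA] := boolP (j \in A);
  have [kA|kA] := boolP (k \in A); rewrite /= !(mul1r, mul0r, add0r, addr0).
- by rewrite su sv subrr ltW.
- have := l3 (v 0 k) (v 0 i) (v 0 j) (below _ _ _ _ gv GG6 iA kA) (below _ _ _ _ gv GG6 jA kA).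
  have := pos (u 0 k) (u 0 i) (u 0 j) (I [set i; k]%SET) (I [set j; k]%SET) (I [set i; j]%SET).
  by lra.
- have := l2 (v 0 j) (v 0 k) (v 0 i) (below _ _ _ _ gv GG5 kA jA) (below _ _ _ _ gv GG5 iA jA).
  have := pos (u 0 j) (u 0 k) (u 0 i) (I [set j; k]%SET) (I [set i; j]%SET) (I [set i; k]%SET).
  by lra.
- apply: close (s1 _ _ _ _ _) (s1 _ _ _ _ _); exact: below.
- have := l1 (v 0 i) (v 0 j) (v 0 k) (below _ _ _ _ gv GG4 jA iA) (below _ _ _ _ gv GG4 kA iA).
  have := pos (u 0 i) (u 0 j) (u 0 k) (I [set i; j]%SET) (I [set i; k]%SET) (I [set j; k]%SET).
  by lra.
- apply: close (s2 _ _ _ _ _) (s2 _ _ _ _ _); exact: below.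
- apply: close (s3 _ _ _ _ _) (s3 _ _ _ _ _); exact: below.
- by rewrite oppr0 ltW.
Qed.

Lemma gap_curvature_cauchy A (e : R) : 0 < e ->
  exists2 G : R, 0 < G & forall u v, scale_gap A G u -> scale_gap A G v ->
    \sum_i indicator A i * (K u i - K v i) <= e.
Proof.
move=> e0; have N0 : 0 < N%:R :> R by rewrite ltr0n (vertex_nonempty T).
pose d := e / (N%:R * N%:R * N%:R).
have d0 : 0 < d by rewrite divr_gt0 // !mulr_gt0.
have Hnear : \forall G \near +oo%R, forall t : 'I_N * 'I_N * 'I_N,
    is_face T t.1.1 t.1.2 t.2 -> forall u v, scale_gap A G u -> scale_gap A G v ->
    log_pairing I v (indicator A) t.1.1 t.1.2 t.2 -
    log_pairing I u (indicator A) t.1.1 t.1.2 t.2 <= d.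
  apply: filter_forall => -[[i j] k] /=.
  have [F|nF] := boolP (is_face T i j k); last by apply: nearW.
  have [G G0 GP] := gap_pairing A F d0.
  apply: filterS (nbhs_pinfty_ge (num_real G)) => H GH _ u v gu gv.
  by apply: GP; apply: scale_gap_le GH _.
have [G [G0 GP]] : exists G : R, 0 < G /\ forall t : 'I_N * 'I_N * 'I_N,
    is_face T t.1.1 t.1.2 t.2 -> forall u v, scale_gap A G u -> scale_gap A G v ->
    log_pairing I v (indicator A) t.1.1 t.1.2 t.2 -
    log_pairing I u (indicator A) t.1.1 t.1.2 t.2 <= d.
  near +oo_R => G; exists G; split; last by near: G.
  by near: G; exact: nbhs_pinfty_gt.
exists G => // u v gu gv; rewrite curvature_pairingB//.
have : face_sum T (log_pairing I v (indicator A)) -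
    face_sum T (log_pairing I u (indicator A)) <= \sum_(i < N) \sum_(j < N) \sum_(k < N) d.
  rewrite /face_sum -sumrB; apply: ler_sum => i _.
  rewrite -sumrB; apply: ler_sum => j _.
  rewrite -sumrB big_mkcond; apply: ler_sum => k _.
  by case: ifPn => [F|_]; [exact: (GP (i, j, k))|exact: ltW].
have S (x : R) : \sum_(i < N) x = N%:R * x by rewrite sumr_const card_ord mulr_natl.
rewrite !S.
have -> : N%:R * (N%:R * (N%:R * d)) = e by rewrite /d; field; rewrite gt_eqF.
by move: e0; lra.
Unshelve. all: by end_near. Qed.

Let ones A : 'rV[R]_N := \row_i indicator A i.

(* Moving [A] down from [v] strictly decreases its total curvature, first by
   strict monotonicity at [v], then by monotonicity; by [gap_curvature_cauchy]
   the configurations reached represent all those with a large gap. *)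
Lemma gap_curvature_at v A : admissible T I (map_mx expR v) ->
  A != finset.set0 -> A != [set: 'I_N]%SET ->
  exists2 X : R, 0 < X & forall Y, X <= Y -> forall u, scale_gap A Y u ->
    \sum_i indicator A i * (K u i - K v i) <= - Y^-1.
Proof.
move=> adm /set0Pn[a aA]; rewrite -finset.subTset => /fintype.subsetPn[b _ bA].
have [c c0 cP] := ext_curvature_strong I_ge0 adm ltr01.
have c20 : 0 < c / 2 by lra.
have [G G0 GP] := gap_curvature_cauchy A c20.
pose shift (y : R) := v - y *: ones A.
have shiftE y i : shift y 0 i = v 0 i - y * indicator A i by rewrite !mxE.
have ind1 i : `|indicator A i| <= 1.
  by rewrite /indicator; case: (i \in A); rewrite ?normr1 ?normr0.
(* Vertices [a] in [A] and [b] outside separate by 1 under the unit shift, so the spread in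
   [ext_curvature_strong] is at least 1. *)
have H1 : \sum_i indicator A i * (K (shift 1) i - K v i) <= - c.
  have E : \sum_i (shift 1 0 i - v 0 i) * (K (shift 1) i - K v i) =
      - \sum_i indicator A i * (K (shift 1) i - K v i).
    rewrite -sumrN; apply: eq_bigr => i _.
    by rewrite shiftE mul1r addrC addKr mulNr.
  rewrite lerNr -E; apply: le_trans (cP (shift 1) _); last first.
    by move=> i; rewrite shiftE mul1r addrC addKr normrN.
  rewrite ler_peMr ?(ltW c0)// (bigD1 a)//= (bigD1 b)//= !shiftE !mul1r.
  rewrite /indicator aA (negbTE bA) subr0 subrr subr0.
  rewrite mulr1n; have -> : (v 0 a - 1 - v 0 a) ^+ 2 = 1 by ring.
  rewrite -addrA lerDl addr_ge0// ?sumr_ge0// => i _; first by rewrite sqr_ge0.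
  by rewrite sumr_ge0// => j _; rewrite sqr_ge0.
(* A shift beyond 1, for monotonicity, and long enough to exceed all differences of coordinates of
   [v] by [G]. *)
pose Y := 1 + G + \sum_i \sum_j `|v 0 i - v 0 j|.
have S0 : 0 <= \sum_i \sum_j `|v 0 i - v 0 j| by do 2! apply: sumr_ge0 => ? _.
have Y1 : 1 < Y by rewrite /Y; lra.
have gY : scale_gap A G (shift Y).
  move=> i j iA jA; rewrite !shiftE /indicator iA (negbTE jA) mulr1 mulr0 subr0.
  have : `|v 0 i - v 0 j| <= \sum_i \sum_j `|v 0 i - v 0 j|.
    rewrite (bigD1 i)//= (bigD1 j)//= -addrA lerDl addr_ge0 ?sumr_ge0// => l _.
    by rewrite sumr_ge0.
  move: (ler_norm (v 0 i - v 0 j)); rewrite /Y; lra.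
clearbody Y.
have H2 : \sum_i indicator A i * (K (shift Y) i - K (shift 1) i) <= 0.
  have E : \sum_i (shift Y 0 i - shift 1 0 i) * (K (shift Y) i - K (shift 1) i) =
      (1 - Y) * \sum_i indicator A i * (K (shift Y) i - K (shift 1) i).
    by rewrite mulr_sumr; apply: eq_bigr => i _; rewrite mulrA !shiftE; congr (_ * _); ring.
  have := ext_curvature_monotone I_ge0 (shift Y) (shift 1).
  by rewrite E nmulr_rge0// subr_lt0.
have ci0 : 0 < (c / 2)^-1 by rewrite invr_gt0.
(* The gap [G] makes [u] comparable with [shift Y] up to [c / 2], and [(c / 2)^-1] brings [Z^-1]
   below the remaining drop [c - c / 2]. *)
exists (G + (c / 2)^-1); first by rewrite addr_gt0.
move=> Z XZ u gu.
have Z0 : 0 < Z by lra.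
have gG : scale_gap A G u by apply: scale_gap_le gu; lra.
have H3 := GP _ _ gG gY.
have split3 (p f g h l : 'I_N -> R) : \sum_i p i * (f i - l i) =
    \sum_i p i * (f i - g i) + \sum_i p i * (g i - h i) + \sum_i p i * (h i - l i).
  by rewrite -!big_split /=; apply: eq_bigr => i _; ring.
rewrite (split3 (indicator A) (K u) (K (shift Y)) (K (shift 1)) (K v)).
apply: le_trans (lerD (lerD H3 H2) H1) _.
have -> : c / 2 + 0 + - c = - (c / 2) by field.
rewrite lerN2 invf_ple ?posrE//; apply: le_trans XZ.
by rewrite lerDr ltW.
Qed.

(** One parameter measures both the gap and the defect [X^-1]. Enlarging it weakens the claim in
    both respects, so the finitely many sets [A] can share it. *)
Lemma gap_curvature v : admissible T I (map_mx expR v) ->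
  exists2 X : R, 0 < X & forall A, A != finset.set0 -> A != [set: 'I_N]%SET ->
    forall u, scale_gap A X u ->
      \sum_i indicator A i * (K u i - K v i) <= - X^-1.
Proof.
move=> adm.
have H : \forall X \near +oo%R, forall A, A != finset.set0 -> A != [set: 'I_N]%SET ->
    forall u, scale_gap A X u -> \sum_i indicator A i * (K u i - K v i) <= - X^-1.
  apply: filter_forall => A.
  have [->|A0] := eqVneq A finset.set0; first by apply: nearW.
  have [->|AT] := eqVneq A [set: 'I_N]%SET; first by apply: nearW.
  have [X X0 XP] := gap_curvature_at adm A0 AT.
  by apply: filterS (nbhs_pinfty_ge (num_real X)) => Y XY _ _; exact: XP.
near +oo_R => X; exists X; last by near: X.
by near: X; exact: nbhs_pinfty_gt.
Unshelve. all: by end_near. Qed.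

Lemma ext_log_curvature_cvg (S : Type) (F : set_system S) (FF : ProperFilter F)
    (u : S -> 'rV[R]_N) (u0 : 'rV[R]_N) :
  (forall j, u s 0 j @[s --> F] --> u0 0 j) ->
  forall i, K (u s) i @[s --> F] --> K u0 i.
Proof.
move=> uu i; rewrite /K ext_log_curvatureE//.
under eq_fun do rewrite ext_log_curvatureE//.
apply: cvgB; first exact: cvg_cst.
apply: cvg_sum => -[j k] /= /andP[_ F'].
have [P0 Q0 S0] := face_I_ge0 I_ge0 F'.
exact: (cvg_face_angle (FF := FF)).
Qed.

Lemma admissible_near (S : Type) (F : set_system S) (FF : ProperFilter F)
    (u : S -> 'rV[R]_N) (u0 : 'rV[R]_N) :
  (forall j, u s 0 j @[s --> F] --> u0 0 j) -> admissible T I (map_mx expR u0) ->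
  \forall s \near F, admissible T I (map_mx expR (u s)).
Proof.
move=> uu /admissibleE adm.
have ec j : expR (u s 0 j) @[s --> F] --> expR (u0 0 j).
  by apply: continuous_cvg => //; exact: continuous_expR.
have H : \forall s \near F, forall t : 'I_N * 'I_N * 'I_N,
    is_face T t.1.1 t.1.2 t.2 -> log_triangle I (u s) t.1.1 t.1.2 t.2.
  apply: filter_forall => -[[i j] k] /=.
  have [F'|nF] := boolP (is_face T i j k); last by apply: nearW.
  have := near_radii_triangle (FF := FF) (ec i) (ec j) (ec k) (adm _ _ _ F').
  exact: filterS.
apply: filterS H => s Hs; apply/admissibleE => i j k; exact: (Hs (i, j, k)).
Qed.

Lemma ext_log_curvature_shift u (c : R) i : K (u + const_mx c) i = K u i.
Proof.
rewrite /K !ext_log_curvatureE//; congr (_ - _); apply: eq_bigr => p _.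
by rewrite /log_angle !mxE face_angle_shift.
Qed.

End CurvatureGap.

(** * Derivatives of the curvature and the Laplace operator *)

Section CurvatureDerivative.
Variables (R : realType) (N : nat) (T : triangulation N) (I : {set 'I_N} -> R).
Hypothesis I_ge0 : forall e, e \in edges T -> 0 <= I e.
Implicit Types (u v r : 'rV[R]_N) (e f : 'I_N -> R) (i j k : 'I_N).

Let K := ext_log_curvature T I.

Definition angle_diff u e i j k : R :=
  (edge_weight (expR (u 0 i)) (expR (u 0 j)) (expR (u 0 k))
      (I [set i; j]%SET) (I [set i; k]%SET) (I [set j; k]%SET) * (e j - e i) +
    edge_weight (expR (u 0 i)) (expR (u 0 k)) (expR (u 0 j))
      (I [set i; k]%SET) (I [set i; j]%SET) (I [set j; k]%SET) * (e k - e i)) /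
  Num.sqrt (radii_heron (expR (u 0 i)) (expR (u 0 j)) (expR (u 0 k))
      (I [set i; j]%SET) (I [set i; k]%SET) (I [set j; k]%SET)).

Definition curvature_diff u e i : R :=
  - \sum_(p : 'I_N * 'I_N | (p.1 < p.2)%N && is_face T i p.1 p.2)
      angle_diff u e i p.1 p.2.

Lemma dw_ext_log_curvature (D : set R) (u : R -> 'rV[R]_N) t e i :
  (forall j, derivative_within D (fun s => u s 0 j) t (e j)) ->
  admissible T I (map_mx expR (u t)) ->
  derivative_within D (fun s => K (u s) i) t (curvature_diff (u t) e i).
Proof.
move=> ue /admissibleE adm.
apply: (@dw_ext _ _ (fun s => 2 * pi - \sum_(p : 'I_N * 'I_N |
    (p.1 < p.2)%N && is_face T i p.1 p.2) log_angle I (u s) i p.1 p.2)).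
  by move=> s; rewrite /K ext_log_curvatureE.
have H : derivative_within D (fun s => \sum_(p : 'I_N * 'I_N |
    (p.1 < p.2)%N && is_face T i p.1 p.2) log_angle I (u s) i p.1 p.2) t
    (\sum_(p : 'I_N * 'I_N | (p.1 < p.2)%N && is_face T i p.1 p.2)
      angle_diff (u t) e i p.1 p.2).
  apply: dw_sum => -[j k] /= /andP[_ F]; have [P0 Q0 S0] := face_I_ge0 I_ge0 F.
  exact: dw_face_angle (ue i) (ue j) (ue k) P0 Q0 S0 (adm _ _ _ F).
by apply: dw_val (dwB (dw_cst D t (2 * pi)) H); rewrite sub0r.
Qed.

Lemma expR_ln r : positive_radii r -> map_mx expR (map_mx (@ln R) r) = r.
Proof. by move=> r0; apply/rowP => i; rewrite !mxE lnK// posrE r0. Qed.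

(** Restricted to a line through [u], [curvature_log] coincides with the extended curvature for
    small parameters, because admissibility is an open condition. *)
Lemma is_derive_curvature_log u v i : admissible T I (map_mx expR u) ->
  is_derive u v (curvature_log T I i) (curvature_diff u (fun j => v 0 j) i).
Proof.
move=> adm.
pose c (s : R) := s *: v + u.
have c0 : c 0 = u by rewrite /c scale0r add0r.
have dc j : derivative_within setT (fun s => c s 0 j) 0 (v 0 j).
  apply: (@dw_ext _ _ (fun s => s * v 0 j + u 0 j)); first by move=> s; rewrite !mxE.
  apply: dw_val (dwD (dwM (dw_id setT 0) (dw_cst setT 0 (v 0 j))) (dw_cst setT 0 (u 0 j))).
  by ring.
have near_adm : \forall s \near (0 : R), admissible T I (map_mx expR (c s)).
  have := @admissible_near _ _ _ _ R (nbhs (0 : R)) (nbhs_pfilter (0 : R)) c u.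
  apply=> // j.
  have := dw_cvg (dc j); rewrite c0 => H.
  apply: cvg_trans H; apply: cvg_app => A AT.
  have {}AT : nbhs (0 : R) (fun s => [set: R] s -> A s) := AT.
  by apply: filterS AT => s; apply.
have adm0 : admissible T I (map_mx expR (c 0)) by rewrite c0.
have dK := dw_ext_log_curvature (i := i) dc adm0.
have : derivative_within setT (fun s => curvature_log T I i (c s)) 0
    (curvature_diff (c 0) (fun j => v 0 j) i).
  apply: dw_near_eq dK; first by rewrite /K -curvature_log_admissible.
  by apply: filterS near_adm => s adms _; rewrite /K -curvature_log_admissible.
rewrite c0 => /(dw_is_derive filterT) [].
rewrite /derivable /derive /=.
have -> : (fun h : R => h^-1 *: (curvature_log T I i (c (h *: 1 + 0)) - curvature_log T I i (c 0))) =
   (fun h : R => h^-1 *: (curvature_log T I i (h *: v + u) - curvature_log T I i u)).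
  by apply/funext => h; rewrite c0 /c addr0 /GRing.scale /= mulr1.
by move=> h1 h2; split.
Qed.

Lemma dcurvatureE r i j : admissible T I r ->
  dcurvature T I r i j =
  curvature_diff (map_mx (@ln R) r) (fun l => (l == j)%:R) i.
Proof.
move=> adm; have r0 := adm.1.
have adm' : admissible T I (map_mx expR (map_mx (@ln R) r)) by rewrite expR_ln.
have [_ ] := is_derive_curvature_log (delta_mx 0 j) i adm'.
by rewrite /dcurvature => ->; congr curvature_diff; apply/funext => l; rewrite !mxE eqxx.
Qed.

Lemma curvature_diff_shift u e f (c : R) i : (forall j, e j = f j + c) ->
  curvature_diff u e i = curvature_diff u f i.
Proof.
move=> ef; rewrite /curvature_diff; congr (- _); apply: eq_bigr => p _; rewrite /angle_diff !ef.
by congr (_ / _); congr (_ * _ + _ * _); ring.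
Qed.

Lemma curvature_diffN u e i : curvature_diff u (fun j => - e j) i = - curvature_diff u e i.
Proof.
rewrite /curvature_diff; congr (- _); rewrite -sumrN; apply: eq_bigr => p _.
rewrite /angle_diff -mulNr; congr (_ / _); ring.
Qed.

Lemma curvature_diff_sum u f i :
  curvature_diff u f i = \sum_j curvature_diff u (fun l => (l == j)%:R) i * f j.
Proof.
rewrite /curvature_diff; under [RHS]eq_bigr do rewrite mulNr big_distrl /=.
rewrite sumrN exchange_big /=; congr (- _); apply: eq_bigr => p _.
rewrite /angle_diff; move: (edge_weight _ _ _ _ _ _) => w2.
move: (edge_weight _ _ _ _ _ _) (Num.sqrt _) => w1 h.
have E l : f l = \sum_j (l == j)%:R * f j.
  rewrite (bigD1 l)//= eqxx mul1r big1 ?addr0// => j /negbTE.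
  by rewrite eq_sym => ->; rewrite mul0r.
rewrite [in LHS](E i) [in LHS](E p.1) [in LHS](E p.2) -!sumrB !mulr_sumr.
rewrite -big_split /= mulr_suml; apply: eq_bigr => j _; ring.
Qed.

Lemma dcurvature_nonadjacent r i j : admissible T I r -> j != i ->
  ~~ adj_vertices T j i -> dcurvature T I r i j = 0.
Proof.
move=> adm ji nadj; rewrite dcurvatureE// /curvature_diff big1 ?oppr0// => -[a b] /= /andP[_ F].
have notj c : [set i; c]%SET \in edges T -> (c == j) = false.
  by move=> icE; apply: contraNF nadj => /eqP <-; rewrite /adj_vertices edgeC.
have iF : (i == j) = false by rewrite eq_sym; apply/negbTE.
have Fa := is_face_edge F.
have Fb : [set i; b]%SET \in edges T.
  by apply: (@is_face_edge _ T _ _ a); rewrite -is_face_swap.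
by rewrite /angle_diff (notj a)// (notj b)// iF subrr !mulr0 addr0 mul0r.
Qed.

Lemma alpha_laplaceE (alpha : R) r f i : admissible T I r ->
  alpha_laplace T I alpha r f i =
  (r 0 i `^ alpha)^-1 * - curvature_diff (map_mx (@ln R) r) f i.
Proof.
move=> adm; congr (_ * _); rewrite curvature_diff_sum -sumrN.
by apply: eq_bigr => j _; rewrite dcurvatureE// mulNr.
Qed.

(** Scale invariance permits replacing [f] by [f - f i], which removes the diagonal term; a vertex
    not joined to [i] lies on no face at [i]. *)
Lemma alpha_laplace_adjacent (alpha : R) r f i : admissible T I r ->
  alpha_laplace T I alpha r f i = (r 0 i `^ alpha)^-1 *
    \sum_(j | adj_vertices T j i) (- dcurvature T I r i j) * (f j - f i).
Proof.
move=> adm; rewrite alpha_laplaceE//; congr (_ * _).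
rewrite (@curvature_diff_shift _ f (fun j => f j - f i) (f i)); last first.
  by move=> j; rewrite subrK.
rewrite curvature_diff_sum -sumrN [RHS]big_mkcond; apply: eq_bigr => j _.
rewrite -dcurvatureE//; case: ifPn => [_|nadj]; first by rewrite mulNr.
have [->|ji] := eqVneq j i; first by rewrite subrr mulr0 oppr0.
by rewrite dcurvature_nonadjacent// mul0r oppr0.
Qed.

Lemma derivable_curvature_log r i j : admissible T I r ->
  derivable (curvature_log T I i) (map_mx (@ln R) r) (delta_mx 0 j).
Proof.
move=> adm; have r0 := adm.1.
have adm' : admissible T I (map_mx expR (map_mx (@ln R) r)) by rewrite expR_ln.
by have [] := is_derive_curvature_log (delta_mx 0 j) i adm'.
Qed.

Lemma alpha_curvature_logE (alpha : R) r i : admissible T I r ->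
  alpha_curvature T I alpha r i =
  K (map_mx (@ln R) r) i * expR (- (alpha * ln (r 0 i))).
Proof.
move=> adm; have r0 := adm.1.
have adm' : admissible T I (map_mx expR (map_mx (@ln R) r)) by rewrite expR_ln.
rewrite /alpha_curvature /K -(curvature_log_admissible I_ge0)// expR_ln//.
by rewrite expRN /powR gt_eqF.
Qed.

Lemma dw_alpha_curvature (alpha : R) (tau : \bar R) (r : R -> 'rV[R]_N) :
  flow_solution T I alpha tau r -> forall t i, time_interval tau t ->
  derivative_within (time_interval tau)
    (fun s => alpha_curvature T I alpha (r s) i) t
    (alpha_laplace T I alpha (r t) (alpha_curvature T I alpha (r t)) i
     + alpha * alpha_curvature T I alpha (r t) i
       * (alpha_curvature T I alpha (r t) i - average_curvature T alpha (r t))).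
Proof.
move=> sol t i Dt; have [adm dr] := sol t Dt.
have r0 := adm.1.
pose Rc := alpha_curvature T I alpha (r t); pose Av := average_curvature T alpha (r t).
pose u s := map_mx (@ln R) (r s).
have du j : derivative_within (time_interval tau) (fun s => u s 0 j) t (Av - Rc j).
  apply: (@dw_ext _ _ (fun s => ln (r s 0 j))); first by move=> s; rewrite mxE.
  apply: dw_val (dw_comp (dr j) (is_derive1_ln (r0 j))).
  by rewrite mxE mulrC -mulrA divff ?mulr1// gt_eqF.
have adm' : admissible T I (map_mx expR (u t)) by rewrite expR_ln.
have dK := dw_ext_log_curvature (i := i) du adm'.
have dE := dw_comp (dwZ (c := - alpha) (du i)) (is_derive_expR _).
have := dwM dK dE.
have eqf s : time_interval tau s -> K (u s) i * expR (- alpha * u s 0 i) =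
    alpha_curvature T I alpha (r s) i.
  by move=> Ds; rewrite alpha_curvature_logE ?mxE ?mulNr//; case: (sol s Ds).
move=> H; have := dw_eq Dt eqf H; apply: dw_val.
rewrite alpha_laplaceE// -/Rc -/Av -/(u t).
(* In the velocity [Av - Rc j] the common term [Av] is an infinitesimal scaling, which leaves the
   curvature unchanged. *)
rewrite (@curvature_diff_shift _ _ (fun j => - Rc j) Av); last by move=> j; rewrite addrC.
rewrite curvature_diffN.
have -> : (r t 0 i `^ alpha)^-1 = expR (- alpha * u t 0 i).
  by rewrite /powR gt_eqF ?r0// -expRN mxE mulNr.
have RcE : Rc i = K (u t) i * expR (- alpha * u t 0 i).
  by rewrite /Rc -eqf.
rewrite [in RHS]mulrC; congr (_ + _).
by rewrite mulrA -RcE; ring.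
Qed.

End CurvatureDerivative.

(** * The flow in logarithmic coordinates *)

Section LogFlow.
Variables (R : realType) (N : nat) (T : triangulation N) (I : {set 'I_N} -> R).
Hypothesis I_ge0 : forall e, e \in edges T -> 0 <= I e.
Variable alpha : R.
Implicit Types (u v : 'rV[R]_N) (i j : 'I_N) (A B : {set 'I_N}) (D : set R).

Let K := ext_log_curvature T I.

Definition total_curvature : R := 2 * pi * (euler_char T)%:~R.

Definition log_weight u i : R := expR (alpha * u 0 i).

Definition weight_sum u : R := \sum_i log_weight u i.

Definition log_field u i : R :=
  total_curvature / weight_sum u - K u i * expR (- (alpha * u 0 i)).

Let X := total_curvature.

Lemma log_weight_gt0 u i : 0 < log_weight u i.
Proof. exact: expR_gt0. Qed.

Lemma vertex_exists : exists i : 'I_N, true.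
Proof. by exists (Ordinal (vertex_nonempty T)). Qed.

Lemma weight_sum_gt0 u : 0 < weight_sum u.
Proof.
have [i _] := vertex_exists; rewrite /weight_sum (bigD1 i)//= ltr_pwDl ?log_weight_gt0//.
by apply: sumr_ge0 => j _; rewrite ltW ?log_weight_gt0.
Qed.

Lemma weight_field u i :
  log_weight u i * log_field u i = X * log_weight u i / weight_sum u - K u i.
Proof.
rewrite /log_field mulrBr; congr (_ - _); first by rewrite mulrA [_ * X]mulrC.
by rewrite mulrCA -expRD addrN expR0 mulr1.
Qed.

(** Gauss-Bonnet in the form that makes [weight_sum] a conserved quantity. *)
Lemma sum_weight_field u : \sum_i log_weight u i * log_field u i = 0.
Proof.
under eq_bigr do rewrite weight_field.
rewrite sumrB gauss_bonnet// -mulr_suml -mulr_sumr -/(weight_sum u).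
by rewrite mulfK ?subrr// gt_eqF// weight_sum_gt0.
Qed.

(** For [alpha = 0] all weights are 1 and sum to [N], so one formula covers both cases of the
    average. *)
Lemma average_curvatureE u :
  average_curvature T alpha (map_mx expR u) = X / weight_sum u.
Proof.
rewrite /average_curvature /weight_sum /log_weight; case: eqP => [->|_].
  under eq_bigr do rewrite mul0r expR0.
  by rewrite sumr_const card_ord.
congr (_ / _); apply: eq_bigr => i _.
by rewrite mxE /powR gt_eqF ?expR_gt0// expRK.
Qed.

Lemma ext_flow_fieldE u i : ext_flow_field T I alpha (map_mx expR u) 0 i =
  log_field u i * expR (u 0 i).
Proof.
rewrite mxE /ext_alpha_curvature average_curvatureE /log_field mxE.
by rewrite expRN /powR gt_eqF ?expR_gt0// expRK.
Qed.

Definition scaled_log_solution (phi : 'rV[R]_N -> R) D (u : R -> 'rV[R]_N) : Prop :=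
  forall t, D t -> forall i,
    derivative_within D (fun s => u s 0 i) t (phi (u t) * log_field (u t) i).

Definition initial_interval D : Prop := forall t, D t -> 0 <= t /\ `[0, t] `<=` D.

Lemma dw_log_weight D (u : R -> 'rV[R]_N) t i (l : R) :
  derivative_within D (fun s => u s 0 i) t l ->
  derivative_within D (fun s => log_weight (u s) i) t (alpha * (log_weight (u t) i * l)).
Proof.
move=> ul; apply: dw_val (dw_comp (dwZ (c := alpha) ul) (is_derive_expR _)).
by rewrite mulrCA.
Qed.

Lemma dw_const D f t : initial_interval D ->
  (forall t, D t -> derivative_within D f t 0) -> D t -> f t = f 0 :> R.
Proof.
move=> Ditv fD Dt; have [t0 tD] := Ditv t Dt.
have [c _] := dw_MVT (df := fun=> 0) t0 tD fD.
by rewrite mul0r => /eqP; rewrite subr_eq0 => /eqP.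
Qed.

Lemma dw_nonincr D f df t : initial_interval D ->
  (forall t, D t -> derivative_within D f t (df t)) ->
  (forall t, D t -> df t <= 0) -> D t -> f t <= f 0 :> R.
Proof.
move=> Ditv fD f0 Dt; have [t0 tD] := Ditv t Dt.
have [c cin fE] := dw_MVT t0 tD fD.
by rewrite -subr_le0 fE subr0 mulr_le0_ge0//; apply: f0; exact: tD cin.
Qed.

Lemma dw_weight_sum phi D (u : R -> 'rV[R]_N) t : scaled_log_solution phi D u -> D t ->
  derivative_within D (fun s => weight_sum (u s)) t 0.
Proof.
move=> sol Dt.
have := dw_sum (r := index_enum 'I_N) (P := predT)
  (fun i _ => dw_log_weight (sol t Dt i)).
apply: dw_val; rewrite (eq_bigr (fun i => alpha * phi (u t) *
    (log_weight (u t) i * log_field (u t) i))).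
  by rewrite -mulr_sumr sum_weight_field mulr0.
move=> i _; move: (log_weight _ _) (log_field _ _) (phi _) => a b c.
by ring.
Qed.

Lemma weight_sum_const phi D (u : R -> 'rV[R]_N) t : initial_interval D ->
  scaled_log_solution phi D u ->
  D t -> weight_sum (u t) = weight_sum (u 0).
Proof.
move=> Ditv sol Dt; apply: (dw_const (f := fun s => weight_sum (u s)) Ditv) => // s Ds.
exact: dw_weight_sum sol Ds.
Qed.

Section Barrier.
Variable v : 'rV[R]_N.
Hypothesis v_adm : admissible T I (map_mx expR v).
Hypothesis v_const : forall i, K v i = X * log_weight v i / weight_sum v.
Hypothesis alphaX : alpha * X <= 0.

Lemma sum_indicator_K A : \sum_i indicator R A i * K v i =
  X * (\sum_(i in A) log_weight v i / weight_sum v).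
Proof.
rewrite mulr_sumr [RHS]big_mkcond; apply: eq_bigr => i _.
by rewrite /indicator v_const; case: ifP => _; rewrite ?mul0r// mul1r mulrA.
Qed.

Lemma weight_share_bounds A : 0 <= \sum_(i in A) log_weight v i / weight_sum v <= 1.
Proof.
have pos i : 0 <= log_weight v i / weight_sum v.
  by rewrite divr_ge0// ltW ?log_weight_gt0 ?weight_sum_gt0.
rewrite sumr_ge0//=.
have <- : \sum_i log_weight v i / weight_sum v = 1.
  by rewrite -mulr_suml divff// gt_eqF// weight_sum_gt0.
rewrite [leRHS](bigID (fun i => i \in A)) /= lerDl sumr_ge0//.
Qed.

(* The vertices of small weight [exp (alpha u)] are those with small [u] when
   [0 < alpha] and those with large [u] when [alpha < 0]. *)
Lemma small_weight_curvature : alpha != 0 ->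
  exists L d : R, [/\ 0 < L, 0 < d & forall B, B != finset.set0 -> B != [set: 'I_N]%SET ->
    forall u, (forall i j, i \in B -> j \notin B -> L * log_weight u i <= log_weight u j) ->
    alpha * (\sum_i indicator R B i * K u i) <= - d].
Proof.
move=> a0; have [G G0 GP] := gap_curvature I_ge0 v_adm.
(* A ratio [expR (|alpha| * G)] between weights is a gap [G] between the coordinates of [u]. *)
exists (expR (`|alpha| * G)), (`|alpha| / G); split; first exact: expR_gt0.
  by rewrite divr_gt0// normr_gt0.
move=> B B0 BT u uB.
have splitK A w : \sum_i indicator R A i * (K u i - K w i) =
    \sum_i indicator R A i * K u i - \sum_i indicator R A i * K w i.
  by rewrite -sumrB; apply: eq_bigr => i _; rewrite mulrBr.
have uB' i j : i \in B -> j \notin B -> `|alpha| * G + alpha * u 0 i <= alpha * u 0 j.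
  by move=> iB jB; rewrite -ler_expR expRD; exact: uB.
have [ap|an] := ltP 0 alpha.
  have X0 : X <= 0 by rewrite -(pmulr_rle0 _ ap).
  have gap : scale_gap B G u.
    by move=> i j iB jB; have := uB' i j iB jB; rewrite gtr0_norm// -mulrDr ler_pM2l// addrC.
  have := GP B B0 BT u gap; rewrite splitK sum_indicator_K.
  have /andP[p0 _] := weight_share_bounds B.
  have := mulr_le0_ge0 X0 p0; move: (X * _) (\sum_i _) => a b a0' ab.
  rewrite gtr0_norm// -mulrN ler_pM2l//; move: ab; move: (- G^-1) => c; lra.
have {an}an : alpha < 0 by rewrite lt_neqAle a0.
have X0 : 0 <= X by rewrite -(nmulr_rle0 _ an).
(* Now [B] consists of the large radii: the gap estimate applies to its complement, and Gauss-Bonnet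
   carries it back to [B]. *)
have gap : scale_gap (~: B)%SET G u.
  move=> i j; rewrite !inE negbK => iB jB; have := uB' j i jB iB.
  by rewrite ltr0_norm// mulNr -mulrN -mulrDr ler_nM2l//; lra.
have CB0 : (~: B)%SET != finset.set0 by rewrite -finset.setCT (inj_eq (inv_inj (@finset.setCK _))).
have CBT : (~: B)%SET != [set: 'I_N]%SET.
  by rewrite -finset.setC0 (inj_eq (inv_inj (@finset.setCK _))).
have := GP _ CB0 CBT u gap; rewrite splitK sum_indicator_K.
have /andP[_ p1] := weight_share_bounds (~: B)%SET.
have := ler_wpM2l X0 p1; rewrite mulr1.
have : \sum_i indicator R B i * K u i + \sum_i indicator R (~: B)%SET i * K u i = X.
  transitivity (\sum_i K u i); last exact: gauss_bonnet.
  rewrite -big_split /=; apply: eq_bigr => i _.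
  by rewrite -mulrDl /indicator inE; case: (i \in B); rewrite ?addr0 ?add0r mul1r.
rewrite ltr0_norm// mulNr opprK ler_nM2l//.
move: X (G^-1) (\sum_i indicator R (~: B)%SET i * _) (\sum_i indicator R B i * _) (X * _) => a b c d e.
by move=> *; lra.
Qed.

End Barrier.

End LogFlow.

(** * A priori bounds for the flow *)

Section LogFlowBound.
Variables (R : realType) (N : nat) (T : triangulation N) (I : {set 'I_N} -> R).
Hypothesis I_ge0 : forall e, e \in edges T -> 0 <= I e.
Variable alpha : R.
Implicit Types (i j : 'I_N) (A B : {set 'I_N}) (D : set R).

Let K := ext_log_curvature T I.
Let X : R := total_curvature R T.

Variable v : 'rV[R]_N.
Hypothesis v_adm : admissible T I (map_mx expR v).
Hypothesis v_const : forall i, K v i = X * log_weight alpha v i / weight_sum alpha v.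
Hypothesis alphaX : alpha * X <= 0.

Lemma norm_le_sqr (x : R) : `|x| <= 1 + x ^+ 2.
Proof.
rewrite -(real_normK (num_real x)).
have := sqr_ge0 (`|x| - 1 / 2); lra.
Qed.

Lemma card_vertices_gt1 : (1 < N)%N.
Proof.
have [i _] := vertex_exists T; have [e eE _] := vertex_in_edge T i.
by rewrite -(edge_card eE) -[N in (_ <= N)%N]card_ord; exact: max_card.
Qed.

Let log_field_alpha0 u i : alpha = 0 -> log_field T I alpha u i = K v i - K u i.
Proof.
move=> a0; rewrite v_const /log_field /log_weight a0 !mul0r oppr0 expR0 !mulr1.
suff -> : weight_sum 0 u = weight_sum 0 v by [].
by apply: eq_bigr => j _; rewrite /log_weight !mul0r.
Qed.

(** Weights carry no information here, being all 1. But the field is [K v - K u], so by monotonicity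
    the squared distance to [v] cannot grow. *)
Let bound_alpha0 : alpha = 0 -> forall u0 : 'rV[R]_N, exists2 M : R, 0 < M &
  forall phi D (u : R -> 'rV[R]_N), (forall w, 0 <= phi w) -> initial_interval D ->
    scaled_log_solution T I alpha phi D u -> u 0 = u0 ->
    forall t i, D t -> `|u t 0 i| <= M.
Proof.
move=> a0 u0; pose L (w : 'rV[R]_N) := \sum_i (w 0 i - v 0 i) ^+ 2.
have L0 : 0 <= L u0 by apply: sumr_ge0 => i _; exact: sqr_ge0.
have V0 : 0 <= \sum_i `|v 0 i| by apply: sumr_ge0.
exists (1 + L u0 + \sum_i `|v 0 i|); first by rewrite ltr_pwDl// ltr_pwDl.
move=> phi D u phi0 Ditv sol uu t i Dt.
have dL s : D s -> derivative_within D (fun s => L (u s)) s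
    (\sum_j 2 * phi (u s) * - ((u s 0 j - v 0 j) * (K (u s) j - K v j))).
  move=> Ds; rewrite /L; apply: dw_sum => j _.
  have dB := dwB (sol s Ds j) (dw_cst D s (v 0 j)).
  apply: dw_val (dwM dB dB).
  rewrite log_field_alpha0// subr0.
  by move: (K _ _) (K _ _) (phi _) => a b c; ring.
have : L (u t) <= L (u 0).
  apply: (dw_nonincr (f := fun s => L (u s)) Ditv dL) => // s Ds.
  rewrite -mulr_sumr sumrN mulr_ge0_le0 ?mulr_ge0// oppr_le0.
  exact: ext_curvature_monotone.
rewrite uu => Lt.
have Li : (u t 0 i - v 0 i) ^+ 2 <= L u0.
  apply: le_trans Lt; rewrite /L (bigD1 i)//= lerDl.
  by apply: sumr_ge0 => j _; exact: sqr_ge0.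
have vi : `|v 0 i| <= \sum_i `|v 0 i|.
  by rewrite (bigD1 i)//= lerDl sumr_ge0.
have := ler_normD (u t 0 i - v 0 i) (v 0 i); rewrite subrK => /le_trans; apply.
by rewrite lerD// (le_trans (norm_le_sqr _))// lerD2l.
Qed.

(* Let [F B u] be the weight of [B] minus [eps (1 + L)^#|B|].  If [F C] vanishes
   while all other [F B] are nonnegative, comparison with [C] plus one vertex
   shows that the weights outside [C] are [L] times those in [C], so that the
   weight of [C] is increasing. *)
Let bound_alpha : alpha != 0 -> forall u0 : 'rV[R]_N, exists2 M : R, 0 < M &
  forall phi D (u : R -> 'rV[R]_N), (forall w, 0 <= phi w) ->
    (forall w : 'rV[R]_N, (forall i, `|w 0 i| <= M) -> 0 < phi w) -> initial_interval D ->
    scaled_log_solution T I alpha phi D u -> u 0 = u0 ->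
    forall t i, D t -> `|u t 0 i| <= M.
Proof.
move=> a0 u0; have [L [d [L0 d0 Ld]]] := small_weight_curvature I_ge0 v_adm v_const alphaX a0.
pose w (u : 'rV[R]_N) i := log_weight alpha u i; pose W0 := weight_sum alpha u0.
have W00 : 0 < W0 by exact: (weight_sum_gt0 T).
have Q0 : 0 < (1 + L) ^+ N by rewrite exprn_gt0// ltr_wpDr// ltW.
(* The second condition makes every [F B] positive at the start; the third makes the average term of
   the field too small to offset the gain [d] from the curvature. *)
have [eps [eps0 eps1 eps2]] : exists eps : R, [/\ 0 < eps,
    forall i, eps * (1 + L) ^+ N < w u0 i &
    `|alpha * X| * (eps * (1 + L) ^+ N) < d * W0].
  near (0 : R)^'+ => eps; exists eps; split.
  - by near: eps; exact: nbhs_right_gt.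
  - near: eps; apply: filter_forall => i.
    have : 0 < w u0 i / (1 + L) ^+ N by rewrite divr_gt0// log_weight_gt0.
    by move=> /nbhs_right_lt; apply: filterS => x; rewrite ltr_pdivlMr.
  - near: eps.
    have dW : 0 < d * W0 / (1 + `|alpha * X|) / (1 + L) ^+ N.
      by rewrite !divr_gt0// ?mulr_gt0// ltr_pwDl.
    apply: filterS2 (nbhs_right_lt dW) (nbhs_right_gt 0) => x; rewrite ltr_pdivlMr//.
    have aX : 0 < 1 + `|alpha * X| by rewrite ltr_pwDl.
    rewrite ltr_pdivlMr// => xd x0; apply: le_lt_trans xd.
    by rewrite mulrDr mulr1 mulrC lerDr mulr_ge0// ltW.
pose F B (u : 'rV[R]_N) := \sum_i indicator R B i * w u i - eps * (1 + L) ^+ #|B|.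
pose P B := (B != finset.set0) && (B != [set: 'I_N]%SET).
pose M := (1 + `|ln eps| + `|ln W0|) / `|alpha|.
have na0 : 0 < `|alpha| by rewrite normr_gt0.
have boxed u : weight_sum alpha u = W0 -> (forall B, P B -> 0 <= F B u) ->
    forall i, `|u 0 i| <= M.
  move=> uW FB i.
  have P1 : P [set i]%SET.
    rewrite /P -card_gt0 cards1 /=; apply: contraTneq card_vertices_gt1 => E.
    by rewrite -leqNgt -(cards1 i) E cardsT card_ord.
  have := FB _ P1; rewrite /F cards1 expr1 (bigD1 i)//= big1 ?addr0; last first.
    by move=> j ji; rewrite /indicator inE (negbTE ji) mul0r.
  rewrite /indicator inE eqxx mul1r subr_ge0 => wi.
  have h1 : eps <= w u i.
    by apply: le_trans wi; rewrite mulrDr mulr1 lerDl mulr_ge0// ltW.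
  have h2 : w u i <= W0.
    rewrite -uW /weight_sum (bigD1 i)//= lerDl sumr_ge0// => j _.
    by rewrite ltW// log_weight_gt0.
  have {}h1 : ln eps <= alpha * u 0 i.
    by rewrite -[leRHS]expRK ler_ln ?posrE// expR_gt0.
  have {}h2 : alpha * u 0 i <= ln W0.
    by rewrite -[leLHS]expRK ler_ln ?posrE// expR_gt0.
  rewrite /M ler_pdivlMr// mulrC -normrM ler_norml; apply/andP; split.
    have := ler_norm (- ln eps); rewrite normrN; have := normr_ge0 (ln W0); lra.
  have := ler_norm (ln W0); have := normr_ge0 (ln eps); lra.
exists M.
  by rewrite divr_gt0// -addrA ltr_pwDl// addr_ge0.
move=> phi D u phi0 phiM Ditv sol uu t i Dt.
have Wt s : D s -> weight_sum alpha (u s) = W0.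
  by move=> Ds; rewrite (weight_sum_const I_ge0 Ditv sol Ds) uu.
apply: (boxed _ (Wt t Dt)).
move=> B PB; apply/ltW.
apply: (@barrier R _ P D (fun B s => F B (u s)) (fun B s =>
  \sum_i indicator R B i * (alpha * (w (u s) i * (phi (u s) * log_field T I alpha (u s) i)))))
  => //.
- move=> C s PC Ds; rewrite /F.
  have H : derivative_within D (fun s => \sum_i indicator R C i * w (u s) i) s
    (\sum_i indicator R C i *
       (alpha * (w (u s) i * (phi (u s) * log_field T I alpha (u s) i)))).
    by apply: dw_sum => j _; apply: dwZ; apply: dw_log_weight; exact: sol.
  by apply: dw_val (dwB H (dw_cst D s _)); rewrite subr0.
- move=> C /andP[C0 CT]; rewrite uu /F subr_gt0.
  have [a aC] := set0Pn _ C0; rewrite (bigD1 a)//= /indicator aC mul1r.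
  apply: (@lt_le_trans _ _ (w u0 a)); last first.
    rewrite lerDl sumr_ge0// => j _; rewrite mulr_ge0 ?ler0n//.
    by rewrite ltW// log_weight_gt0.
  apply: le_lt_trans (eps1 a); rewrite ler_pM2l// ler_weXn2l ?lerDl ?ltW//.
  by rewrite -[N in (_ <= N)%N]card_ord; exact: max_card.
- move=> s C PC Ds Fpos FC; have /andP[C0 CT] := PC.
  have phis : 0 < phi (u s) by apply: phiM; apply: boxed => //; exact: Wt.
  rewrite (eq_bigr (fun i => phi (u s) * (alpha * (indicator R C i *
    (X * w (u s) i / W0 - K (u s) i))))); last first.
    move=> j _; rewrite /w -(Wt s Ds) -weight_field.
    by move: (indicator R C j) (log_weight _ _ _) (log_field _ _ _ _ _) (phi _) => a b c e; ring.
  rewrite -!mulr_sumr pmulr_rgt0//.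
  have CE : \sum_i indicator R C i * w (u s) i = eps * (1 + L) ^+ #|C|.
    by move/eqP : FC; rewrite /F subr_eq0 => /eqP.
  have split_sum : \sum_i indicator R C i * (X * w (u s) i / W0 - K (u s) i) =
      X * (eps * (1 + L) ^+ #|C|) / W0 - \sum_i indicator R C i * K (u s) i.
    rewrite -CE mulr_sumr mulr_suml -sumrB; apply: eq_bigr => j _.
    by move: (indicator R C j) (w _ _) (K _ _) => a b c; field; rewrite gt_eqF.
  have small j : j \in C -> w (u s) j <= eps * (1 + L) ^+ #|C|.
    move=> jC; rewrite -CE (bigD1 j)//= /indicator jC mul1r lerDl sumr_ge0// => k _.
    by rewrite mulr_ge0 ?ler0n// ltW// log_weight_gt0.
  have large j : j \notin C -> eps * (1 + L) ^+ #|C| * L <= w (u s) j.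
    move=> jC.
    have E : \sum_i indicator R (j |: C)%SET i * w (u s) i =
       \sum_i indicator R C i * w (u s) i + w (u s) j.
      rewrite (bigD1 j)//= [in RHS](bigD1 j)//= /indicator !inE eqxx (negbTE jC) mul1r mul0r.
      rewrite add0r addrC; congr (_ + _); apply: eq_bigr => k /negbTE kj.
      by rewrite !inE kj.
    have H : eps * (1 + L) ^+ #|C|.+1 <= \sum_i indicator R (j |: C)%SET i * w (u s) i.
      (* The full vertex set is not in [P]; its weight is the conserved [W0], which exceeds
         [eps (1 + L)^N] by the choice of [eps]. *)
      have [jCT|jCT] := eqVneq (j |: C)%SET [set: 'I_N]%SET.
        have NC : #|C|.+1 = N by rewrite -[RHS]card_ord -cardsT -jCT cardsU1 jC.
        rewrite NC jCT; apply: ltW; apply: lt_le_trans (eps1 j) _.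
        rewrite (_ : \sum_i _ = W0); last first.
          by rewrite -(Wt s Ds); apply: eq_bigr => k _; rewrite /indicator inE mul1r.
        rewrite /W0 /weight_sum (bigD1 j)//= lerDl sumr_ge0// => k _.
        by rewrite ltW// log_weight_gt0.
      have PjC : P (j |: C)%SET.
        by rewrite /P jCT andbT; apply/set0Pn; exists j; rewrite !inE eqxx.
      by have := Fpos _ PjC; rewrite /F cardsU1 jC add1n subr_ge0.
    move: H; rewrite E CE exprS; move: ((1 + L) ^+ _) => q; lra.
  have := Ld C C0 CT (u s) _.
  have gap a b : a \in C -> b \notin C -> L * w (u s) a <= w (u s) b.
    move=> aC bC; apply: le_trans (large b bC); rewrite mulrC ler_pM2r//.
    exact: small.
  move=> /(_ gap) KC; rewrite split_sum mulrBr.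
  have hX : - d < alpha * (X * (eps * (1 + L) ^+ #|C|) / W0).
    have aXe : `|alpha * (X * (eps * (1 + L) ^+ #|C|) / W0)| < d.
      have q0 : 0 < (1 + L) ^+ #|C| by rewrite exprn_gt0// ltr_wpDr// ltW.
      have qN : (1 + L) ^+ #|C| <= (1 + L) ^+ N.
        rewrite ler_weXn2l ?lerDl ?ltW//.
        by rewrite -[N in (_ <= N)%N]card_ord; exact: max_card.
      move: q0 qN; move: (_ ^+ #|C|) => q q0 qN.
      have -> : alpha * (X * (eps * q) / W0) = (alpha * X) * (eps * q) / W0.
        by rewrite !mulrA.
      rewrite normrM normfV (gtr0_norm W00) ltr_pdivrMr// normrM.
      apply: le_lt_trans eps2; rewrite ler_wpM2l// gtr0_norm ?mulr_gt0//.
      by rewrite ler_pM2l.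
    by move: aXe; rewrite ltr_norml => /andP[].
  by move: KC hX; rewrite -/K; move: (alpha * _) (alpha * _) => p q; lra.
Unshelve. all: by end_near. Qed.

(* The factor [phi] allows for the truncated field to which Peano's theorem is
   applied. *)
Lemma scaled_bound (u0 : 'rV[R]_N) : exists2 M : R, 0 < M &
  forall phi D (u : R -> 'rV[R]_N), (forall w, 0 <= phi w) ->
    (forall w : 'rV[R]_N, (forall i, `|w 0 i| <= M) -> 0 < phi w) -> initial_interval D ->
    scaled_log_solution T I alpha phi D u -> u 0 = u0 ->
    forall t i, D t -> `|u t 0 i| <= M.
Proof.
have [a0|a0] := eqVneq alpha 0; last exact: bound_alpha.
have [M M0 MP] := bound_alpha0 a0 u0; exists M => // phi D u phi0 _; exact: MP.
Qed.

End LogFlowBound.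

Section LocalDerivatives.
Variable R : realType.
Implicit Types (D : set R) (f g : R -> R) (t l : R).

Lemma dw_near_sub D D' f t l : (\forall s \near t, D' s -> D s) ->
  derivative_within D f t l -> derivative_within D' f t l.
Proof.
move=> DD; rewrite /derivative_within => H; apply: cvg_trans H; apply: cvg_app => A DA.
have {}DA : (t^') (fun s => D s -> A s) := DA.
have {}DD : (t^') (fun s => D' s -> D s) by exact: (@cvg_within _ (nbhs t) _ [set y | y != t]).
by apply: filterS2 DA DD => s As Ds /Ds.
Qed.

Lemma dw_shift D f t l (c : R) : derivative_within D f (t - c) l ->
  derivative_within [set s | D (s - c)] (fun s => f (s - c)) t l.
Proof.
move=> /dwP[g [fE gl gt]]; apply/dwP; exists (fun s => g (s - c)); split=> //.
  by move=> s; rewrite fE; congr (_ * _); ring.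
have sc : (s - c) @[s --> within [set s | D (s - c)] (nbhs t)] --> within D (nbhs (t - c)).
  move=> A; rewrite /= /within /= => DA.
  have tc : (s - c) @[s --> t] --> t - c by apply: cvgB => //; exact: cvg_cst.
  exact: tc DA.
exact: cvg_comp sc gl.
Qed.

End LocalDerivatives.

(** * Global existence and continuation of solutions *)

Section LogFlowExistence.
Variables (R : realType) (N : nat) (T : triangulation N) (I : {set 'I_N} -> R).
Hypothesis I_ge0 : forall e, e \in edges T -> 0 <= I e.
Variable alpha : R.
Implicit Types (i j : 'I_N) (D : set R).

Let K := ext_log_curvature T I.
Let X : R := total_curvature R T.

Lemma ext_log_curvature_bound (u : 'rV[R]_N) i :
  `|K u i| <= 2 * pi + \sum_(p : 'I_N * 'I_N) pi.
Proof.
have pi0 := pi_ge0 R.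
rewrite /K ext_log_curvatureE// ler_norml; apply/andP; split; last first.
  rewrite lerBlDr -addrA lerDl addr_ge0 ?sumr_ge0// => p _.
  by have /andP[] := face_angle_bound (u 0 i) (u 0 p.1) (u 0 p.2)
    (I [set i; p.1]%SET) (I [set i; p.2]%SET) (I [set p.1; p.2]%SET).
rewrite lerBrDr -lerBrDl opprK.
have : \sum_(p : 'I_N * 'I_N | (p.1 < p.2)%N && is_face T i p.1 p.2) log_angle I u i p.1 p.2 <=
    \sum_(p : 'I_N * 'I_N) pi.
  rewrite big_mkcond; apply: ler_sum => p _; case: ifP => // _.
  by have /andP[] := face_angle_bound (u 0 i) (u 0 p.1) (u 0 p.2)
    (I [set i; p.1]%SET) (I [set i; p.2]%SET) (I [set p.1; p.2]%SET).
by move=> /le_trans; apply; lra.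
Qed.

Lemma log_field_bound (M : R) : exists B : R, 0 <= B /\
  forall u : 'rV[R]_N, (forall i, `|u 0 i| <= M) -> forall i, `|log_field T I alpha u i| <= B.
Proof.
pose KB : R := 2 * pi + \sum_(p : 'I_N * 'I_N) pi.
pose E := expR (`|alpha| * M).
have KB0 : 0 <= KB by rewrite addr_ge0 ?mulr_ge0 ?sumr_ge0 ?pi_ge0// => p _; exact: pi_ge0.
have E0 : 0 < E by exact: expR_gt0.
exists (`|X| * E + KB * E); split; first by rewrite addr_ge0// mulr_ge0// ltW.
move=> u uM i.
have aM j : `|alpha * u 0 j| <= `|alpha| * M by rewrite normrM ler_wpM2l.
have W1 : (weight_sum alpha u)^-1 <= E.
  rewrite -[leRHS]invrK lef_pV2 ?posrE ?(weight_sum_gt0 T) ?invr_gt0//.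
  rewrite /weight_sum (bigD1 i)//= -expRN; apply: (@le_trans _ _ (log_weight alpha u i)).
    by rewrite ler_expR; have := aM i; rewrite ler_norml => /andP[].
  by rewrite lerDl sumr_ge0// => j _; rewrite ltW ?log_weight_gt0.
rewrite /log_field (le_trans (ler_normB _ _))// lerD//.
  rewrite normrM ler_wpM2l// ger0_norm// invr_ge0 ltW//; exact: (weight_sum_gt0 T).
rewrite normrM ler_pM//; first exact: ext_log_curvature_bound.
rewrite gtr0_norm ?expR_gt0// ler_expR.
by have := aM i; rewrite ler_norml => /andP[]; lra.
Qed.

Lemma log_field_cvg (S : Type) (F : set_system S) (FF : ProperFilter F)
    (u : S -> 'rV[R]_N) (u0 : 'rV[R]_N) :
  (forall j, u s 0 j @[s --> F] --> u0 0 j) ->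
  forall i, log_field T I alpha (u s) i @[s --> F] --> log_field T I alpha u0 i.
Proof.
move=> uu i; rewrite /log_field.
have ec (c : R) j : expR (c * u s 0 j) @[s --> F] --> expR (c * u0 0 j).
  apply: continuous_cvg; first exact: continuous_expR.
  by apply: cvgM => //; exact: cvg_cst.
apply: cvgB.
  apply: cvgM; first exact: cvg_cst.
  apply: cvgV; first by rewrite gt_eqF//; exact: (weight_sum_gt0 T).
  by apply: cvg_sum => j _; exact: ec.
apply: cvgM; first exact: ext_log_curvature_cvg.
by rewrite -mulNr; under eq_fun do rewrite -mulNr; exact: ec.
Qed.

Variable v : 'rV[R]_N.
Hypothesis v_adm : admissible T I (map_mx expR v).
Hypothesis v_const : forall i, K v i = X * log_weight alpha v i / weight_sum alpha v.
Hypothesis alphaX : alpha * X <= 0.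

Definition log_solution D (u : R -> 'rV[R]_N) : Prop :=
  forall t, D t -> forall i,
    derivative_within D (fun s => u s 0 i) t (log_field T I alpha (u t) i).

Lemma log_solution_bound (u0 : 'rV[R]_N) : exists2 M : R, 0 < M &
  forall D (u : R -> 'rV[R]_N), initial_interval D -> log_solution D u -> u 0 = u0 ->
    forall t i, D t -> `|u t 0 i| <= M.
Proof.
have [M M0 MP] := scaled_bound I_ge0 v_adm v_const alphaX u0.
exists M => // D u Ditv sol; apply: (MP (fun=> 1)) => //.
by move=> t Dt i; rewrite mul1r; exact: sol.
Qed.

Definition half_line : set R := [set t | 0 <= t].

Lemma half_line_initial : initial_interval half_line.
Proof. by move=> t t0; split=> // s; rewrite /= in_itv /= => /andP[]. Qed.

Lemma log_solution_exists (u0 : 'rV[R]_N) :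
  exists u : R -> 'rV[R]_N, u 0 = u0 /\ log_solution half_line u.
Proof.
have [M M0 MP] := scaled_bound I_ge0 v_adm v_const alphaX u0.
pose M2 := 1 + N%:R * M.
(* [phi] is 1 on the box of size [M], whose points have coordinate sum at most [N * M] in absolute
   value, and 0 once that sum reaches [M2]. The truncated field is bounded, and [scaled_bound] keeps
   its solutions where [phi] is 1. *)
pose phi (u : 'rV[R]_N) : R := Num.max 0 (Num.min 1 (M2 - \sum_i `|u 0 i|)).
have phi0 u : 0 <= phi u by rewrite le_max lexx.
have phi1 u : phi u <= 1 by rewrite ge_max ler01 ge_min lexx.
have phiM (u : 'rV[R]_N) : (forall i, `|u 0 i| <= M) -> phi u = 1.
  move=> uM; rewrite /phi min_l ?max_r//.
  have : \sum_i `|u 0 i| <= \sum_(i < N) M by apply: ler_sum => i _.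
  by rewrite sumr_const card_ord -mulr_natl /M2; lra.
have phi_box (u : 'rV[R]_N) : phi u != 0 -> forall i, `|u 0 i| <= M2.
  move=> pu i; rewrite leNgt; apply: contra pu => ui; apply/eqP/max_idPl.
  rewrite ge_min subr_le0; apply/orP; right.
  apply: le_trans (ltW ui) _; rewrite (bigD1 i)//= lerDl sumr_ge0//.
have [B [B0 BP]] := log_field_bound M2.
pose Y (u : 'rV[R]_N) : 'rV[R]_N := \row_i (phi u * log_field T I alpha u i).
have Yc i : continuous (fun u => Y u 0 i).
  rewrite (_ : (fun u => Y u 0 i) = (fun u => phi u * log_field T I alpha u i)); last first.
    by apply/funext => u; rewrite mxE.
  move=> u; have uc j : (w : 'rV[R]_N) 0 j @[w --> u] --> u 0 j by exact: coord_continuous.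
  have H2 : log_field T I alpha w i @[w --> u] --> log_field T I alpha u i.
    exact: (log_field_cvg (nbhs_pfilter u)).

  have Hs : (\sum_j `|(w : 'rV[R]_N) 0 j|) @[w --> u] --> \sum_j `|u 0 j|.
    apply: (@cvg_sum _ _ (nbhs u) _ _ _ _ (fun j (w : 'rV[R]_N) => `|w 0 j|)) => j _.
    exact: cvg_norm (uc j).
  have Sc : (M2 - \sum_j `|(w : 'rV[R]_N) 0 j|) @[w --> u] --> M2 - \sum_j `|u 0 j|.
    exact: (cvgB (cvg_cst M2) Hs).
  have H1 : phi w @[w --> u] --> phi u.
    exact: cvg_comp Sc (@continuous_clamp R 0 1 (M2 - \sum_j `|u 0 j|)).
  exact: cvgM H1 H2.
have YB u i : `|Y u 0 i| <= B.
  rewrite mxE; have [->|pu] := eqVneq (phi u) 0; first by rewrite mul0r normr0.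
  rewrite normrM (le_trans _ (BP u (phi_box u pu) i))// ler_piMl// ger0_norm//.
have [u [uu sol]] := peano Yc YB u0.
exists u; split=> // t t0 i.
have sol' : scaled_log_solution T I alpha phi half_line u.
  by move=> s s0 j; have := sol s s0 j; rewrite mxE.
have box s j : half_line s -> `|u s 0 j| <= M.
  move=> s0; apply: (MP phi half_line u) => //; last exact: half_line_initial.
  by move=> w wM; rewrite phiM.
have := sol' t t0 i; rewrite phiM ?mul1r// => j; exact: box.
Qed.

(** The a priori bound makes the given solution Lipschitz, so it has a limit at [tau], from which a
    global solution is attached. Without uniqueness, the solution built from its initial value might
    be a different one. *)
Lemma log_solution_extend (tau : R) (u : R -> 'rV[R]_N) : 0 < tau ->
  log_solution [set t | 0 <= t /\ t < tau] u ->
  exists u' : R -> 'rV[R]_N, log_solution half_line u' /\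
    forall t, 0 <= t -> t < tau -> u' t = u t.
Proof.
move=> tau0; set D := [set t | _] => sol.
have Ditv : initial_interval D.
  move=> t [t0 tt]; split=> // s; rewrite /= in_itv /= => /andP[s0 st].
  by split=> //; exact: le_lt_trans tt.
have [M M0 MP] := log_solution_bound (u 0).
have [B [B0 BP]] := log_field_bound M.
have lip s t i : 0 <= s -> s <= t -> t < tau -> `|u t 0 i - u s 0 i| <= B * (t - s).
  move=> s0 st tt.
  have sub : `[s, t] `<=` D.
    move=> z; rewrite /= in_itv /= => /andP[z0 zt].
    by split; [exact: le_trans z0|exact: le_lt_trans tt].
  have [c cin ->] := dw_MVT st sub (fun z Dz => sol z Dz i).
  rewrite normrM (ger0_norm (_ : 0 <= t - s)) ?subr_ge0// ler_wpM2r ?subr_ge0//.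
  by apply: BP => j; apply: (MP D u) => //; exact: sub cin.
(* As [u] is [B]-Lipschitz, [u s + B (tau - s)] is nonincreasing in [s], and its infimum is the
   limit of [u] at [tau]. *)
pose E i := [set u s 0 i + B * (tau - s) | s in D].
pose ubar : 'rV[R]_N := \row_i inf (E i).
have ubarP s i : 0 <= s -> s < tau -> `|ubar 0 i - u s 0 i| <= B * (tau - s).
  move=> s0 st.
  have lb z : D z -> u s 0 i - B * (tau - s) <= u z 0 i + B * (tau - z).
    move=> [z0 zt]; have [sz|zs] := leP s z.
      have := lip s z i s0 sz zt; rewrite ler_norml => /andP[h _].
      have : 0 <= B * (tau - z) by rewrite mulr_ge0// subr_ge0 ltW.
      move: h; rewrite !mulrBr; lra.
    have := lip z s i z0 (ltW zs) st; rewrite ler_norml => /andP[_ h].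
    have : 0 <= B * (tau - s) by rewrite mulr_ge0// subr_ge0 ltW.
    move: h; rewrite !mulrBr; lra.
  rewrite mxE ler_norml; apply/andP; split.
    rewrite lerBrDr addrC; apply: lb_le_inf.
      by exists (u s 0 i + B * (tau - s)); exists s.
    by move=> _ [z Dz <-]; exact: lb.
  rewrite lerBlDr addrC; apply: ge_inf; last by exists s.
  by exists (u s 0 i - B * (tau - s)) => _ [z Dz <-]; exact: lb.
have [y [y0 ysol]] := log_solution_exists ubar.
pose u' t := if t < tau then u t else y (t - tau).
exists u'; split; last by move=> t _ tt; rewrite /u' tt.
have u'_near t i : t < tau -> \forall s \near t, u s 0 i = u' s 0 i.
  move=> tt; near=> s; rewrite /u' ifT//.
  by near: s; exact: lt_nbhsl.
have left_dw t i : 0 <= t -> t < tau ->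
    derivative_within half_line (fun s => u' s 0 i) t (log_field T I alpha (u' t) i).
  move=> t0 tt.
  have E1 : u' t = u t by rewrite /u' tt.
  rewrite E1; apply: (dw_near_eq (f := fun s => u s 0 i)); first by rewrite E1.
    by rewrite near_withinE; apply: filterS (u'_near t i tt) => s + _.
  apply: dw_near_sub (sol t (conj t0 tt) i).
  by near=> s => s0; split=> //; near: s; exact: lt_nbhsl.
have right_dw t i : tau <= t ->
    derivative_within [set s | half_line (s - tau)] (fun s => u' s 0 i) t
      (log_field T I alpha (u' t) i).
  move=> tt; have tt0 : half_line (t - tau) by rewrite /half_line /= subr_ge0.
  have E1 s : half_line (s - tau) -> u' s = y (s - tau).
    by rewrite /half_line /= subr_ge0 => st; rewrite /u' ltNge st.
  rewrite E1//; apply: (dw_eq (f := fun s => y (s - tau) 0 i)) => //.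
    by move=> s /E1 ->.
  exact: dw_shift (ysol _ tt0 i).
move=> t t0 i; have [tt|tt] := ltP t tau; first exact: left_dw.
have [tautt|] := ltP tau t.
  apply: dw_near_sub (right_dw t i tt); near=> s => _.
  by rewrite /half_line /= subr_ge0 ltW//; near: s; exact: lt_nbhsr.
move=> tt'; have {tt tt'}tE : t = tau by apply/eqP; rewrite eq_le tt tt'.
subst t.
have u'tau : u' tau = ubar by rewrite /u' ltxx subrr y0.
have u'cvg j : u' s 0 j @[s --> tau^'-] --> u' tau 0 j.
  apply/cvgrPdist_le => e e0.
  near=> s.
  have st : s < tau by near: s; exact: nbhs_left_lt.
  have s0 : 0 < s by near: s; exact: nbhs_left_gt.
  rewrite u'tau /u' st (le_trans (ubarP s j (ltW s0) st))//.
  have : tau - e / (B + 1) < s.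
    by near: s; apply: nbhs_left_gt; rewrite ltrBlDr ltrDl divr_gt0// ltr_wpDl.
  rewrite ltrBlDr -ltrBlDl => h.
  apply: (@le_trans _ _ (B * (e / (B + 1)))); first by rewrite ler_wpM2l// ltW.
  by rewrite mulrA ler_pdivrMr ?ltr_wpDl// mulrC ler_pM2l//; lra.
(* At the junction the left derivative is obtained as the limit of the field, by continuity of [u'];
   the right one belongs to the attached solution. *)
have dl : derivative_within `]0, tau] (fun s => u' s 0 i) tau (log_field T I alpha (u' tau) i).
  apply: (dw_left_end (df := fun s => log_field T I alpha (u' s) i)) => //.
    move=> s /andP[s0 st]; apply: (dw_is_derive (D := half_line)).
      by apply: filterS (lt_nbhsr s0) => z; exact: ltW.
    by apply: left_dw => //; exact: ltW.
  exact: (log_field_cvg (at_left_proper_filter tau)).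
apply: dw_near_sub (dwU dl (right_dw tau i (lexx tau))).
near=> s => _; have s0 : 0 < s by near: s; exact: lt_nbhsr.
have [st|st] := leP s tau; first by left; rewrite /= in_itv /= s0.
by right; rewrite /half_line /= subr_ge0 ltW.
Unshelve. all: by end_near. Qed.

End LogFlowExistence.

Arguments half_line {R}.

(** * The density of the Lyapunov function *)

Section Lyapunov.
Variable R : realType.
Variable alpha : R.

(** The factor [expR (alpha * y)] is chosen so that the derivative of
    [log_weight v i * h (u i - v i)] along the flow is [(u i - v i) * log_weight u i * log_field u
    i], in which the curvature appears without a weight. *)
Lemma lyapunov_density : exists h : R -> R, h 0 = 0 /\
  forall y : R, is_derive y 1 h (expR (alpha * y) * y).
Proof.
have dE (a t : R) : derivative_within setT (fun s => expR (a * s)) t (a * expR (a * t)).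
  by apply: dw_val (dw_comp (dwZ (c := a) (dw_id setT t)) (is_derive_expR _)); rewrite mulr1 mulrC.
have [->|a0] := eqVneq alpha 0.
  exists (fun y => 2^-1 * (y * y)); split; first by rewrite !mulr0.
  move=> y; apply: (@dw_is_derive _ setT); first exact: filterT.
  apply: dw_val (dwZ (c := 2^-1) (dwM (dw_id setT y) (dw_id setT y))).
  by rewrite mul0r expR0; field.
exists (fun y => (alpha ^+ 2)^-1 * (expR (alpha * y) * (alpha * y - 1) + 1)); split.
  by rewrite mulr0 expR0; ring.
move=> y; apply: (@dw_is_derive _ setT); first exact: filterT.
apply: dw_val (dwZ (c := (alpha ^+ 2)^-1) (dwD (dwM (dE alpha y)
  (dwB (dwZ (c := alpha) (dw_id setT y)) (dw_cst setT y 1))) (dw_cst setT y 1))).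
by field.
Qed.

(** The mean value theorem applied to [h y - k y^2], whose derivative [(expR (alpha * y) - 2 k) y]
    has the sign of [y], or the opposite one, for the two extreme values of [k]. *)
Lemma lyapunov_density_bounds (h : R -> R) (M : R) : h 0 = 0 ->
  (forall y : R, is_derive y 1 h (expR (alpha * y) * y)) ->
  forall y, `|y| <= M ->
    expR (- (`|alpha| * M)) / 2 * y ^+ 2 <= h y <= expR (`|alpha| * M) / 2 * y ^+ 2.
Proof.
move=> h0 dh y yM.
have between (k z : R) : `|z| <= M -> exists2 x : R, `|x| <= M &
    h z - k * z ^+ 2 = (expR (alpha * x) - 2 * k) * (x * z) /\ 0 <= x * z.
  move=> zM.
  have dg t : setT t -> derivative_within setT (fun s => h s - k * (s * s)) t
      ((expR (alpha * t) - 2 * k) * t).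
    move=> _; apply: dw_val (dwB (is_derive_dw setT (dh t))
      (dwZ (c := k) (dwM (dw_id setT t) (dw_id setT t)))).
    by ring.
  have [z0|z0] := leP 0 z.
    have [x] := dw_MVT z0 (@subsetT _ _) dg; rewrite in_itv /= => /andP[x0 xz] E.
    exists x; first by rewrite ger0_norm// (le_trans xz)// (le_trans (ler_norm _)).
    split; last by rewrite mulr_ge0.
    by move: E; rewrite h0 !mulr0 !subr0 expr2 => ->; rewrite mulrA.
  have [x] := dw_MVT (ltW z0) (@subsetT _ _) dg; rewrite in_itv /= => /andP[xz x0] E.
  exists x.
    by rewrite ler0_norm// (le_trans _ zM)// ltr0_norm// lerN2.
  split; last by rewrite mulr_le0// ltW.
  move: E; rewrite h0 !mulr0 subrr !sub0r mulrN => /oppr_inj; rewrite expr2 => ->.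
  by rewrite mulrA.
have expM x : `|x| <= M -> expR (- (`|alpha| * M)) <= expR (alpha * x) <= expR (`|alpha| * M).
  move=> xM; rewrite !ler_expR -ler_norml normrM ler_wpM2l//.
apply/andP; split.
  have [x xM [E xy]] := between (expR (- (`|alpha| * M)) / 2) y yM.
  have /andP[e1 _] := expM x xM.
  rewrite -subr_ge0 E mulr_ge0// subr_ge0 mulrC divfK//.
have [x xM [E xy]] := between (expR (`|alpha| * M) / 2) y yM.
have /andP[_ e2] := expM x xM.
by rewrite -subr_le0 E mulr_le0_ge0// subr_le0 [2 * _]mulrC divfK.
Qed.

End Lyapunov.

(** * Exponential convergence *)

Section Convergence.
Variables (R : realType) (N : nat) (T : triangulation N) (I : {set 'I_N} -> R).
Hypothesis I_ge0 : forall e, e \in edges T -> 0 <= I e.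
Variable alpha : R.
Implicit Types (i j : 'I_N) (D : set R).

Let K := ext_log_curvature T I.
Let X : R := total_curvature R T.

Variable v : 'rV[R]_N.
Hypothesis v_adm : admissible T I (map_mx expR v).
Hypothesis v_const : forall i, K v i = X * log_weight alpha v i / weight_sum alpha v.
Hypothesis alphaX : alpha * X <= 0.

(** For [alpha = 0] the weight sum is the constant [N]; the scale is then fixed by the product of
    the radii, which is also conserved. *)
Definition log_size (u : 'rV[R]_N) : R :=
  if alpha == 0 then \sum_i u 0 i else weight_sum alpha u.

Lemma log_size_const D (u : R -> 'rV[R]_N) t : initial_interval D ->
  log_solution T I alpha D u -> D t -> log_size (u t) = log_size (u 0).
Proof.
move=> Ditv sol Dt; rewrite /log_size; case: eqP => [a0|_]; last first.
  apply: (weight_sum_const I_ge0 (phi := fun=> 1) Ditv) => // s Ds i.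
  by rewrite mul1r; exact: sol.
apply: (dw_const (f := fun s => \sum_i u s 0 i) Ditv) => // s Ds.
have := dw_sum (r := index_enum 'I_N) (P := predT) (fun i _ => sol s Ds i).
apply: dw_val; apply: etrans (sum_weight_field I_ge0 alpha (u s)).
by apply: eq_bigr => i _; rewrite /log_weight a0 mul0r expR0 mul1r.
Qed.

Let both_signs (u : 'rV[R]_N) : log_size u = log_size v ->
  (exists j, u 0 j - v 0 j <= 0) /\ (exists j, 0 <= u 0 j - v 0 j).
Proof.
have sum_eq (f g : 'I_N -> R) : \sum_i f i = \sum_i g i ->
    (exists j, f j <= g j) /\ (exists j, g j <= f j).
  move=> fg; have [i0 _] := vertex_exists T.
  have nlt (p q : 'I_N -> R) : (forall j, p j < q j) -> \sum_i p i < \sum_i q i.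
    move=> pq; apply: ltr_sum => [|j _]; last exact: pq.
    by apply/hasP; exists i0; rewrite ?mem_index_enum.
  split; apply: contrapT => H.
    have : \sum_i g i < \sum_i f i.
      by apply: nlt => j; rewrite ltNge; apply/negP => gf; apply: H; exists j.
    by rewrite fg ltxx.
  have : \sum_i f i < \sum_i g i.
    by apply: nlt => j; rewrite ltNge; apply/negP => gf; apply: H; exists j.
  by rewrite fg ltxx.
rewrite /log_size; case: eqP => [_|/eqP a0] /sum_eq[[j jle] [k kle]].
  by split; [exists j; rewrite subr_le0|exists k; rewrite subr_ge0].
move: jle kle; rewrite !ler_expR => jle kle.
have [ap|an] := ltP 0 alpha.
  split; [exists j; rewrite subr_le0|exists k; rewrite subr_ge0];
    by rewrite -(ler_pM2l ap).
have {an}an : alpha < 0 by rewrite lt_neqAle a0.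
split; [exists k; rewrite subr_le0|exists j; rewrite subr_ge0];
  by rewrite -(ler_nM2l an).
Qed.

(** Monotonicity sees only differences of coordinates. Equal sizes exclude a pure scaling: some
    vertex deviates from [v] with the opposite sign, or not at all, so its distance from the
    deviation at [i] is at least that deviation. *)
Let sqr_le_spread (u : 'rV[R]_N) i : log_size u = log_size v ->
  (u 0 i - v 0 i) ^+ 2 <=
    \sum_i \sum_j ((u 0 i - v 0 i) - (u 0 j - v 0 j)) ^+ 2.
Proof.
move=> /both_signs[[j jle] [k kle]].
pose e i := u 0 i - v 0 i.
have pick l : (e i - e l) ^+ 2 <= \sum_i \sum_j (e i - e j) ^+ 2.
  rewrite (bigD1 i)//=; apply: ler_wpDr.
    by apply: sumr_ge0 => m _; apply: sumr_ge0 => ? _; exact: sqr_ge0.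
  by rewrite (bigD1 l)//= lerDl sumr_ge0// => m _; exact: sqr_ge0.
have [ei|ei] := leP 0 (e i).
  apply: le_trans (pick j); rewrite ler_sqr ?nnegrE// -/(e i).
    by rewrite lerBrDr gerDl.
  by rewrite subr_ge0 (le_trans jle).
apply: le_trans (pick k); rewrite -[leLHS]sqrrN -[leRHS]sqrrN ler_sqr ?nnegrE -/(e i).
- by rewrite lerN2 gerBl.
- by rewrite oppr_ge0 ltW.
- by rewrite oppr_ge0 subr_le0 (le_trans (ltW ei)).
Qed.

(** The weight sums agree, and [(a - b) (expR (alpha * a) - expR (alpha * b))] is zero or has the
    sign of [alpha]; [alphaX] concludes. *)
Let drift_le0 (u : 'rV[R]_N) : log_size u = log_size v ->
  X * (\sum_i (u 0 i - v 0 i) *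
    (log_weight alpha u i / weight_sum alpha u - log_weight alpha v i / weight_sum alpha v)) <= 0.
Proof.
move=> size_eq.
have Weq : weight_sum alpha u = weight_sum alpha v.
  move: size_eq; rewrite /log_size; case: (alpha =P 0) => [a0 _|_]; last by [].

  by rewrite /weight_sum; apply: eq_bigr => i _; rewrite /log_weight a0 !mul0r.
have W0 := weight_sum_gt0 T alpha v.
rewrite mulr_sumr sumr_le0// => i _; rewrite Weq -mulrBl !mulrA.
rewrite pmulr_lle0 ?invr_gt0//.
rewrite /log_weight; have [->|a0] := eqVneq alpha 0.
  by rewrite !mul0r subrr mulr0.
have [ap|an] := ltP 0 alpha.
  have X0 : X <= 0 by rewrite -(pmulr_rle0 _ ap).
  rewrite -mulrA mulr_le0_ge0//.
  have [uv|vu] := leP (v 0 i) (u 0 i).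
    by rewrite mulr_ge0 ?subr_ge0// ler_expR ler_pM2l.
  by rewrite mulr_le0// subr_le0 ?ler_expR ?ler_pM2l// ltW.
have {an}an : alpha < 0 by rewrite lt_neqAle a0.
have X0 : 0 <= X by rewrite -(nmulr_rle0 _ an).
rewrite -mulrA mulr_ge0_le0//.
have [uv|vu] := leP (v 0 i) (u 0 i).
  by rewrite mulr_ge0_le0 ?subr_ge0// subr_le0 ler_expR ler_nM2l.
by rewrite mulr_le0_ge0 ?subr_le0 ?subr_ge0 ?ler_expR ?ler_nM2l// ltW.
Qed.

Lemma log_convergence (u : R -> 'rV[R]_N) : log_solution T I alpha half_line u ->
  log_size (u 0) = log_size v ->
  exists C lam : R, 0 < lam /\ forall t i, 0 <= t ->
    `|u t 0 i - v 0 i| <= C * expR (- (lam * t)).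
Proof.
move=> sol size0; have Ditv := @half_line_initial R.
have size_t t : 0 <= t -> log_size (u t) = log_size v.
  by move=> t0; rewrite (log_size_const Ditv sol t0).
have [M0 M00 M0P] := log_solution_bound I_ge0 v_adm v_const alphaX (u 0).
pose M := M0 + \sum_j `|v 0 j|.
have M_gt0 : 0 < M by rewrite ltr_pwDl// sumr_ge0.
have uM t i : 0 <= t -> `|u t 0 i - v 0 i| <= M.
  move=> t0; apply: le_trans (ler_normB _ _) _; rewrite lerD//.
    by apply: (M0P half_line u).
  by rewrite (bigD1 i)//= lerDl sumr_ge0.
have [c c0 cP] := ext_curvature_strong I_ge0 v_adm M_gt0.
have [h [h0 dh]] := lyapunov_density alpha.
have hb := lyapunov_density_bounds h0 dh.
pose c1 := expR (- (`|alpha| * M)) / 2; pose C1 := expR (`|alpha| * M) / 2.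
have c10 : 0 < c1 by rewrite divr_gt0// expR_gt0.
have C10 : 0 < C1 by rewrite divr_gt0// expR_gt0.
pose Wv := weight_sum alpha v.
have Wv0 : 0 < Wv := weight_sum_gt0 T alpha v.
pose L t := \sum_i log_weight alpha v i * h (u t 0 i - v 0 i).
pose S t := \sum_i \sum_j ((u t 0 i - v 0 i) - (u t 0 j - v 0 j)) ^+ 2.
pose dL t := \sum_i (u t 0 i - v 0 i) * (X * log_weight alpha (u t) i / weight_sum alpha (u t)
   - K (u t) i).
have N0 : 0 < N%:R :> R by rewrite ltr0n (vertex_nonempty T).
have dLP t : 0 <= t -> derivative_within half_line L t (dL t).
  move=> t0; apply: dw_sum => i _.
  have dui := dwB (sol t t0 i) (dw_cst half_line t (v 0 i)).
  apply: dw_val (dwZ (c := log_weight alpha v i) (dw_comp dui (dh _))).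
  rewrite -weight_field subr0 /log_weight [alpha * (_ - _)]mulrBr expRB.
  have := expR_gt0 (alpha * v 0 i); move: (expR (alpha * v 0 i)) => y y0.
  move: (log_field _ _ _ _ _) (expR _) => a b; field.
  by rewrite gt_eqF.
have dL_le t : 0 <= t -> dL t <= - (c * S t).
  move=> t0.
  have E : dL t = X * (\sum_i (u t 0 i - v 0 i) *
      (log_weight alpha (u t) i / weight_sum alpha (u t) -
       log_weight alpha v i / weight_sum alpha v)) -
      \sum_i (u t 0 i - v 0 i) * (K (u t) i - K v i).
    rewrite mulr_sumr -sumrB; apply: eq_bigr => i _; rewrite v_const.
    move: (K _ _) (_ - v 0 i) (weight_sum _ (u t)) (weight_sum _ v) => k e w1 w2.
    by move: (log_weight _ _ _) (log_weight _ _ _) (w1^-1) (w2^-1) => a b p q; ring.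
  rewrite E -[leRHS]add0r lerD ?drift_le0 ?size_t// lerN2.
  by apply: cP => i; exact: uM.
have L_le t : 0 <= t -> L t <= Wv * C1 * N%:R * S t.
  move=> t0.
  have S0 : 0 <= S t by apply: sumr_ge0 => i _; apply: sumr_ge0 => j _; exact: sqr_ge0.
  have -> : Wv * C1 * N%:R * S t = \sum_(i < N) Wv * (C1 * S t).
    by rewrite sumr_const card_ord -[RHS]mulr_natl; ring.
  apply: ler_sum => i _.
  have /andP[h1 h2] := hb M _ (uM t i t0).
  apply: ler_pM; first by rewrite ltW ?log_weight_gt0.
  - by apply: le_trans h1; rewrite mulr_ge0 ?sqr_ge0// ltW.
  - rewrite /Wv /weight_sum (bigD1 i)//= lerDl sumr_ge0// => j _.
    by rewrite ltW ?log_weight_gt0.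
  apply: le_trans h2 _; rewrite ler_pM2l//; apply: sqr_le_spread; exact: size_t.
have WCN := mulr_gt0 (mulr_gt0 Wv0 C10) N0.
(* The derivative of [L] is at most [- c S], and [L] is at most [Wv * C1 * N] times [S]; the
   quotient is the decay rate of [L]. *)
pose kap := c / (Wv * C1 * N%:R).
have kap0 : 0 < kap := divr_gt0 c0 WCN.
have dL_kap t : 0 <= t -> dL t <= - (kap * L t).
  move=> t0; apply: le_trans (dL_le t t0) _; rewrite lerN2 /kap mulrAC (ler_pdivrMr _ _ WCN).
  by rewrite -[leRHS]mulrA ler_pM2l// [leRHS]mulrC L_le.
have Lexp t : 0 <= t -> L t <= L 0 * expR (- (kap * t)).
  move=> t0.
  have dLE s : half_line s -> derivative_within half_line (fun s => L s * expR (kap * s)) s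
      ((dL s + kap * L s) * expR (kap * s)).
    move=> s0; have dE := dw_comp (dwZ (c := kap) (dw_id half_line s)) (is_derive_expR _).
    by apply: dw_val (dwM (dLP s s0) dE); ring.
  have H : L t * expR (kap * t) <= L 0 * expR (kap * 0).
    apply: (dw_nonincr (f := fun s => L s * expR (kap * s)) Ditv dLE) => // s s0.
    rewrite mulr_le0_ge0 ?expR_ge0// -lerBrDr sub0r; exact: dL_kap.
  move: H; rewrite mulr0 expR0 mulr1 => H.
  by rewrite expRN ler_pdivlMr ?expR_gt0.
(* [1 + q] bounds the square root of [q], and the sum over vertices gives one constant for all of
   them. The rate is halved because [L] controls squares. *)
exists (\sum_i (1 + L 0 / (log_weight alpha v i * c1))), (kap / 2).
split; first by rewrite divr_gt0.
move=> t i t0.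
have /andP[h1 _] := hb M _ (uM t i t0).
have Lpos j s : 0 <= s -> 0 <= log_weight alpha v j * h (u s 0 j - v 0 j).
  move=> s0; have /andP[h1' _] := hb M _ (uM s j s0).
  apply: mulr_ge0; first by rewrite ltW ?log_weight_gt0.
  by apply: le_trans h1'; rewrite mulr_ge0 ?sqr_ge0// ltW.
have w0 := log_weight_gt0 alpha v i.
have wc0 : 0 < log_weight alpha v i * c1 by rewrite mulr_gt0.
have L00 : 0 <= L 0 by apply: sumr_ge0 => j _; exact: Lpos.
have e2 : (u t 0 i - v 0 i) ^+ 2 <= L 0 / (log_weight alpha v i * c1) * expR (- (kap * t)).
  rewrite mulrAC ler_pdivlMr// mulrC -mulrA.
  apply: le_trans (Lexp t t0); apply: (@le_trans _ _ (log_weight alpha v i * h (u t 0 i - v 0 i))).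
    by rewrite ler_pM2l.
  by rewrite /L (bigD1 i)//= lerDl sumr_ge0// => j _; exact: Lpos.
set q := L 0 / (log_weight alpha v i * c1) in e2.
have q0 : 0 <= q by rewrite divr_ge0// ltW.
have e3 : `|u t 0 i - v 0 i| <= (1 + q) * expR (- (kap / 2 * t)).
  rewrite -ler_sqr ?nnegrE ?mulr_ge0 ?addr_ge0 ?expR_ge0// real_normK ?num_real//.
  apply: le_trans e2 _; rewrite exprMn.
  have -> : expR (- (kap / 2 * t)) ^+ 2 = expR (- (kap * t)).
    by rewrite expr2 -expRD; congr expR; field.
  by rewrite ler_wpM2r ?expR_ge0//; have := sqr_ge0 q; lra.
apply: le_trans e3 _; rewrite ler_wpM2r ?expR_ge0// (bigD1 i)//= lerDl sumr_ge0// => j _.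
by rewrite addr_ge0// divr_ge0// mulr_ge0// ltW ?log_weight_gt0.
Qed.

End Convergence.

(** * Back to radii *)

Section LogCoordinates.
Variables (R : realType) (N : nat) (T : triangulation N) (I : {set 'I_N} -> R).
Hypothesis I_ge0 : forall e, e \in edges T -> 0 <= I e.
Variable alpha : R.
Implicit Types (i j k : 'I_N) (r u v : 'rV[R]_N) (tau : \bar R).

Let K := ext_log_curvature T I.
Let X : R := total_curvature R T.
Let lnv r : 'rV[R]_N := map_mx (@ln R) r.
Let expv u : 'rV[R]_N := map_mx expR u.

Lemma time_interval_EFin (tau : R) : time_interval tau%:E = [set t | 0 <= t /\ t < tau].
Proof. by apply/seteqP; split=> t /=; rewrite /time_interval /= lte_fin. Qed.

Lemma time_interval_pinfty : time_interval +oo%E = @half_line R.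
Proof. by apply/seteqP; split=> t /=; [case|split=> //; exact: ltry]. Qed.

Lemma time_interval_initial tau : initial_interval (time_interval tau).
Proof.
move=> t [t0 tt]; split=> // s; rewrite /= in_itv /= => /andP[s0 st]; split=> //.
by apply: le_lt_trans tt; rewrite lee_fin.
Qed.

Lemma ext_flow_log tau (r : R -> 'rV[R]_N) : ext_flow_solution T I alpha tau r ->
  log_solution T I alpha (time_interval tau) (fun t => lnv (r t)).
Proof.
move=> sol t Dt i; have [r0 dr] := sol t Dt.
apply: (dw_ext (f := fun s => ln (r s 0 i))) => [s|]; first by rewrite mxE.
apply: dw_val (dw_comp (dr i) (is_derive1_ln (r0 i))).
rewrite -[X in ext_flow_field T I alpha X](expR_ln r0) ext_flow_fieldE// mxE lnK ?posrE//.
by rewrite mulrC mulfK// gt_eqF.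
Qed.

Lemma log_ext_flow tau (u : R -> 'rV[R]_N) :
  log_solution T I alpha (time_interval tau) u ->
  ext_flow_solution T I alpha tau (fun t => expv (u t)).
Proof.
move=> sol t Dt; split=> [|i]; first exact: positive_expR.
rewrite ext_flow_fieldE// mulrC.
apply: (dw_ext (f := fun s => expR (u s 0 i))) => [s|]; first by rewrite mxE.
exact: dw_comp (sol t Dt i) (is_derive_expR _).
Qed.

Lemma flow_fieldE r : admissible T I r ->
  flow_field T I alpha r = ext_flow_field T I alpha r.
Proof.
move=> adm; apply/rowP => i; rewrite !mxE; congr ((_ - _ / _) * _).
rewrite -(expR_ln adm.1); apply: curvature_log_admissible => //.
by rewrite expR_ln//; exact: adm.1.
Qed.

Lemma flow_solution_ext tau (r : R -> 'rV[R]_N) : flow_solution T I alpha tau r ->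
  ext_flow_solution T I alpha tau r.
Proof.
move=> sol t Dt; have [adm dr] := sol t Dt; split=> [|i]; first exact: adm.1.
by rewrite -flow_fieldE.
Qed.

(** Gauss-Bonnet leaves [X / weight_sum] as the only possible value of the constant. *)
Lemma constant_curvature_log r : constant_alpha_curvature T I alpha r -> forall i,
  K (lnv r) i = X * log_weight alpha (lnv r) i / weight_sum alpha (lnv r).
Proof.
move=> [adm [c Hc]].
have Kc j : K (lnv r) j = c * log_weight alpha (lnv r) j.
  rewrite -(Hc j) alpha_curvature_logE// /log_weight mxE expRN divfK//.
  by rewrite gt_eqF ?expR_gt0.
have -> : X = c * weight_sum alpha (lnv r).
  rewrite /X /total_curvature -(gauss_bonnet I_ge0 (lnv r)) mulr_sumr.
  by apply: eq_bigr => j _; exact: Kc.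
by move=> i; rewrite Kc mulrAC mulfK// gt_eqF// (weight_sum_gt0 T).
Qed.

Lemma admissible_shift u (s : R) : admissible T I (expv u) ->
  admissible T I (expv (u + const_mx s)).
Proof.
move=> /admissibleE adm; apply/admissibleE => i j k F; have := adm _ _ _ F.
rewrite /log_triangle /face_triangle /radii_triangle !mxE !expRD.
rewrite ![_ * expR s]mulrC !edge_len_scale ?expR_gt0//.
by rewrite /is_triangle -!mulrDr !ltr_pM2l ?expR_gt0.
Qed.

Lemma log_weight_shift u (s : R) i :
  log_weight alpha (u + const_mx s) i = expR (alpha * s) * log_weight alpha u i.
Proof. by rewrite /log_weight !mxE mulrDr expRD mulrC. Qed.

Lemma weight_sum_shift u (s : R) :
  weight_sum alpha (u + const_mx s) = expR (alpha * s) * weight_sum alpha u.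
Proof.
by rewrite /weight_sum mulr_sumr; apply: eq_bigr => i _; exact: log_weight_shift.
Qed.

Lemma alpha_sizeE u :
  alpha_size alpha (expv u) = (if alpha == 0 then expR else id) (log_size alpha u).
Proof.
rewrite /alpha_size /log_size; case: eqP => _.
  by rewrite expR_sum; apply: eq_bigr => i _; rewrite mxE.
apply: eq_bigr => i _; rewrite mxE /log_weight.
by rewrite /powR gt_eqF ?expR_gt0// expRK.
Qed.

Lemma log_size_shift u v : exists s : R,
  log_size alpha (u + const_mx s) = log_size alpha v.
Proof.
have N0 : N%:R != 0 :> R by rewrite pnatr_eq0 -lt0n (vertex_nonempty T).
rewrite /log_size; case: eqP => [_|/eqP a0].
  exists ((\sum_i v 0 i - \sum_i u 0 i) / N%:R).
  under eq_bigr do rewrite !mxE.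
  by rewrite big_split /= sumr_const card_ord -[_ *+ N]mulr_natr divfK// addrC subrK.
have W0 w := weight_sum_gt0 T alpha w.
exists (ln (weight_sum alpha v / weight_sum alpha u) / alpha).
rewrite weight_sum_shift [alpha * _]mulrC divfK// lnK ?posrE ?divr_gt0//.
by rewrite divfK// gt_eqF.
Qed.

(** Scaling changes neither the extended curvature nor the shares of the weights, so [rs] can be
    moved along its ray to the conserved size of [r0]. *)
Lemma normalized_target rs r0 : constant_alpha_curvature T I alpha rs ->
  positive_radii r0 -> exists c : R, exists v,
    [/\ 0 < c, expv v = c *: rs, admissible T I (expv v),
        forall i, K v i = X * log_weight alpha v i / weight_sum alpha v &
        log_size alpha (lnv r0) = log_size alpha v].
Proof.
move=> crs r00; have adm := crs.1.
have [s sE] := log_size_shift (lnv rs) (lnv r0).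
exists (expR s), (lnv rs + const_mx s); split=> [||||//].
- exact: expR_gt0.
- by apply/rowP => i; rewrite !mxE expRD lnK ?posrE ?adm.1// mulrC.
- by apply: admissible_shift; rewrite /expv expR_ln//; exact: adm.1.
move=> i; rewrite /K ext_log_curvature_shift// log_weight_shift weight_sum_shift.
rewrite [LHS](constant_curvature_log crs) [X * (_ * _)]mulrCA -mulf_div divff ?mul1r//.
by rewrite gt_eqF ?expR_gt0.
Qed.

Lemma expR_lipschitz (M a b : R) : a <= M -> b <= M ->
  `|expR a - expR b| <= expR M * `|a - b|.
Proof.
wlog ba : a b / b <= a => [H aM bM|aM bM].
  have [/H|/ltW/H] := leP b a; first exact.
  by rewrite distrC [`|b - a|]distrC; exact.
rewrite !ger0_norm ?subr_ge0 ?ler_expR//.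
have -> : expR a - expR b = expR a * (1 - expR (b - a)).
  by rewrite mulrBr mulr1 -expRD [a + _]addrC subrK.
apply: ler_pM; rewrite ?expR_ge0 ?ler_expR ?subr_ge0//.
  by rewrite -expR0 ler_expR subr_le0.
by have := expR_ge1Dx (b - a); lra.
Qed.

Lemma converges_expR (u : R -> 'rV[R]_N) v :
  (exists C lam : R, 0 < lam /\ forall t i, 0 <= t ->
    `|u t 0 i - v 0 i| <= C * expR (- (lam * t))) ->
  converges_exponentially (fun t => expv (u t)) (expv v).
Proof.
move=> [C [lam [lam0 uv]]]; pose M := \sum_j `|v 0 j| + `|C|.
have vM i : `|v 0 i| + `|C| <= M by rewrite lerD2r (bigD1 i)//= lerDl sumr_ge0.
exists (expR M * C), lam; split=> // t i t0; rewrite !mxE -mulrA.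
have e1 : C * expR (- (lam * t)) <= `|C|.
  apply: le_trans (ler_norm _) _; rewrite normrM ler_piMr// ger0_norm ?expR_ge0//.
  by rewrite -expR0 ler_expR oppr_le0 mulr_ge0// ltW.
have vi := vM i; have vn := ler_norm (v 0 i); have C0 := normr_ge0 C.
have uM : u t 0 i <= M.
  have := uv t i t0; rewrite ler_norml => /andP[_].
  by move: (expR _) (`|C|) e1 vi => p q; lra.
apply: le_trans (expR_lipschitz uM _) _; first lra.
by rewrite ler_pM2l ?expR_gt0// uv.
Qed.

Section Extended.
Variables rs r0 : 'rV[R]_N.
Hypotheses (rs_const : constant_alpha_curvature T I alpha rs)
  (r0_gt0 : positive_radii r0) (alphachi : alpha * (euler_char T)%:~R <= 0).

Let alphaX : alpha * X <= 0.
Proof. by rewrite /X /total_curvature mulrCA mulr_ge0_le0// mulr_ge0// pi_ge0. Qed.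

Let v_adm : admissible T I (expv (lnv rs)).
Proof. by rewrite /expv expR_ln; [exact: rs_const.1|exact: rs_const.1.1]. Qed.

Let v_const := constant_curvature_log rs_const.

Lemma log_solution_bounded (u0 : 'rV[R]_N) : exists M : R,
  forall D (u : R -> 'rV[R]_N), initial_interval D -> log_solution T I alpha D u ->
    u 0 = u0 -> forall t i, D t -> `|u t 0 i| <= M.
Proof.
by have [M _ MP] := log_solution_bound I_ge0 v_adm v_const alphaX u0; exists M.
Qed.

Lemma ext_flow_exists : exists_for_all_time (ext_flow_solution T I alpha) r0.
Proof.
split.
  have [u [u0 sol]] := log_solution_exists I_ge0 v_adm v_const alphaX (lnv r0).
  exists (fun t => expv (u t)); split; last by rewrite u0 /expv expR_ln.
  by apply: log_ext_flow; rewrite time_interval_pinfty.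
case=> [tau||] r //; last by [exists r].
rewrite lte_fin => tau0 sol _.
have lsol : log_solution T I alpha [set t : R | 0 <= t /\ t < tau] (fun t => lnv (r t)).
  by rewrite -time_interval_EFin; exact: ext_flow_log.
have [u [usol uE]] := log_solution_extend I_ge0 v_adm v_const alphaX tau0 lsol.
exists (fun t => expv (u t)); split.
  by apply: log_ext_flow; rewrite time_interval_pinfty.
move=> t Dt; have [rt _] := sol t Dt; move: Dt; rewrite time_interval_EFin => -[t0 tt].
by rewrite uE// /expv expR_ln.
Qed.

Lemma ext_flow_converges : exists c v, [/\ 0 < c, expv v = c *: rs,
  admissible T I (expv v), alpha_size alpha (c *: rs) = alpha_size alpha r0 &
  forall r : R -> 'rV[R]_N, ext_flow_solution T I alpha +oo%E r -> r 0 = r0 ->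
    converges_exponentially r (c *: rs)].
Proof.
have [c [v [c0 vE w_adm w_const size_eq]]] := normalized_target rs_const r0_gt0.
exists c, v; split=> //.
  by rewrite -vE -[in RHS](expR_ln r0_gt0) !alpha_sizeE size_eq.
move=> r sol rE; have lsol := ext_flow_log sol; rewrite time_interval_pinfty in lsol.
have size0 : log_size alpha (lnv (r 0)) = log_size alpha v by rewrite rE.
have /converges_expR[C [lam [lam0 H]]] :=
  log_convergence I_ge0 w_adm w_const alphaX lsol size0.
exists C, lam; split=> // t i t0; rewrite -vE; apply: le_trans (H t i t0).
have Dt : time_interval +oo%E t by rewrite time_interval_pinfty.
by have [rt _] := sol t Dt; rewrite /expv /lnv expR_ln.
Qed.

(** The bound [M] is uniform on the whole interval, finite or not, and keeps every radius above
    [expR (- M)]. *)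
Lemma no_essential_singularity tau (r : R -> 'rV[R]_N) : (0 < tau)%E ->
  ext_flow_solution T I alpha tau r -> ~ essential_singularity r tau.
Proof.
move=> tau0 sol [i [t_ [[Dt _] r_to0]]].
have [M MP] := log_solution_bounded (lnv (r 0)).
have [n] := filter_ex (cvgr_lt _ r_to0 _ (expR_gt0 (- M))).
apply/negP; rewrite -leNgt.
have := MP _ _ (@time_interval_initial tau) (ext_flow_log sol) erefl _ i (Dt n).
rewrite ler_norml => /andP[+ _]; rewrite mxE -ler_expR lnK// posrE.
by have [rt _] := sol _ (Dt n); exact: rt.
Qed.

End Extended.
End LogCoordinates.

(** * Removable singularities *)

Section Singularities.
Variables (R : realType) (N : nat) (T : triangulation N) (I : {set 'I_N} -> R).
Hypothesis I_ge0 : forall e, e \in edges T -> 0 <= I e.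
Variable alpha : R.
Implicit Types (i j k : 'I_N) (r u v : 'rV[R]_N).

Let expv u : 'rV[R]_N := map_mx expR u.

Definition edge_excess r i j k : R :=
  edge_length I r i k + edge_length I r k j - edge_length I r i j.

Lemma edge_excess_cvg (S : Type) (F : set_system S) (FF : ProperFilter F)
    (r : S -> 'rV[R]_N) (r0 : 'rV[R]_N) i j k :
  (forall l, r s 0 l @[s --> F] --> r0 0 l) ->
  edge_excess (r s) i j k @[s --> F] --> edge_excess r0 i j k.
Proof.
move=> rr; have len a b : edge_length I (r s) a b @[s --> F] --> edge_length I r0 a b.
  apply: continuous_cvg; first exact: sqrt_continuous.
  apply: cvgD.
    by apply: cvgD; apply: cvgM; exact: rr.
  by apply: cvgM; [apply: cvgM; [apply: cvgM; [exact: cvg_cst|exact: rr]|exact: rr]|exact: cvg_cst].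
by apply: cvgB; [apply: cvgD; exact: len|exact: len].
Qed.

(** Permuting the vertices of a face produces all three inequalities from one. *)
Lemma edge_excess_admissible r : positive_radii r ->
  (forall i j k, is_face T i j k -> 0 < edge_excess r i j k) <-> admissible T I r.
Proof.
move=> r0; split=> [H|[_ H] i j k /H].
  split=> // i j k F; have F1 := H i j k F.
  have F2 : 0 < edge_excess r i k j by apply: H; rewrite is_face_swap.
  have F3 : 0 < edge_excess r j k i by apply: H; rewrite -is_face_rot.
  by rewrite /Defs.nondegenerate -!(subr_gt0 (edge_length _ _ _ _)); apply/and3P.
by rewrite /Defs.nondegenerate /edge_excess subr_gt0 => /and3P[].
Qed.

Lemma no_removable_at_limit (tau : \bar R) (r : R -> 'rV[R]_N) r1 :
  admissible T I r1 ->
  (forall t_ : nat -> R, times_to tau t_ ->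
    forall l, r (t_ n) 0 l @[n --> \oo] --> r1 0 l) ->
  ~ removable_singularity T I r tau.
Proof.
move=> adm cv [t_ [tt [_ [i [j [k [F ex0]]]]]]].
have ex1 := edge_excess_cvg (i := i) (j := j) (k := k) eventually_filter (cv t_ tt).
have E : 0 = edge_excess r1 i j k by apply: (cvg_unique _ ex0 ex1); exact: norm_hausdorff.
have [pos _] := adm.
by have := (edge_excess_admissible pos).2 adm i j k F; rewrite -E ltxx.
Qed.

Lemma times_to_harmonic (tau : R) : 0 < tau ->
  times_to tau%:E (fun n => tau - tau * harmonic n).
Proof.
move=> tau0; split=> [n|].
  have h0 : 0 < (harmonic n : R) by exact: harmonic_gt0.
  (* Equality at [n = 0]: the sequence starts at time 0, which belongs to the interval. *)
  have h1 : (harmonic n : R) <= 1 by rewrite /harmonic /= invf_le1 ?ltr0n// ler1n.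
  rewrite time_interval_EFin; split; last by rewrite ltrBlDr ltrDl mulr_gt0.
  by rewrite subr_ge0 ler_piMr// ltW.
apply: cvg_EFin; first by near=> n.
rewrite [X in _ --> X](_ : _ = tau - tau * 0); last by rewrite mulr0 subr0.
apply: cvgB; first exact: cvg_cst.
by apply: cvgM; [exact: cvg_cst|exact: cvg_harmonic].
Unshelve. all: by end_near. Qed.

(* At the first exit time the radii are bounded and bounded away from 0, while
   some triangle inequality, strict up to then, becomes an equality. *)
Lemma first_exit_removable (u : R -> 'rV[R]_N) (t0 : R) :
  log_solution T I alpha half_line u -> admissible T I (expv (u 0)) ->
  0 <= t0 -> ~ admissible T I (expv (u t0)) ->
  (exists M : R, forall (t : R) i, 0 <= t -> `|u t 0 i| <= M) ->
  exists tau : R, [/\ 0 < tau,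
    flow_solution T I alpha tau%:E (fun t => expv (u t)) &
    removable_singularity T I (fun t => expv (u t)) tau%:E].
Proof.
move=> sol adm0 t00 bad0 [M uM].
pose B := [set t | 0 <= t /\ ~ admissible T I (expv (u t))].
have B0 : B !=set0 by exists t0.
have lbB : has_lbound B by exists 0 => t [].
pose tau := inf B.
have tau0 : 0 <= tau by apply: lb_le_inf => // t [].
have good (t : R) : 0 <= t -> t < tau -> admissible T I (expv (u t)).
  move=> t0' tt; apply: contrapT => bad.
  by have : tau <= t; [apply: ge_inf|rewrite leNgt tt].
have ucvg (t : R) j : 0 <= t -> u s 0 j @[s --> within half_line (nbhs t)] --> u t 0 j.
  by move=> tp; apply: dw_cvg (sol t tp j).
(* Admissibility is open, so the infimum of the bad times is itself bad. *)
have tau_bad : ~ admissible T I (expv (u tau)).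
  move=> adm; have FF : ProperFilter (within half_line (nbhs tau)).
    by apply: within_nbhs_proper; exact: subset_closure.
  have [e e0 eP] := near_within_ball (admissible_near FF (fun j => ucvg tau j tau0) adm).
  have [b [bp bbad] be] := inf_adherent e0 (conj B0 lbB).
  have bt : tau <= b by apply: ge_inf => //; split.
  apply: bbad; apply: eP => //.
  by rewrite ger0_norm ?subr_ge0// ltrBlDl.
have tau_gt0 : 0 < tau.
  by rewrite lt_neqAle tau0 andbT; apply/eqP => E; apply: tau_bad; rewrite -E.
have Dsub : time_interval tau%:E `<=` half_line.
  by move=> t; rewrite time_interval_EFin => -[].
have flow : flow_solution T I alpha tau%:E (fun t => expv (u t)).
  move=> t Dt; have := Dt; rewrite time_interval_EFin => -[tp tt].
  have adm := good t tp tt; split=> // i; rewrite flow_fieldE//.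
  have lsol : log_solution T I alpha (time_interval tau%:E) u.
    by move=> s Ds l; exact: dw_sub Dsub (sol s (Dsub s Ds) l).
  by have [_] := log_ext_flow lsol Dt; exact.
exists tau; split=> //.
exists (fun n => tau - tau * harmonic n); have [Dt tcv] := times_to_harmonic tau_gt0.
split; first by split.
split.
  exists [set r | forall i, `[expR (- M), expR M]%classic (r 0 i)]; split.
  - exact: (@rV_compact R N (fun=> `[expR (- M), expR M]%classic)
      (fun=> @segment_compact R _ _)).
  - move=> r rP i; have := rP i; rewrite /= in_itv /= => /andP[+ _].
    by apply: lt_le_trans; exact: expR_gt0.
  - move=> n i; rewrite /= in_itv /= mxE !ler_expR -ler_norml uM//.
    by have [] := Dt n.
have [[[i j] k] F le0] : exists2 p : 'I_N * 'I_N * 'I_N, is_face T p.1.1 p.1.2 p.2 &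
    edge_excess (expv (u tau)) p.1.1 p.1.2 p.2 <= 0.
  apply: contrapT => H; apply: tau_bad.
  apply/edge_excess_admissible; first exact: positive_expR.
  move=> i j k F; rewrite ltNge; apply/negP => le0; apply: H.
  by exists (i, j, k).
rewrite /= in F le0.
exists i, j, k; split=> //.
have tn : tau - tau * harmonic n @[n --> \oo] --> tau.
  rewrite [X in _ --> X](_ : _ = tau - tau * 0); last by rewrite mulr0 subr0.
  apply: cvgB; first exact: cvg_cst.
  by apply: cvgM; [exact: cvg_cst|exact: cvg_harmonic].
have un l : u (tau - tau * harmonic n) 0 l @[n --> \oo] --> u tau 0 l.
  apply: (@cvg_comp _ _ _ (fun n => tau - tau * harmonic n) (fun s => u s 0 l));
    last exact: ucvg tau l tau0.
  move=> A; rewrite /within /= => /tn; rewrite /nbhs /=; apply: filterS => n; apply.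
  by have [] := Dt n.
have exn : edge_excess (expv (u (tau - tau * harmonic n))) i j k @[n --> \oo]
    --> edge_excess (expv (u tau)) i j k.
  apply: edge_excess_cvg => l; rewrite mxE.
  under eq_fun do rewrite mxE.
  by apply: continuous_cvg (un l); exact: continuous_expR.
(* The excess at [tau] is nonpositive by the choice of the face, and nonnegative as a limit of
   positive values. *)
suff E : edge_excess (expv (u tau)) i j k = 0 by rewrite E in exn.
apply/eqP; rewrite eq_le le0 /=.
have cl : closed [set x : R | 0 <= x] by exact: closed_ge.
apply: (closed_cvg _ cl _ _ exn); apply: nearW => n /=.
have := Dt n; rewrite time_interval_EFin => -[p1 p2].
have adm := good _ p1 p2.
by apply: ltW; have [pos _] := adm; exact: (edge_excess_admissible pos).2.
Qed.

End Singularities.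

(** * Limits of solutions and consequences for the original flow *)

Section Limits.
Variables (R : realType) (N : nat) (T : triangulation N) (I : {set 'I_N} -> R).
Hypothesis I_ge0 : forall e, e \in edges T -> 0 <= I e.
Variable alpha : R.
Implicit Types (i j k : 'I_N) (u v : 'rV[R]_N).

(** Increments over unit time tend to 0, and each is a value of the field at a late time. *)
Lemma log_solution_limit (u : R -> 'rV[R]_N) v :
  log_solution T I alpha half_line u ->
  (forall j, u t 0 j @[t --> +oo%R] --> v 0 j) ->
  forall i, log_field T I alpha v i = 0.
Proof.
move=> sol uv i; have Vv : log_field T I alpha (u t) i @[t --> +oo%R] --> log_field T I alpha v i.
  exact: log_field_cvg.
apply/eqP; rewrite -normr_eq0 eq_le normr_ge0 andbT.
apply/ler_addgt0Pl => e e0; rewrite addr0.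
have e3 : 0 < e / 3 by rewrite divr_gt0.
have := filterI (cvgr_dist_lt _ _ Vv _ e3) (cvgr_dist_lt _ _ (uv i) _ e3).
move=> [A [_ AP]].
pose t := Num.max A 0 + 1.
have tA : A < t by rewrite /t ltr_pwDr// le_max lexx.
have t0 : 0 <= t by rewrite /t addr_ge0// le_max lexx orbT.
have t1 : t <= t + 1 by rewrite lerDl.
have sub : `[t, t + 1] `<=` half_line.
  by move=> s; rewrite /= in_itv /= => /andP[ts _]; exact: le_trans ts.
have [x] := dw_MVT t1 sub (fun s hs => sol s hs i).
rewrite in_itv /= => /andP[tx _] E.
have [Hx _] := AP x (lt_le_trans tA tx).
have [_ H0] := AP t tA.
have [_ H1] := AP (t + 1) (lt_le_trans tA t1).
move: E Hx H0 H1; rewrite [t + 1 - t]addrC addKr mulr1 /=.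
move: (log_field _ _ _ _ _) (log_field _ _ _ _ _) (u (t + 1) 0 i) (u t 0 i) (v 0 i).
move=> a b p q w E; rewrite !ltr_distl => /andP[h1 h2] /andP[h3 h4] /andP[h5 h6].
by rewrite ler_norml; apply/andP; split; lra.
Qed.

Lemma flow_limit_constant (r : R -> 'rV[R]_N) (rs : 'rV[R]_N) :
  flow_solution T I alpha +oo%E r -> admissible T I rs ->
  r t @[t --> +oo%R] --> rs -> constant_alpha_curvature T I alpha rs.
Proof.
move=> sol adm cv; have rs0 := adm.1; split=> //.
have lsol := ext_flow_log (flow_solution_ext I_ge0 sol); rewrite time_interval_pinfty in lsol.
have ucv j : map_mx (@ln R) (r t) 0 j @[t --> +oo%R] --> map_mx (@ln R) rs 0 j.
  rewrite mxE; under eq_fun do rewrite mxE.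
  apply: continuous_cvg; first exact: continuous_ln.
  exact: (@continuous_cvg _ _ _ _ _ r (fun M : 'rV[R]_N => M 0 j) rs
    (@coord_continuous R 1 N 0 j rs) cv).
exists (total_curvature R T / weight_sum alpha (map_mx (@ln R) rs)) => i.
have := log_solution_limit lsol ucv i.
rewrite alpha_curvature_logE// /log_field mxE => /eqP; rewrite subr_eq0 => /eqP ->.
by [].
Qed.

Section Target.
Variables rs r0 : 'rV[R]_N.
Hypotheses (rs_const : constant_alpha_curvature T I alpha rs)
  (r0_adm : admissible T I r0) (alphachi : alpha * (euler_char T)%:~R <= 0).
Hypothesis regular : forall (tau : R) (r : R -> 'rV[R]_N), 0 < tau ->
  flow_solution T I alpha tau%:E r -> r 0 = r0 -> ~ removable_singularity T I r tau%:E.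

(** Up to a first exit from the admissible set the extended solution solves the original flow, and
    the exit would be a removable singularity in finite time, which [regular] forbids. *)
Lemma ext_flow_admissible (r : R -> 'rV[R]_N) :
  ext_flow_solution T I alpha +oo%E r -> r 0 = r0 ->
  flow_solution T I alpha +oo%E r.
Proof.
move=> sol rE; have lsol := ext_flow_log sol; rewrite time_interval_pinfty in lsol.
pose u t := map_mx (@ln R) (r t).
have ru t : 0 <= t -> map_mx expR (u t) = r t.
  move=> t0; have Dt : time_interval +oo%E t by rewrite time_interval_pinfty.
  by have [rt _] := sol t Dt; exact: expR_ln.
have uM : exists M : R, forall (t : R) i, 0 <= t -> `|u t 0 i| <= M.
  have [M MP] := log_solution_bounded I_ge0 rs_const alphachi (u 0).
  by exists M => t i t0; apply: (MP half_line u) => //; exact: half_line_initial.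
move=> t Dt; have t0 : 0 <= t by case: Dt.
suff adm : admissible T I (r t).
  by split=> // i; rewrite flow_fieldE//; have [] := sol t Dt.
apply: contrapT; rewrite -ru// => bad.
have adm0 : admissible T I (map_mx expR (u 0)) by rewrite ru// rE.
have [tau [tau0 flow sing]] := first_exit_removable I_ge0 lsol adm0 t0 bad uM.
by apply: (regular tau0 flow) sing; rewrite ru.
Qed.

Lemma flow_exists : exists_for_all_time (flow_solution T I alpha) r0.
Proof.
have [[r [sol rE]] ext] := ext_flow_exists I_ge0 rs_const r0_adm.1 alphachi.
split; first by exists r; split=> //; exact: ext_flow_admissible.
move=> tau r' tau0 sol' rE'.
have [r1 [sol1 rE1]] := ext tau r' tau0 (flow_solution_ext I_ge0 sol') rE'.
exists r1; split=> //; apply: ext_flow_admissible => //.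
by rewrite rE1// /time_interval /=; split.
Qed.

(** The limit is admissible, so every triangle inequality is strict there; by continuity none can
    degenerate along times tending to infinity. *)
Lemma flow_converges : exists c : R,
  [/\ 0 < c, alpha_size alpha (c *: rs) = alpha_size alpha r0 &
    forall r : R -> 'rV[R]_N, flow_solution T I alpha +oo%E r -> r 0 = r0 ->
      converges_exponentially r (c *: rs) /\ ~ removable_singularity T I r +oo%E].
Proof.
have [c [v [c0 vE v_adm size_eq H]]] := ext_flow_converges I_ge0 rs_const r0_adm.1 alphachi.
exists c; split=> // r sol rE.
have conv := H r (flow_solution_ext I_ge0 sol) rE; split=> //.
apply: (@no_removable_at_limit _ _ _ _ _ _ (c *: rs)); first by rewrite -vE.
move=> t_ [Dt /cvgeryP tcv] l.
suff rcv : r t 0 l @[t --> +oo%R] --> (c *: rs) 0 l.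
  exact: (@cvg_comp _ _ _ t_ (fun s => r s 0 l) _ _ _ tcv rcv).
have [C [lam [lam0 CP]]] := conv.
have lamt : lam * t @[t --> +oo%R] --> +oo%R by apply: gt0_cvgMry => //; exact: cvg_id.
have ecv : C * expR (- (lam * t)) @[t --> +oo%R] --> 0.
  rewrite -(mulr0 C); apply: cvgM; first exact: cvg_cst.
  exact: cvg_comp lamt (@cvgr_expR R).
apply/cvgrPdist_le => e e0.
apply: filterS2 (cvgr_dist_lt _ _ ecv _ e0) (nbhs_pinfty_ge (num_real (0 : R))) => t Ct t0.
rewrite distrC; apply: le_trans (CP t l t0) _.
by move: Ct; rewrite sub0r normrN => /ltW; apply: le_trans; exact: ler_norm.
Qed.

End Target.
End Limits.

Theorem theorem5p4 (R : realType) (N : nat) (T : triangulation N)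
    (I : {set 'I_N} -> R) (alpha : R)
    (I_ge0 : forall e, e \in edges T -> 0 <= I e) :
  (* (1) *)
  ((forall (r : 'rV[R]_N) (i : 'I_N), admissible T I r ->
      (forall j, derivable (curvature_log T I i) (map_mx (@ln R) r)
                           (delta_mx 0 j)) /\
      forall f : 'I_N -> R,
        alpha_laplace T I alpha r f i =
        (r 0 i `^ alpha)^-1 *
          \sum_(j | adj_vertices T j i) (- dcurvature T I r i j) * (f j - f i)) /\
   (forall (tau : \bar R) (r : R -> 'rV[R]_N), (0 < tau)%E ->
      flow_solution T I alpha tau r ->
      forall t i, time_interval tau t ->
        derivative_within (time_interval tau)
          (fun s => alpha_curvature T I alpha (r s) i) t
          (alpha_laplace T I alpha (r t) (alpha_curvature T I alpha (r t)) i
           + alpha * alpha_curvature T I alpha (r t) i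
             * (alpha_curvature T I alpha (r t) i
                - average_curvature T alpha (r t)))))
  /\
  (* (2) *)
  (forall (r : R -> 'rV[R]_N) (rs : 'rV[R]_N),
     flow_solution T I alpha +oo%E r -> admissible T I rs ->
     r t @[t --> +oo%R] --> rs ->
     (exists r' : 'rV[R]_N, constant_alpha_curvature T I alpha r') /\
     constant_alpha_curvature T I alpha rs)
  /\
  (* (3) *)
  (alpha * (euler_char T)%:~R <= 0 ->
   forall rs : 'rV[R]_N, constant_alpha_curvature T I alpha rs ->
   (forall (tau : \bar R) (r : R -> 'rV[R]_N), (0 < tau)%E ->
      flow_solution T I alpha tau r -> ~ essential_singularity r tau) /\
   (forall r0 : 'rV[R]_N, admissible T I r0 ->
      (forall (tau : R) (r : R -> 'rV[R]_N), 0 < tau ->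
         flow_solution T I alpha tau%:E r -> r 0 = r0 ->
         ~ removable_singularity T I r tau%:E) ->
      exists_for_all_time (flow_solution T I alpha) r0 /\
      exists c : R,
        [/\ 0 < c, alpha_size alpha (c *: rs) = alpha_size alpha r0 &
          forall r : R -> 'rV[R]_N, flow_solution T I alpha +oo%E r ->
            r 0 = r0 ->
            converges_exponentially r (c *: rs) /\
            ~ removable_singularity T I r +oo%E]))
  /\
  (* (4) *)
  (alpha * (euler_char T)%:~R <= 0 ->
   forall rs : 'rV[R]_N, constant_alpha_curvature T I alpha rs ->
   forall r0 : 'rV[R]_N, positive_radii r0 ->
     exists_for_all_time (ext_flow_solution T I alpha) r0 /\
     exists c : R,
       [/\ 0 < c, alpha_size alpha (c *: rs) = alpha_size alpha r0 &
         forall r : R -> 'rV[R]_N, ext_flow_solution T I alpha +oo%E r ->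
           r 0 = r0 -> converges_exponentially r (c *: rs)]).
Proof.
split.
  split.
    move=> r i adm; split=> [j|f]; first exact: derivable_curvature_log.
    exact: alpha_laplace_adjacent.
  by move=> tau r _ sol t i Dt; exact: dw_alpha_curvature.
split.
  move=> r rs sol adm cv; have H := flow_limit_constant I_ge0 sol adm cv.
  by split=> //; exists rs.
split=> [alphachi rs rs_const|alphachi rs rs_const r0 r00].
  split=> [tau r tau0 sol|r0 r0_adm regular].
    exact: (no_essential_singularity I_ge0 rs_const alphachi tau0 (flow_solution_ext I_ge0 sol)).
  by split; [exact: (flow_exists I_ge0 rs_const)|exact: flow_converges].
split; first exact: (ext_flow_exists I_ge0 rs_const).
have [c [v [c0 _ _ size_eq H]]] := ext_flow_converges I_ge0 rs_const r00 alphachi.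
by exists c.
Qed.
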